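(* Let $p,q,l_1,l_2$ be positive integers with $p<q$, and put $$\alpha=\left(\frac{p}{q}\right)^{\frac{l_2}{l_1}},\qquad l=\left(\frac{p}{q}\right)^{\frac{l_2}{l_1}-1},$$ so that $0<\alpha<1$ and $\alpha=\frac{p}{q}\,l$. Let $f_{(\alpha,l)}(x)$, $x>0$, denote the one-sided L\'evy stable density of index $\alpha$ (described in the context). Then: (i) If $l$ is not a positive integer and $l_1\neq l_2$, then $$f_{(\alpha,l)}(x)=\frac{l\sqrt{pq}}{x(2\pi)^{\frac{q-p}{2}}}\,H^{q,0}_{p,q}\left[\frac{p^{pl}}{x^{pl}q^{q}}\,\Big|\,{}^{(1,l),\left(\frac{1}{p},l\right),\dots,\left(\frac{p-1}{p},l\right)}_{(1,1),\left(\frac{1}{q},1\right),\dots,\left(\frac{q-1}{q},1\right)}\right]$$ $$=\frac{l\sqrt{pq}}{x(2\pi)^{\frac{q-p}{2}}}\left(\frac{p^{lp}}{x^{lp}q^{q}}\right){}_{q-1}\Psi_{p}\left[-\frac{p^{pl}}{x^{pl}q^{q}}\,\Big|\,{}^{\left(-\frac{q-1}{q},-1\right),\dots,\left(-\frac{2}{q},-1\right),\left(-\frac{1}{q},-1\right)}_{(1-l,-l),\left(\frac{q-plq}{pq},-l\right),\dots,\left(\frac{(p-1)q-plq}{pq},-l\right)}\right]$$ $$+\frac{l\sqrt{pq}}{x(2\pi)^{\frac{q-p}{2}}}\sum_{j=1}^{q-1}\left(\frac{p^{jl\frac{p}{q}}}{x^{jl\frac{p}{q}}q^{j}}\right){}_{q-1}\Psi_{p}\left[-\frac{p^{pl}}{x^{pl}q^{q}}\,\Big|\,{}^{\left(1-\left[\frac{j}{q}\right]_{q},-1\right),\left(\frac{2}{q}-\left[\frac{j}{q}\right]_{2},-1\right),\left(\frac{3}{q}-\left[\frac{j}{q}\right]_{3},-1\right),\dots,\left(\frac{q-1}{q}-\left[\frac{j}{q}\right]_{q-1},-1\right)}_{\left(\frac{pq-jpl}{pq},-l\right),\left(\frac{q-jpl}{pq},-l\right),\dots,\left(\frac{(p-1)q-jpl}{pq},-l\right)}\right].$$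 (ii) If $l=1$ and $l_1=l_2$ (so $\alpha=p/q$), then $$f_{(\alpha,1)}(x)=\frac{\sqrt{pq}}{x(2\pi)^{\frac{q-p}{2}}}\,H^{q-1,0}_{p-1,q-1}\left[\frac{p^{p}}{x^{p}q^{q}}\,\Big|\,{}^{\left(\frac{1}{p},1\right),\dots,\left(\frac{p-1}{p},1\right)}_{\left(\frac{1}{q},1\right),\dots,\left(\frac{q-1}{q},1\right)}\right]$$ $$=\frac{\sqrt{pq}}{x(2\pi)^{\frac{q-p}{2}}}\sum_{j=1}^{q-1}\left(\frac{p^{j\frac{p}{q}}}{x^{j\frac{p}{q}}q^{j}}\right)\frac{\prod_{i_1=2}^{q-1}\Gamma\!\left(\frac{i_1}{q}-\left[\frac{j}{q}\right]_{i_1}\right)}{\prod_{i_2=1}^{p-1}\Gamma\!\left(\frac{i_2q-jp}{pq}\right)}\;{}_{p-1}F_{q-2}\!\left(1-\tfrac{q-jp}{pq},\dots,1-\tfrac{(p-1)q-jp}{pq};\;1-\tfrac{2}{q}+\left[\tfrac{j}{q}\right]_{2},\dots,1-\tfrac{q-1}{q}+\left[\tfrac{j}{q}\right]_{q-1};\;(-1)^{q-p}\frac{p^{p}}{x^{p}q^{q}}\right),$$ where empty products equal $1$. (iii) If $l\in\{2,3,4,\dots\}$ and $l_1\neq l_2$, then $$f_{(\alpha,l)}(x)=\frac{\sqrt{pql}}{x(2\pi)^{\frac{q+1-p-l}{2}}}\,H^{q-1,0}_{p+l-2,q-1}\left[\frac{p^{pl}l^{l}}{x^{pl}q^{q}}\,\Big|\,{}^{\left(\frac{1}{l},1\right),\dots,\left(\frac{l-1}{l},1\right),\left(\frac{1}{p},l\right),\dots,\left(\frac{p-1}{p},l\right)}_{\left(\frac{1}{q},1\right),\dots,\left(\frac{q-1}{q},1\right)}\right]$$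 $$=\frac{\sqrt{pql}}{x(2\pi)^{\frac{q+1-l-p}{2}}}\sum_{j=1}^{q-1}\left(\frac{p^{jl\frac{p}{q}}\,l^{j\frac{l}{q}}}{x^{jl\frac{p}{q}}q^{j}}\right){}_{q-2}\Psi_{p-1+l-1}\left[-\frac{p^{pl}l^{l}}{x^{pl}q^{q}}\,\Big|\,{}^{\left(\frac{2}{q}-\left[\frac{j}{q}\right]_{2},-1\right),\left(\frac{3}{q}-\left[\frac{j}{q}\right]_{3},-1\right),\dots,\left(\frac{q-1}{q}-\left[\frac{j}{q}\right]_{q-1},-1\right)}_{\left(\frac{q-jl}{lq},-1\right),\dots,\left(\frac{(l-1)q-jl}{lq},-1\right),\left(\frac{q-jpl}{pq},-l\right),\dots,\left(\frac{(p-1)q-jpl}{pq},-l\right)}\right].$$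
   Context: One-sided L\'evy stable density: for $0<\alpha<1$ and $x>0$, $f_\alpha(x)=\frac{1}{2\pi i}\int_L \frac{\Gamma\left(\frac{1}{\alpha}-\frac{s}{\alpha}\right)}{\alpha\,\Gamma(1-s)}x^{-s}\,ds$ (with $L$ a vertical line $0<\mathrm{Re}(s)<\alpha$); this is the probability density on $(0,\infty)$ whose Laplace transform is $e^{-t^{\alpha}}$. When $\alpha=(p/q)^{l_2/l_1}$ and $l=(p/q)^{l_2/l_1-1}$, this density is written $f_{(\alpha,l)}$. Fox $H$-function: for $z>0$, $H^{m,n}_{P,Q}\left[z\,\big|\,{}^{(a_1,A_1),\dots,(a_P,A_P)}_{(b_1,B_1),\dots,(b_Q,B_Q)}\right]=\frac{1}{2\pi i}\int_L\frac{\prod_{j=1}^{m}\Gamma(b_j+B_js)\prod_{j=1}^{n}\Gamma(1-a_j-A_js)}{\prod_{j=m+1}^{Q}\Gamma(1-b_j-B_js)\prod_{j=n+1}^{P}\Gamma(a_j+A_js)}z^{-s}\,ds$, with $L$ the standard Mellin–Barnes contour separating the poles of the $\Gamma(b_j+B_js)$ from those of the $\Gamma(1-a_j-A_js)$. Generalized Wright function: ${}_P\Psi_Q\left[z\,\big|\,{}^{(a_1,A_1),\dots,(a_P,A_P)}_{(b_1,B_1),\dots,(b_Q,B_Q)}\right]=\sum_{n=0}^{\infty}\frac{\prod_{i=1}^{P}\Gamma(a_i+A_in)}{\prod_{j=1}^{Q}\Gamma(b_j+B_jn)\,n!}z^{n}$, with $A_i,B_j$ nonzero reals. Generalized hypergeometric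 series: ${}_PF_Q(a_1,\dots,a_P;b_1,\dots,b_Q;z)=\sum_{n=0}^{\infty}\frac{\prod_{i=1}^{P}(a_i)_n}{\prod_{j=1}^{Q}(b_j)_n\,n!}z^{n}$, where $(b)_n=b(b+1)\cdots(b+n-1)$, $(b)_0=1$. L\'evy jump function: for positive integers $j,n$ and the fixed $q$, $\left[\frac{j}{q}\right]_n=\frac{j}{q}$ if $j<n$, and $\left[\frac{j}{q}\right]_n=\frac{j+1}{q}$ if $j\ge n$. *)

(* Defs.v *)
From Stdlib Require Import Reals List Factorial.
From Coquelicot Require Import Coquelicot.
Import ListNotations.
Open Scope R_scope.

Definition cpow (x : R) (s : C) : C :=
  (exp (Re s * ln x) * cos (Im s * ln x), exp (Re s * ln x) * sin (Im s * ln x)).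

Definition prodC (l : list C) : C := fold_right Cmult (RtoC 1) l.
Definition sumC (l : list C) : C := fold_right Cplus (RtoC 0) l.
Definition prodR (l : list R) : R := fold_right Rmult 1 l.

Definition Clim_seq (u : nat -> C) : C :=
  (real (Lim_seq (fun n => Re (u n))), real (Lim_seq (fun n => Im (u n)))).

(** Reciprocal Gamma function (entire), via Euler–Gauss:
    1/Γ(z) = lim_n z(z+1)...(z+n) / (n! n^z). *)
Definition rgammaC (z : C) : C :=
  Clim_seq (fun n =>
    Cdiv (prodC (map (fun k => Cplus z (RtoC (INR k))) (seq 0 (S n))))
         (Cmult (RtoC (INR (fact n))) (cpow (INR n) z))).

Definition GammaC (z : C) : C := Cinv (rgammaC z).

(** Mellin–Barnes integral along the vertical line Re s = c:
    (1/(2πi)) ∫_{c-i∞}^{c+i∞} F(s) ds = (1/(2π)) ∫_{-∞}^{∞} F(c+it) dt. *)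
Definition MB_line (F : C -> C) (c : R) : C :=
  Cmult (RtoC (/ (2 * PI)))
        (RInt_gen (V := C_R_CompleteNormedModule) (fun t => F (c, t))
                  (Rbar_locally m_infty) (Rbar_locally p_infty)).

(** One-sided Lévy stable density, Mellin–Barnes definition with contour Re s = c
    (0 < c < α):  (1/2πi) ∫ Γ(1/α - s/α) / (α Γ(1-s)) x^{-s} ds. *)
Definition levy (alpha c x : R) : C :=
  MB_line (fun s =>
     Cmult (Cmult (GammaC (Cminus (RtoC (/ alpha)) (Cdiv s (RtoC alpha))))
                  (Cdiv (rgammaC (Cminus (RtoC 1) s)) (RtoC alpha)))
           (cpow x (Copp s))) c.

(** Fox H-function H^{m,n}_{P,Q}[z | (a_j,A_j) ; (b_j,B_j)], P = length a, Q = length b,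
    with contour the vertical line Re s = c.  Division by Γ is written as
    multiplication by the reciprocal Gamma function. *)
Definition Hfox (m n : nat) (a b : list (R * R)) (c z : R) : C :=
  MB_line (fun s =>
    Cmult (Cmult (Cmult (Cmult
      (prodC (map (fun pr => GammaC (Cplus (RtoC (fst pr)) (Cmult (RtoC (snd pr)) s))) (firstn m b)))
      (prodC (map (fun pr => GammaC (Cminus (Cminus (RtoC 1) (RtoC (fst pr))) (Cmult (RtoC (snd pr)) s))) (firstn n a))))
      (prodC (map (fun pr => rgammaC (Cminus (Cminus (RtoC 1) (RtoC (fst pr))) (Cmult (RtoC (snd pr)) s))) (skipn m b))))
      (prodC (map (fun pr => rgammaC (Cplus (RtoC (fst pr)) (Cmult (RtoC (snd pr)) s))) (skipn n a))))
      (cpow z (Copp s))) c.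

(** The vertical line Re s = c is a Mellin–Barnes contour separating the poles of
    the Γ(b_j + B_j s), j ≤ m, from those of the Γ(1 - a_j - A_j s), j ≤ n
    (for positive A_j, B_j). *)
Definition H_contour (m n : nat) (a b : list (R * R)) (c : R) : Prop :=
  (forall pr, In pr (firstn m b) -> 0 < fst pr + snd pr * c) /\
  (forall pr, In pr (firstn n a) -> 0 < 1 - fst pr - snd pr * c).

Definition CSeries (u : nat -> C) : C :=
  (Series (fun n => Re (u n)), Series (fun n => Im (u n))).

Definition Wright (a b : list (R * R)) (z : R) : C :=
  CSeries (fun n =>
    Cmult (Cmult
      (prodC (map (fun pr => GammaC (RtoC (fst pr + snd pr * INR n))) a))
      (prodC (map (fun pr => rgammaC (RtoC (fst pr + snd pr * INR n))) b)))
      (RtoC (z ^ n / INR (fact n)))).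

Definition poch (x : R) (n : nat) : R := prodR (map (fun k => x + INR k) (seq 0 n)).
Definition hyperF (a b : list R) (z : R) : R :=
  Series (fun n => prodR (map (fun x => poch x n) a) / prodR (map (fun x => poch x n) b)
                   / INR (fact n) * z ^ n).

Definition jump (q j n : nat) : R :=
  if Nat.ltb j n then INR j / INR q else (INR j + 1) / INR q.

(** Index range {lo, ..., hi} as a list (empty if hi < lo). *)
Definition range (lo hi : nat) : list nat := seq lo (S hi - lo).

Definition alpha_of (p q l1 l2 : nat) : R := Rpower (INR p / INR q) (INR l2 / INR l1).
Definition ell_of (p q l1 l2 : nat) : R := Rpower (INR p / INR q) (INR l2 / INR l1 - 1).

(* Main.v *)
(** All integrals in the statement are, after a linear change of variable, integrals of
    [Gamma(w) / Gamma(al w + b) * Y^w] over a line [Re w = c > 0], with [0 < al < 1]; the Gauss multiplication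
    formula turns the integrand of the Fox function into this form with [b = 1 - al], and the integrand of the
    stable density has this form with [b = 0].  Such an integral equals the sum of
    [(-1)^k / k! * Y^(-k) / Gamma(b - al k)], independently of [c].

    Only for Perron's integral of [Y^w / w] is a contour moved across a pole.  This integral and the recursion
    [F_(n+1)(w) = F_n(w) - F_n(w + 1)] for [F_n(w) = n! / (w (w+1) ... (w+n))] give the integrals of [F_n(w) Y^w];
    [n -> oo] gives the integral of [Gamma(w) Y^w]; [w Gamma(w) = Gamma(w + 1)] inserts any product of linear
    factors, in particular Gauss's approximants of [1 / Gamma(al w + b)]; and a second passage to the limit gives
    the claim.  The second limit is dominated because each factor
    [(1 + al^2 t^2/(al c + b + k)^2) / (1 + t^2/(c + k)^2)] of the squared modulus is at most [1], and is bounded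
    away from [1] for [1 <= k <= |t| - c].

    Splitting the sum over [k] by residue classes modulo [q], and rewriting each term by the multiplication
    formula taken at its poles, yields the Wright and hypergeometric series. *)

Require Import Defs.
From Stdlib Require Import Reals ZArith List Factorial Lra Lia Psatz FunctionalExtensionality.
From Coquelicot Require Import Coquelicot.
Import ListNotations.
Open Scope R_scope.

(** * The reciprocal Gamma function *)

(** Since [rgammaC] is defined by Gauss's products, everything about Gamma is extracted from them:
    they converge with error O(1/n), uniformly on discs. Working with the entire function 1/Gamma
    keeps poles out of the estimates.

    The two sides of an identity are never compared as integrals. Each is evaluated to a series, so
    any admissible line may be taken on either side. The series for b = 0 and b = 1 - al agree up to
    a factor: 1/Gamma(0) = 0 removes the term k = 0, and the functional equation shifts the rest.

    Perron's integrand is not absolutely integrable, so the calculus is built on limits of integrals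
    over [-T, T]; genuine improper integrals appear only once a majorant K / (1 + t^2) is known. The
    first approximants of Gamma decay too slowly for such a majorant, so the index of the
    approximants is shifted before the limit.

    The condition al < 1 acts twice: in the series, where (al k)^(al k) competes with k!, and on the
    line, where 1/Gamma(al w + b) must grow more slowly than 1/Gamma(w). *)

Lemma exp_le_mono (a b : R) : a <= b -> exp a <= exp b.
Proof. intros [L|L]; [left; apply exp_increasing; auto | right; f_equal; auto]. Qed.

Lemma continuity_cst (a : R) : continuity (fun _ => a).
Proof. apply continuity_const. intros x y. reflexivity. Qed.

Definition cexp (s : C) : C := (exp (Re s) * cos (Im s), exp (Re s) * sin (Im s)).

Lemma C_ext (a b : C) : Re a = Re b -> Im a = Im b -> a = b.
Proof. destruct a, b; simpl; intros; subst; reflexivity. Qed.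

Lemma Re_mult (a b : C) : Re (a * b)%C = Re a * Re b - Im a * Im b.
Proof. reflexivity. Qed.

Lemma Im_mult (a b : C) : Im (a * b)%C = Re a * Im b + Im a * Re b.
Proof. reflexivity. Qed.

Lemma Re_scal (r : R) (a : C) : Re (RtoC r * a)%C = r * Re a.
Proof. destruct a; simpl; ring. Qed.

Lemma Im_scal (r : R) (a : C) : Im (RtoC r * a)%C = r * Im a.
Proof. destruct a; simpl; ring. Qed.

Lemma cpow_cexp (x : R) (s : C) : cpow x s = cexp (s * RtoC (ln x)).
Proof.
  unfold cpow, cexp. rewrite Re_mult, Im_mult; simpl.
  f_equal; f_equal; f_equal; ring.
Qed.

Lemma cexp_add (a b : C) : cexp (a + b) = (cexp a * cexp b)%C.
Proof.
  apply C_ext; unfold cexp; simpl; rewrite exp_plus, ?cos_plus, ?sin_plus;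
    unfold Re, Im; ring.
Qed.

Lemma cexp_0 : cexp 0 = RtoC 1.
Proof. unfold cexp; simpl. rewrite exp_0, cos_0, sin_0. apply C_ext; simpl; ring. Qed.

Lemma cexp_R (r : R) : cexp (RtoC r) = RtoC (exp r).
Proof. unfold cexp; simpl. rewrite cos_0, sin_0. apply C_ext; simpl; ring. Qed.

Lemma Cmod_cexp (s : C) : Cmod (cexp s) = exp (Re s).
Proof.
  unfold Cmod, cexp; simpl.
  replace (_ + _) with (exp (Re s) * exp (Re s) * ((sin (Im s))² + (cos (Im s))²))
    by (unfold Rsqr; ring).
  rewrite sin2_cos2, Rmult_1_r. apply sqrt_square, Rlt_le, exp_pos.
Qed.

Lemma cexp_neq_0 (s : C) : cexp s <> 0%C.
Proof. apply Cmod_gt_0. rewrite Cmod_cexp. apply exp_pos. Qed.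

Lemma cexp_opp (s : C) : cexp (- s) = (/ cexp s)%C.
Proof.
  assert (H := cexp_add (- s) s).
  replace (- s + s)%C with (RtoC 0) in H by ring. rewrite cexp_0 in H.
  rewrite <- (Cmult_1_r (cexp (- s))), <- (Cinv_r (cexp s)) by apply cexp_neq_0.
  rewrite Cmult_assoc, <- H. ring.
Qed.

Lemma cpow_neq_0 (x : R) (s : C) : cpow x s <> 0%C.
Proof. rewrite cpow_cexp. apply cexp_neq_0. Qed.

Lemma Cmod_cpow (x : R) (s : C) : Cmod (cpow x s) = exp (Re s * ln x).
Proof. rewrite cpow_cexp, Cmod_cexp. f_equal. destruct s; simpl; ring. Qed.

Lemma cpow_add (x : R) (a b : C) : cpow x (a + b) = (cpow x a * cpow x b)%C.
Proof. rewrite !cpow_cexp, <- cexp_add. f_equal. ring. Qed.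

Lemma cpow_mult (x y : R) (a : C) :
  0 < x -> 0 < y -> cpow (x * y) a = (cpow x a * cpow y a)%C.
Proof.
  intros. rewrite !cpow_cexp, <- cexp_add, ln_mult by auto.
  f_equal. rewrite RtoC_plus. ring.
Qed.

Lemma cpow_R (x r : R) : cpow x (RtoC r) = RtoC (Rpower x r).
Proof. rewrite cpow_cexp, <- RtoC_mult, cexp_R. reflexivity. Qed.

Lemma Cmod_Re_Im (a : C) : Cmod a <= Rabs (Re a) + Rabs (Im a).
Proof.
  destruct a as [x y]. unfold Cmod; simpl.
  rewrite <- (sqrt_square (Rabs x + Rabs y)).
  2: { assert (H := Rabs_pos x). assert (H' := Rabs_pos y). lra. }
  apply sqrt_le_1_alt.
  assert (H := Rabs_pos x). assert (H' := Rabs_pos y).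
  assert (Hx : x * x = Rabs x * Rabs x) by (rewrite <- Rabs_mult, Rabs_pos_eq; nra).
  assert (Hy : y * y = Rabs y * Rabs y) by (rewrite <- Rabs_mult, Rabs_pos_eq; nra).
  nra.
Qed.

Lemma Rabs_Im_le (a : C) : Rabs (Im a) <= Cmod a.
Proof. eapply Rle_trans; [apply Rmax_r | apply Rmax_Cmod]. Qed.

Lemma Rabs_sin_le (b : R) : Rabs (sin b) <= Rabs b.
Proof.
  destruct (MVT_gen sin 0 b cos) as [x [_ H]].
  - intros. apply is_derive_Reals, derivable_pt_lim_sin.
  - intros. apply continuity_sin.
  - rewrite sin_0 in H. replace (sin b) with (cos x * b) by lra.
    rewrite Rabs_mult. assert (Rabs (cos x) <= 1) by apply Rabs_le, COS_bound.
    assert (Hb := Rabs_pos b). nra.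
Qed.

Lemma Rabs_cos_minus_1_le (b : R) : Rabs (cos b - 1) <= b ^ 2 / 2.
Proof.
  assert (H : 1 - cos b = 2 * (sin (b / 2))^2).
  { replace (cos b) with (cos (2 * (b / 2))) by (f_equal; field).
    rewrite cos_2a_sin. ring. }
  assert (H1 := Rabs_sin_le (b / 2)).
  assert (H2 : (sin (b/2))^2 <= (b/2)^2).
  { rewrite <- (pow2_abs (sin _)), <- (pow2_abs (b/2)). apply pow_incr. split; auto.
    apply Rabs_pos. }
  assert (H0 := pow2_ge_0 (sin (b/2))).
  rewrite Rabs_left1; nra.
Qed.

Lemma Rabs_sin_minus_id_le (b : R) : Rabs (sin b - b) <= b ^ 2.
Proof.
  destruct (MVT_gen (fun b => sin b - b) 0 b (fun x => cos x - 1)) as [x [Hx H]].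
  - intros. auto_derive; auto; ring.
  - intros. apply continuity_pt_minus; [apply continuity_sin | apply derivable_continuous, derivable_id].
  - rewrite sin_0 in H. replace (sin b - b) with ((cos x - 1) * b) by lra.
    rewrite Rabs_mult, <- (pow2_abs b).
    assert (Hx' : Rabs x <= Rabs b).
    { unfold Rmin, Rmax in Hx. destruct (Rle_dec 0 b).
      - rewrite !Rabs_pos_eq; lra. - rewrite !Rabs_left1; lra. }
    assert (H0 := Rabs_pos x). assert (Hb := Rabs_pos b).
    assert (Rabs (cos x - 1) <= Rabs x).
    { destruct (MVT_gen cos 0 x (fun y => - sin y)) as [y [Hy H']].
      - intros. auto_derive; auto; ring.
      - intros. apply continuity_cos.
      - rewrite cos_0 in H'. rewrite H', Rabs_mult, Rabs_Ropp.
        assert (Rabs (sin y) <= 1) by apply Rabs_le, SIN_bound.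
        rewrite Rminus_0_r. nra. }
    nra.
Qed.

Lemma exp_minus_1_le (a : R) : Rabs (exp a - 1) <= Rabs a * exp (Rabs a).
Proof.
  assert (H1 := exp_ineq1_le a). assert (H2 := exp_ineq1_le (- a)).
  assert (H3 : exp a * exp (- a) = 1) by (rewrite <- exp_plus, Rplus_opp_r; apply exp_0).
  assert (H4 := exp_pos a).
  destruct (Rle_dec 0 a).
  - rewrite (Rabs_pos_eq a) by lra. rewrite Rabs_pos_eq by lra. nra.
  - rewrite (Rabs_left1 a) by lra.
    assert (1 <= exp (- a)) by lra.
    assert (exp a <= 1) by nra.
    rewrite Rabs_left1; nra.
Qed.

Lemma exp_minus_1_minus_id_le (a : R) : Rabs (exp a - 1 - a) <= a ^ 2 * exp (Rabs a).
Proof.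
  assert (H1 := exp_ineq1_le a). assert (H2 := exp_ineq1_le (- a)).
  assert (H3 : exp a * exp (- a) = 1) by (rewrite <- exp_plus, Rplus_opp_r; apply exp_0).
  assert (H4 := exp_pos a).
  rewrite Rabs_pos_eq by lra.
  assert (K : exp a - 1 <= a * exp a) by nra.
  destruct (Rle_dec 0 a).
  - rewrite (Rabs_pos_eq a) by lra.
    assert (a * (exp a - 1) <= a * (a * exp a)) by (apply Rmult_le_compat_l; lra). nra.
  - rewrite (Rabs_left1 a) by lra.
    assert (1 <= exp (- a)) by lra.
    assert (- a * (1 - exp a) <= - a * - a) by (apply Rmult_le_compat_l; lra).
    assert (a ^ 2 * 1 <= a ^ 2 * exp (- a)) by (apply Rmult_le_compat_l; nra). nra.
Qed.

(** With u = a + i b the real part is (e^a - 1 - a) + e^a (cos b - 1) and the imaginary part e^a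
    (sin b - b) + (e^a - 1) b, all of second order; the mixed product is absorbed by 2 |a| |b| <=
    |u|^2. *)
Lemma cexp_minus_1_minus_id_le (u : C) :
  Cmod (cexp u - 1 - u) <= 3 * Cmod u ^ 2 * exp (Cmod u).
Proof.
  destruct u as [a b]. set (m := Cmod (a, b)).
  assert (Ha : Rabs a <= m) by apply (re_le_Cmod (a, b)).
  assert (Hb : Rabs b <= m) by apply (Rabs_Im_le (a, b)).
  assert (Hm : m ^ 2 = a ^ 2 + b ^ 2) by apply Cmod2_alt.
  assert (HE : exp (Rabs a) <= exp m) by (apply exp_le_mono; lra).
  assert (HE0 : exp a <= exp m).
  { assert (a <= m) by (eapply Rle_trans; [apply Rle_abs | auto]).
    apply exp_le_mono; lra. }
  assert (Ep := exp_pos a). assert (Mp := exp_pos m).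
  eapply Rle_trans; [apply Cmod_Re_Im|].
  replace (Re (cexp (a, b) - 1 - (a, b))) with ((exp a - 1 - a) + exp a * (cos b - 1)) by (simpl; ring).
  replace (Im (cexp (a, b) - 1 - (a, b))) with (exp a * (sin b - b) + (exp a - 1) * b) by (simpl; ring).
  assert (H1 := exp_minus_1_minus_id_le a). assert (H2 := exp_minus_1_le a).
  assert (H3 := Rabs_cos_minus_1_le b). assert (H4 := Rabs_sin_minus_id_le b).
  assert (K1 := Rabs_triang (exp a - 1 - a) (exp a * (cos b - 1))).
  assert (K2 := Rabs_triang (exp a * (sin b - b)) ((exp a - 1) * b)).
  rewrite !Rabs_mult, (Rabs_pos_eq (exp a)) in * by lra.
  assert (Pa := Rabs_pos a). assert (Pb := Rabs_pos b).
  assert (a ^ 2 * exp (Rabs a) <= a ^ 2 * exp m) by (apply Rmult_le_compat_l; auto; nra).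
  assert (exp a * Rabs (cos b - 1) <= exp m * (b ^ 2 / 2))
    by (apply Rmult_le_compat; auto; try lra; apply Rabs_pos).
  assert (exp a * Rabs (sin b - b) <= exp m * b ^ 2)
    by (apply Rmult_le_compat; auto; try lra; apply Rabs_pos).
  assert (Rabs (exp a - 1) * Rabs b <= (Rabs a * exp m) * Rabs b).
  { apply Rmult_le_compat_r; auto. eapply Rle_trans; eauto. apply Rmult_le_compat_l; auto. }
  assert (2 * (Rabs a * Rabs b) <= m ^ 2).
  { rewrite Hm, <- (pow2_abs a), <- (pow2_abs b).
    assert (Hs := pow2_ge_0 (Rabs a - Rabs b)). lra. }
  fold m. rewrite Hm in *. nra.
Qed.

(** * Gauss's approximants of 1/Gamma and their rate of convergence *)

Definition rG (n : nat) (z : C) : C :=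
  Cdiv (prodC (map (fun k => Cplus z (RtoC (INR k))) (seq 0 (S n))))
       (Cmult (RtoC (INR (fact n))) (cpow (INR n) z)).

Lemma prodC_app (a b : list C) : prodC (a ++ b) = (prodC a * prodC b)%C.
Proof. induction a; simpl; [ring|]. rewrite IHa. unfold prodC; simpl. ring. Qed.

Lemma RtoC_neq_0 (r : R) : r <> 0 -> RtoC r <> 0%C.
Proof. intros H E. apply H. apply (f_equal Re) in E. exact E. Qed.

Lemma INR_S_pos (n : nat) : 0 < INR (S n).
Proof. apply lt_0_INR. lia. Qed.

(** The factors of Euler's product, (1 + z/N') (N/N')^z with N' = N + 1. At n = 0 the power n^z is
    only a default value ([ln 0] is 0), so this and the estimates below speak of [rG (S n)]. *)
Lemma rG_succ (n : nat) (z : C) :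
  rG (S (S n)) z =
  (rG (S n) z * ((1 + z / RtoC (INR (S (S n)))) * cexp (- (z * RtoC (ln (INR (S (S n)) / INR (S n)))))))%C.
Proof.
  unfold rG. rewrite (seq_S (S (S n))), map_app, prodC_app. cbn [map prodC fold_right Nat.add].
  set (p := prodC _).
  change (fact (S (S n))) with ((S (S n)) * fact (S n))%nat.
  rewrite mult_INR, RtoC_mult, cexp_opp.
  assert (H1 := INR_S_pos n). assert (H2 := INR_S_pos (S n)).
  assert (E : cpow (INR (S (S n))) z = (cpow (INR (S n)) z * cexp (z * RtoC (ln (INR (S (S n)) / INR (S n)))))%C).
  { rewrite !cpow_cexp, <- cexp_add. f_equal. rewrite ln_div by auto. rewrite RtoC_minus. ring. }
  rewrite E. field.
  repeat split; try apply cexp_neq_0; try apply cpow_neq_0; apply RtoC_neq_0; try lra.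
  apply INR_fact_neq_0.
Qed.

Lemma ln_succ_div_bounds (n : nat) :
  / INR (S (S n)) <= ln (INR (S (S n)) / INR (S n)) <= / INR (S n).
Proof.
  assert (H1 := INR_S_pos n). assert (H2 := INR_S_pos (S n)).
  assert (E : INR (S (S n)) = INR (S n) + 1) by (rewrite (S_INR (S n)); ring).
  split.
  - rewrite <- (Ropp_involutive (ln _)), <- ln_Rinv by (apply Rdiv_lt_0_compat; auto).
    assert (/ (INR (S (S n)) / INR (S n)) = 1 + - / INR (S (S n))).
    { rewrite E. field. lra. }
    rewrite H. assert (Hx := exp_ineq1_le (- / INR (S (S n)))).
    assert (0 < 1 + - / INR (S (S n))).
    { rewrite <- H. apply Rinv_0_lt_compat, Rdiv_lt_0_compat; auto. }
    assert (ln (1 + - / INR (S (S n))) <= - / INR (S (S n))).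
    { eapply Rle_trans; [apply ln_le; [auto | apply Hx] |]. rewrite ln_exp; lra. }
    lra.
  - replace (INR (S (S n)) / INR (S n)) with (1 + / INR (S n)) by (rewrite E; field; lra).
    rewrite <- (ln_exp (/ INR (S n))) at 2. apply ln_le.
    + assert (0 < / INR (S n)) by (apply Rinv_0_lt_compat; auto). lra.
    + apply exp_ineq1_le.
Qed.

Lemma Cmod_triangle_minus (a b : C) : Cmod (a - b) <= Cmod a + Cmod b.
Proof. eapply Rle_trans; [apply Cmod_triangle|]. rewrite Cmod_opp. lra. Qed.

(** Constant of the O(1/N^2) estimate for one factor on the disc of radius r. The summands come from
    the remainder of the exponential, from z (1/N' - h) and from z^2 h / N', where h = ln (N'/N). *)
Definition rG_rate (r : R) : R := (1 + r) * (3 * r ^ 2 * exp r) + r + r ^ 2.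

Lemma rG_rate_pos (r : R) : 0 <= r -> 0 <= rG_rate r.
Proof.
  intros. unfold rG_rate. assert (H1 := exp_pos r).
  assert (0 <= 3 * r ^ 2 * exp r) by (apply Rmult_le_pos; nra). nra.
Qed.

Lemma rG_factor_bound (r : R) (z : C) (n : nat) : Cmod z <= r ->
  Cmod ((1 + z / RtoC (INR (S (S n)))) * cexp (- (z * RtoC (ln (INR (S (S n)) / INR (S n))))) - 1)
  <= rG_rate r / INR (S n) ^ 2.
Proof.
  intros Hz.
  assert (H1 := INR_S_pos n). assert (H2 := INR_S_pos (S n)).
  assert (E : INR (S (S n)) = INR (S n) + 1) by (rewrite (S_INR (S n)); ring).
  assert (Hone : 1 <= INR (S n)) by (rewrite S_INR; assert (H := pos_INR n); lra).
  destruct (ln_succ_div_bounds n) as [L1 L2].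
  set (h := ln _) in *. set (N := INR (S n)) in *. set (N' := INR (S (S n))) in *.
  assert (Hi : / N' = / (N + 1)) by (rewrite E; auto).
  assert (Hn0 : 0 < / N) by (apply Rinv_0_lt_compat; auto).
  assert (Hn1 : / N <= 1) by (rewrite <- Rinv_1; apply Rinv_le_contravar; lra).
  assert (Hn'0 : 0 < / N') by (apply Rinv_0_lt_compat; auto).
  assert (Hnn : / N' <= / N) by (apply Rinv_le_contravar; lra).
  assert (Hd : / N - / N' <= (/ N) ^ 2).
  { assert (Hd' : / N - / N' = / N * / N') by (rewrite Hi; field; lra). rewrite Hd'. nra. }
  assert (Z0 := Cmod_ge_0 z).
  set (u := (- (z * RtoC h))%C).
  assert (Hu : Cmod u <= r * / N).
  { unfold u. rewrite Cmod_opp, Cmod_mult, Cmod_R, Rabs_pos_eq by lra.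
    apply Rmult_le_compat; lra. }
  assert (U0 := Cmod_ge_0 u).
  (* The first-order terms z / N' and u = - z h nearly cancel: their sum z (1/N' - h) is already of
     order 1/N^2. *)
  replace ((1 + z / RtoC N') * cexp u - 1)%C
    with ((1 + z * RtoC (/ N')) * (cexp u - 1 - u) + (z * RtoC (/ N' - h) - z * z * RtoC (h * / N')))%C.
  2: { unfold Cdiv. rewrite <- RtoC_inv by lra. rewrite RtoC_minus, RtoC_mult. unfold u. ring. }
  eapply Rle_trans; [apply Cmod_triangle|].
  rewrite Cmod_mult.
  assert (B1 : Cmod (1 + z * RtoC (/ N')) <= 1 + r).
  { eapply Rle_trans; [apply Cmod_triangle|]. rewrite Cmod_1, Cmod_mult, Cmod_R, Rabs_pos_eq by lra. nra. }
  assert (B2 : Cmod (cexp u - 1 - u) <= 3 * (r * / N) ^ 2 * exp r).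
  { eapply Rle_trans; [apply cexp_minus_1_minus_id_le|].
    apply Rmult_le_compat.
    - assert (0 <= Cmod u ^ 2) by nra. lra.
    - apply Rlt_le, exp_pos.
    - apply Rmult_le_compat_l; [lra|]. apply pow_incr; lra.
    - assert (Cmod u <= r) by nra. apply exp_le_mono; lra. }
  assert (B3 : Cmod (z * RtoC (/ N' - h) - z * z * RtoC (h * / N')) <= r * (/ N) ^ 2 + r ^ 2 * (/ N) ^ 2).
  { eapply Rle_trans; [apply Cmod_triangle_minus|].
    rewrite !Cmod_mult, !Cmod_R, (Rabs_left1 (/ N' - h)), (Rabs_pos_eq (h * / N')) by nra.
    apply Rplus_le_compat.
    - apply Rmult_le_compat; lra.
    - apply Rmult_le_compat; nra. }
  apply Rle_trans with ((1 + r) * (3 * (r * / N) ^ 2 * exp r) + (r * (/ N) ^ 2 + r ^ 2 * (/ N) ^ 2)).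
  - apply Rplus_le_compat; auto. apply Rmult_le_compat; auto; apply Cmod_ge_0.
  - right. unfold rG_rate. field. lra.
Qed.

Lemma rG_1 (z : C) : rG 1 z = (z * (z + 1))%C.
Proof.
  unfold rG. simpl. rewrite cpow_cexp, ln_1.
  replace (z * RtoC 0)%C with (RtoC 0) by ring. rewrite cexp_0.
  replace (RtoC (1 + 0)) with (RtoC 1) by (f_equal; ring).
  replace (RtoC 1 * RtoC 1)%C with (RtoC 1) by ring. unfold Cdiv.
  rewrite <- RtoC_inv, Rinv_1 by lra. ring.
Qed.

Definition rG_bound (r : R) : R := r * (r + 1) * exp (2 * rG_rate r).

(** The product of the factors 1 + c/N^2 is controlled by the exponent 2c - 2c/N, which makes the
    induction close because c/N^2 <= 2c/N - 2c/(N + 1). It starts from [rG 1 z] = z (z + 1), whence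
    the r (r + 1) in [rG_bound]. *)
Lemma rG_bounded (r : R) (z : C) (n : nat) : Cmod z <= r -> Cmod (rG (S n) z) <= rG_bound r.
Proof.
  intros Hz. assert (Z0 := Cmod_ge_0 z).
  assert (Cp := rG_rate_pos r ltac:(lra)). set (c := rG_rate r) in *.
  assert (H : Cmod (rG (S n) z) <= r * (r + 1) * exp (2 * c - 2 * c / INR (S n))).
  { induction n.
    - rewrite rG_1. simpl. replace (2 * c - 2 * c / 1) with 0 by field. rewrite exp_0, Rmult_1_r, Cmod_mult.
      apply Rmult_le_compat; auto; try apply Cmod_ge_0.
      eapply Rle_trans; [apply Cmod_triangle|]. rewrite Cmod_1. lra.
    - rewrite rG_succ, Cmod_mult.
      assert (H := rG_factor_bound r z n Hz). fold c in H. set (D := Cmult (_ + _)%C _) in *.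
      assert (HD : Cmod D <= 1 + c / INR (S n) ^ 2).
      { replace D with ((D - 1) + 1)%C by ring. eapply Rle_trans; [apply Cmod_triangle|].
        rewrite Cmod_1. lra. }
      assert (H1 := INR_S_pos n). assert (H2 := INR_S_pos (S n)).
      assert (E : INR (S (S n)) = INR (S n) + 1) by (rewrite (S_INR (S n)); ring).
      assert (Hone : 1 <= INR (S n)) by (rewrite S_INR; assert (H' := pos_INR n); lra).
      replace (2 * c - 2 * c / INR (S (S n)))
        with ((2 * c - 2 * c / INR (S n)) + (2 * c / INR (S n) - 2 * c / INR (S (S n)))) by ring.
      rewrite exp_plus, <- Rmult_assoc.
      apply Rmult_le_compat; auto; try apply Cmod_ge_0.
      eapply Rle_trans; [apply HD|]. eapply Rle_trans; [|apply exp_ineq1_le].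
      apply Rplus_le_compat_l. rewrite E. set (N := INR (S n)) in *.
      apply Rminus_le.
      replace (c / N ^ 2 - (2 * c / N - 2 * c / (N + 1))) with (- (c * (N - 1) / (N ^ 2 * (N + 1)))) by (field; lra).
      assert (0 <= c * (N - 1) / (N ^ 2 * (N + 1))).
      { apply Rdiv_le_0_compat; [nra|]. apply Rmult_lt_0_compat; nra. }
      lra. }
  eapply Rle_trans; [apply H|]. unfold rG_bound. fold c.
  apply Rmult_le_compat_l; [nra|].
  assert (0 <= 2 * c / INR (S n)) by (apply Rdiv_le_0_compat; [lra | apply INR_S_pos]).
  assert (Hle : 2 * c - 2 * c / INR (S n) <= 2 * c) by lra.
  apply exp_le_mono; lra.
Qed.

Definition rG_err (r : R) : R := 2 * rG_bound r * rG_rate r.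

Lemma rG_err_pos (r : R) : 0 <= r -> 0 <= rG_err r.
Proof.
  intros. unfold rG_err, rG_bound. assert (H1 := rG_rate_pos r H).
  assert (H2 := exp_pos (2 * rG_rate r)).
  assert (0 <= r * (r + 1)) by nra.
  assert (0 <= r * (r + 1) * exp (2 * rG_rate r)) by (apply Rmult_le_pos; lra).
  apply Rmult_le_pos; lra.
Qed.

(** The increments are O(1/N^2) and telescope through 1/N^2 <= 2 (1/N - 1/(N + 1)), the origin of
    the factor 2 in [rG_err]. The constant depends on the disc only; this uniformity gives
    continuity and the local uniform convergence under the integrals. *)
Lemma rG_cauchy (r : R) (z : C) (n k : nat) : Cmod z <= r ->
  Cmod (rG (S (k + n)) z - rG (S n) z) <= rG_err r / INR (S n).
Proof.
  intros Hz. assert (Z0 := Cmod_ge_0 z).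
  assert (Ep := rG_err_pos r ltac:(lra)).
  assert (H : Cmod (rG (S (k + n)) z - rG (S n) z) <= rG_err r * (/ INR (S n) - / INR (S (k + n)))).
  { induction k.
    - simpl. replace (_ - _)%C with (RtoC 0) by ring. rewrite Cmod_0. lra.
    - change (S k + n)%nat with (S (k + n)). set (m := (k + n)%nat) in *.
      replace (rG (S (S m)) z - rG (S n) z)%C with
        ((rG (S (S m)) z - rG (S m) z) + (rG (S m) z - rG (S n) z))%C by ring.
      eapply Rle_trans; [apply Cmod_triangle|].
      assert (Hstep : Cmod (rG (S (S m)) z - rG (S m) z) <= rG_err r * (/ INR (S m) - / INR (S (S m)))).
      { rewrite rG_succ.
        match goal with |- Cmod (?a * ?D - ?a) <= _ => replace (a * D - a)%C with (a * (D - 1))%C by ring end.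
        rewrite Cmod_mult.
        apply Rle_trans with (rG_bound r * (rG_rate r / INR (S m) ^ 2)).
        - apply Rmult_le_compat; try apply Cmod_ge_0. apply rG_bounded; auto. apply rG_factor_bound; auto.
        - unfold rG_err.
          assert (H1 := INR_S_pos m).
          assert (E : INR (S (S m)) = INR (S m) + 1) by (rewrite (S_INR (S m)); ring).
          assert (Hone : 1 <= INR (S m)) by (rewrite S_INR; assert (H' := pos_INR m); lra).
          rewrite E. set (N := INR (S m)) in *. apply Rminus_le.
          match goal with |- ?x <= 0 =>
            replace x with (- (rG_err r / 2 * ((N - 1) / (N ^ 2 * (N + 1))))) by (unfold rG_err; field; lra) end.
          assert (0 <= (N - 1) / (N ^ 2 * (N + 1))).
          { apply Rdiv_le_0_compat; [nra|]. apply Rmult_lt_0_compat; nra. }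
          nra. }
      rewrite Rmult_minus_distr_l in *. lra. }
  eapply Rle_trans; [apply H|]. apply Rmult_le_compat_l; auto.
  assert (0 < / INR (S (k + n))) by (apply Rinv_0_lt_compat, INR_S_pos). lra.
Qed.

Definition Clim (u : nat -> C) (l : C) : Prop :=
  is_lim_seq (fun n => Re (u n)) (Re l) /\ is_lim_seq (fun n => Im (u n)) (Im l).

Lemma Clim_seq_eq (u : nat -> C) (l : C) : Clim u l -> Clim_seq u = l.
Proof.
  intros [H1 H2]. unfold Clim_seq.
  rewrite (is_lim_seq_unique _ _ H1), (is_lim_seq_unique _ _ H2). destruct l; reflexivity.
Qed.

Lemma Clim_unique (u : nat -> C) (l l' : C) : Clim u l -> Clim u l' -> l = l'.
Proof. intros H H'. rewrite <- (Clim_seq_eq _ _ H). apply Clim_seq_eq, H'. Qed.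

Lemma Clim_ext_loc (u v : nat -> C) (l : C) (N : nat) :
  (forall n, (N <= n)%nat -> u n = v n) -> Clim u l -> Clim v l.
Proof.
  intros E [H1 H2]. split; [eapply is_lim_seq_ext_loc; [|apply H1] | eapply is_lim_seq_ext_loc; [|apply H2]];
    exists N; intros; rewrite E; auto.
Qed.

Lemma Clim_const (l : C) : Clim (fun _ => l) l.
Proof. split; apply is_lim_seq_const. Qed.

Lemma Clim_mult (u v : nat -> C) (l m : C) :
  Clim u l -> Clim v m -> Clim (fun n => u n * v n)%C (l * m)%C.
Proof.
  intros [H1 H2] [H3 H4]. split.
  - apply (is_lim_seq_minus' _ _ (Re l * Re m) (Im l * Im m)); apply (is_lim_seq_mult' _ _ _ _); auto.
  - apply (is_lim_seq_plus' _ _ (Re l * Im m) (Im l * Re m)); apply (is_lim_seq_mult' _ _ _ _); auto.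
Qed.

Lemma Clim_RtoC (u : nat -> R) (l : R) : is_lim_seq u l -> Clim (fun n => RtoC (u n)) (RtoC l).
Proof. intros H; split; [exact H | apply is_lim_seq_const]. Qed.

Lemma Clim_subseq (u : nat -> C) (l : C) (f : nat -> nat) :
  filterlim f eventually eventually -> Clim u l -> Clim (fun n => u (f n)) l.
Proof. intros Hf [H1 H2]. split; [apply (is_lim_seq_subseq (fun n => Re (u n))) | apply (is_lim_seq_subseq (fun n => Im (u n)))]; auto. Qed.

Lemma Clim_Cmod (u : nat -> C) (l : C) : Clim u l -> is_lim_seq (fun n => Cmod (u n)) (Cmod l).
Proof.
  intros [H1 H2]. unfold Cmod.
  apply (is_lim_seq_continuous sqrt (fun n => Re (u n) ^ 2 + Im (u n) ^ 2) (Re l ^ 2 + Im l ^ 2)).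
  - apply continuity_pt_sqrt. assert (H := pow2_ge_0 (Re l)). assert (H' := pow2_ge_0 (Im l)). lra.
  - apply (is_lim_seq_plus' _ _ (Re l ^ 2) (Im l ^ 2)); simpl;
      apply (is_lim_seq_mult' _ _ _ _); auto; apply (is_lim_seq_mult' _ _ _ _); auto; apply is_lim_seq_const.
Qed.

Lemma Clim_of_Cmod (u : nat -> C) (l : C) (e : nat -> R) :
  (forall n, Cmod (u n - l) <= e n) -> is_lim_seq e 0 -> Clim u l.
Proof.
  intros H He. split.
  - apply is_lim_seq_ext with (fun n => (Re (u n) - Re l) + Re l); [intros; ring|].
    rewrite <- (Rplus_0_l (Re l)) at 1.
    apply (is_lim_seq_plus' _ _ 0 (Re l)); [|apply is_lim_seq_const].
    apply is_lim_seq_abs_0. apply (is_lim_seq_le_le (fun _ => 0) _ e); auto; [|apply is_lim_seq_const].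
    intros n. split; [apply Rabs_pos|]. eapply Rle_trans; [|apply H]. apply (re_le_Cmod (u n - l)).
  - apply is_lim_seq_ext with (fun n => (Im (u n) - Im l) + Im l); [intros; ring|].
    rewrite <- (Rplus_0_l (Im l)) at 1.
    apply (is_lim_seq_plus' _ _ 0 (Im l)); [|apply is_lim_seq_const].
    apply is_lim_seq_abs_0. apply (is_lim_seq_le_le (fun _ => 0) _ e); auto; [|apply is_lim_seq_const].
    intros n. split; [apply Rabs_pos|]. eapply Rle_trans; [|apply H]. apply (Rabs_Im_le (u n - l)).
Qed.

Lemma is_lim_seq_const_div_INR_S (a : R) : is_lim_seq (fun n => a / INR (S n)) 0.
Proof.
  apply is_lim_seq_ext with (fun n => a * / INR (S n)); [reflexivity|].
  replace (Finite 0) with (Rbar_mult a 0) by (simpl; f_equal; ring).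
  apply is_lim_seq_scal_l. apply (is_lim_seq_incr_1 (fun n => / INR n)).
  apply (is_lim_seq_inv INR p_infty); [apply is_lim_seq_INR | discriminate].
Qed.

Lemma ex_lim_of_rate (u : nat -> R) (e : R) :
  (forall n k, Rabs (u (k + n)%nat - u n) <= e / INR (S n)) -> exists l : R, is_lim_seq u l.
Proof.
  intros H. destruct (proj2 (ex_lim_seq_cauchy_corr u)) as [l Hl].
  - intros eps. assert (L := is_lim_seq_const_div_INR_S e).
    apply is_lim_seq_spec in L. destruct (L (pos_div_2 eps)) as [N HN]. exists N. intros n m Hn Hm.
    assert (A : forall n, (N <= n)%nat -> Rabs (u n - u N) < eps / 2).
    { intros i Hi. replace i with ((i - N) + N)%nat by lia. eapply Rle_lt_trans; [apply H|].
      specialize (HN N (le_n _)). rewrite Rminus_0_r in HN. eapply Rle_lt_trans; [apply Rle_abs|]. exact HN. }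
    replace (u n - u m) with ((u n - u N) - (u m - u N)) by ring.
    eapply Rle_lt_trans; [apply Rabs_triang|]. rewrite Rabs_Ropp.
    assert (H1 := A n Hn). assert (H2 := A m Hm). lra.
  - exists l; auto.
Qed.

(** [Clim_seq] also returns a value for divergent sequences; this convergence is what gives
    [rgammaC] its meaning. *)
Lemma rgammaC_lim (z : C) : Clim (fun n => rG n z) (rgammaC z).
Proof.
  assert (HR : exists a : R, is_lim_seq (fun n => Re (rG (S n) z)) a).
  { apply (ex_lim_of_rate _ (rG_err (Cmod z))). intros n k.
    eapply Rle_trans; [|apply (rG_cauchy _ z n k (Rle_refl _))]. apply (re_le_Cmod (_ - _)). }
  assert (HI : exists a : R, is_lim_seq (fun n => Im (rG (S n) z)) a).
  { apply (ex_lim_of_rate _ (rG_err (Cmod z))). intros n k.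
    eapply Rle_trans; [|apply (rG_cauchy _ z n k (Rle_refl _))]. apply (Rabs_Im_le (_ - _)). }
  destruct HR as [a Ha], HI as [b Hb].
  assert (H : Clim (fun n => rG n z) (a, b)).
  { split; simpl; [apply (is_lim_seq_incr_1 (fun n => Re (rG n z))) | apply (is_lim_seq_incr_1 (fun n => Im (rG n z)))]; auto. }
  replace (rgammaC z) with (a, b); auto. symmetry. apply (Clim_seq_eq _ _ H).
Qed.

Lemma rG_rgammaC_err (r : R) (z : C) (n : nat) : Cmod z <= r ->
  Cmod (rgammaC z - rG (S n) z) <= rG_err r / INR (S n).
Proof.
  intros Hz.
  assert (H : Clim (fun k => rG (S (k + n)) z - rG (S n) z)%C (rgammaC z - rG (S n) z)%C).
  { destruct (rgammaC_lim z) as [H1 H2]. split; simpl.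
    - apply (is_lim_seq_minus' (fun k => Re (rG (S (k + n)) z)) (fun _ => Re (rG (S n) z)) (Re (rgammaC z)) (Re (rG (S n) z))).
      + apply (is_lim_seq_incr_n (fun k => Re (rG (S k) z)) n). apply (is_lim_seq_incr_1 (fun n => Re (rG n z))). auto.
      + apply is_lim_seq_const.
    - apply (is_lim_seq_minus' (fun k => Im (rG (S (k + n)) z)) (fun _ => Im (rG (S n) z)) (Im (rgammaC z)) (Im (rG (S n) z))).
      + apply (is_lim_seq_incr_n (fun k => Im (rG (S k) z)) n). apply (is_lim_seq_incr_1 (fun n => Im (rG n z))). auto.
      + apply is_lim_seq_const. }
  apply Clim_Cmod in H.
  refine (is_lim_seq_le _ _ _ _ _ H (is_lim_seq_const (rG_err r / INR (S n)))).
  intros k. apply rG_cauchy. auto.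
Qed.

Definition ris (z : C) (n : nat) : C := prodC (map (fun k => Cplus z (RtoC (INR k))) (seq 0 n)).

Lemma ris_S (z : C) (n : nat) : ris z (S n) = (ris z n * (z + RtoC (INR n)))%C.
Proof. unfold ris. rewrite seq_S, map_app, prodC_app. simpl. ring. Qed.

Lemma ris_S_l (z : C) (n : nat) : ris z (S n) = (z * ris (z + 1) n)%C.
Proof.
  induction n.
  - rewrite ris_S. unfold ris. simpl. ring.
  - rewrite ris_S, IHn, ris_S, S_INR, RtoC_plus. ring.
Qed.

Lemma rG_ris (n : nat) (z : C) : rG n z = (ris z (S n) / (RtoC (INR (fact n)) * cpow (INR n) z))%C.
Proof. reflexivity. Qed.

(** The functional equation holds for the approximants up to the factor 1 + (z + 1)/n, which tends
    to 1. *)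
Lemma rG_shift (n : nat) (z : C) :
  (z * rG (S n) (z + 1) = rG (S n) z * (1 + (z + 1) * RtoC (/ INR (S n))))%C.
Proof.
  rewrite !rG_ris, (ris_S z (S n)), (ris_S (z + 1) (S n)), (ris_S_l z n), (ris_S (z + 1) n).
  rewrite cpow_add, cpow_R, Rpower_1 by apply INR_S_pos.
  assert (H := INR_S_pos n).
  rewrite RtoC_inv by lra.
  assert (E : INR (S n) = INR n + 1) by apply S_INR.
  replace (RtoC (INR (S n))) with (RtoC (INR n) + 1)%C by (rewrite E, RtoC_plus; auto).
  field. repeat split; try apply cpow_neq_0; try (apply RtoC_neq_0, INR_fact_neq_0).
  rewrite <- RtoC_plus. apply RtoC_neq_0. lra.
Qed.

Lemma rgammaC_succ (z : C) : rgammaC z = (z * rgammaC (z + 1))%C.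
Proof.
  symmetry. apply (Clim_unique (fun n => z * rG (S n) (z + 1))%C).
  - apply Clim_mult; [apply Clim_const|].
    apply (Clim_subseq (fun n => rG n (z + 1)) _ S); [|apply rgammaC_lim].
    apply eventually_subseq_loc. exists 0%nat; intros; lia.
  - apply Clim_ext_loc with (fun n => rG (S n) z * (1 + (z + 1) * RtoC (/ INR (S n))))%C 0%nat.
    { intros. symmetry. apply rG_shift. }
    replace (rgammaC z) with (rgammaC z * 1)%C by ring.
    apply Clim_mult.
    + apply (Clim_subseq (fun n => rG n z) _ S); [|apply rgammaC_lim].
      apply eventually_subseq_loc. exists 0%nat; intros; lia.
    + apply (Clim_of_Cmod _ _ (fun n => Cmod (z + 1) / INR (S n))).
      * intros n. right. replace (1 + (z + 1) * RtoC (/ INR (S n)) - 1)%C with ((z + 1) * RtoC (/ INR (S n)))%C by ring.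
        rewrite Cmod_mult, Cmod_R, Rabs_pos_eq; [reflexivity|].
        apply Rlt_le, Rinv_0_lt_compat, INR_S_pos.
      * apply is_lim_seq_const_div_INR_S.
Qed.

Lemma ris_1 (n : nat) : ris 1 n = RtoC (INR (fact n)).
Proof.
  induction n; [reflexivity|]. rewrite ris_S, IHn. change (fact (S n)) with (S n * fact n)%nat.
  rewrite mult_INR, RtoC_mult, S_INR, RtoC_plus. ring.
Qed.

Lemma rgammaC_1 : rgammaC 1 = 1%C.
Proof.
  apply (Clim_unique (fun n => rG (S n) 1)).
  - apply (Clim_subseq (fun n => rG n 1) _ S); [|apply rgammaC_lim].
    apply eventually_subseq_loc. exists 0%nat; intros; lia.
  - apply (Clim_of_Cmod _ _ (fun n => 1 / INR (S n))); [|apply is_lim_seq_const_div_INR_S].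
    intros n. rewrite rG_ris, ris_1.
    change (fact (S (S n))) with (S (S n) * fact (S n))%nat. rewrite mult_INR, cpow_R, Rpower_1 by apply INR_S_pos.
    right. assert (H := INR_S_pos n).
    rewrite <- RtoC_mult, <- RtoC_div, <- RtoC_minus, Cmod_R.
    2: { apply Rmult_integral_contrapositive; split; [apply INR_fact_neq_0 | lra]. }
    replace (INR (S (S n)) * INR (fact (S n)) / (INR (fact (S n)) * INR (S n)) - 1) with (1 / INR (S n)).
    + apply Rabs_pos_eq. apply Rdiv_le_0_compat; lra.
    + rewrite (S_INR (S n)). field. split; [lra | apply INR_fact_neq_0].
Qed.

(** * Real arguments: values, zeros, positivity *)

Definition rgam (r : R) : R := Re (rgammaC (RtoC r)).

Lemma prodC_RtoC {A : Type} (f : A -> R) (l : list A) :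
  prodC (map (fun k => RtoC (f k)) l) = RtoC (prodR (map f l)).
Proof. induction l; [reflexivity|]. simpl. rewrite IHl, <- RtoC_mult. reflexivity. Qed.

Lemma ris_R (r : R) (n : nat) : ris (RtoC r) n = RtoC (poch r n).
Proof.
  unfold ris, poch. rewrite <- prodC_RtoC. f_equal. apply map_ext. intros. now rewrite RtoC_plus.
Qed.

Lemma prodR_app (a b : list R) : prodR (a ++ b) = prodR a * prodR b.
Proof. induction a; simpl; [ring|]. rewrite IHa. unfold prodR; simpl. ring. Qed.

Lemma poch_S (r : R) (n : nat) : poch r (S n) = poch r n * (r + INR n).
Proof. unfold poch. rewrite seq_S, map_app, prodR_app. simpl. ring. Qed.

Definition rGR (n : nat) (r : R) : R := poch r (S n) / (INR (fact n) * Rpower (INR n) r).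

Lemma rG_R (n : nat) (r : R) : rG n (RtoC r) = RtoC (rGR n r).
Proof.
  rewrite rG_ris, ris_R, cpow_R, <- RtoC_mult, <- RtoC_div; [reflexivity|].
  apply Rmult_integral_contrapositive; split; [apply INR_fact_neq_0|].
  unfold Rpower. assert (H := exp_pos (r * ln (INR n))). lra.
Qed.

Lemma rgammaC_R (r : R) : rgammaC (RtoC r) = RtoC (rgam r).
Proof.
  apply C_ext; [reflexivity|]. simpl.
  destruct (rgammaC_lim (RtoC r)) as [_ H].
  assert (H' : is_lim_seq (fun n => Im (rG n (RtoC r))) 0).
  { apply is_lim_seq_ext with (fun _ => 0); [|apply is_lim_seq_const]. intros. rewrite rG_R. reflexivity. }
  apply is_lim_seq_unique in H. apply is_lim_seq_unique in H'. rewrite H in H'. injection H'; auto.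
Qed.

Lemma rgam_lim (r : R) : is_lim_seq (fun n => rGR n r) (rgam r).
Proof.
  destruct (rgammaC_lim (RtoC r)) as [H _]. eapply is_lim_seq_ext; [|apply H].
  intros n; cbv beta. rewrite rG_R. reflexivity.
Qed.

Lemma rgam_succ (r : R) : rgam r = r * rgam (r + 1).
Proof.
  unfold rgam at 1. rewrite rgammaC_succ, <- RtoC_plus, rgammaC_R, <- RtoC_mult. reflexivity.
Qed.

Lemma rgam_1 : rgam 1 = 1.
Proof. unfold rgam. rewrite rgammaC_1. reflexivity. Qed.

Lemma rgam_0 : rgam 0 = 0.
Proof. rewrite rgam_succ. ring. Qed.

Lemma rgam_opp_INR (n : nat) : rgam (- INR n) = 0.
Proof.
  induction n; [simpl; rewrite Ropp_0; apply rgam_0|].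
  rewrite rgam_succ, S_INR. replace (- (INR n + 1) + 1) with (- INR n) by ring. rewrite IHn. ring.
Qed.

(** At the poles the equation reads 0 = 0, since both the complex and the real inverse send 0 to
    0. *)
Lemma GammaC_R (r : R) : GammaC (RtoC r) = RtoC (/ rgam r).
Proof.
  unfold GammaC. rewrite rgammaC_R. unfold Cinv, RtoC; simpl.
  destruct (Req_dec (rgam r) 0) as [E|E].
  - rewrite E. rewrite Rinv_0. unfold Rdiv. f_equal; ring.
  - f_equal; field; auto.
Qed.

(* Weighted AM-GM for the logarithm, applied to [1 + x] and [1]. *)
Lemma ln_1_plus_concave (c x : R) : 0 <= c <= 1 -> 0 <= x -> c * ln (1 + x) <= ln (1 + c * x).
Proof.
  intros Hc Hx. set (m := 1 + c * x). assert (Hm : 0 < m) by (unfold m; nra).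
  assert (L : forall t, 0 < t -> ln t <= t - 1).
  { intros t Ht. assert (H := exp_ineq1_le (ln t)). rewrite exp_ln in H; lra. }
  assert (H1 := L ((1 + x) / m) ltac:(apply Rdiv_lt_0_compat; lra)).
  assert (H2 := L (/ m) ltac:(apply Rinv_0_lt_compat; lra)).
  rewrite ln_div in H1 by lra. rewrite ln_Rinv in H2 by lra.
  assert (E : c * ((1 + x) / m - 1) + (1 - c) * (/ m - 1) = 0) by (unfold m in *; field; lra).
  nra.
Qed.

(** A lower bound that does not depend on n survives the limit and makes 1/Gamma positive on (0, 1].
    The induction rests on (1 + 1/N)^c <= 1 + c/N, the concavity above. *)
Lemma rGR_lower (c : R) (n : nat) : 0 < c <= 1 -> c <= rGR (S n) c.
Proof.
  intros Hc. unfold rGR.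
  assert (H : forall n, c * INR (fact n) * Rpower (INR (S n)) c <= poch c (S n)).
  { induction n0.
    - unfold poch, Rpower; simpl. rewrite ln_1, Rmult_0_r, exp_0. lra.
    - rewrite poch_S. change (fact (S n0)) with (S n0 * fact n0)%nat. rewrite mult_INR.
      assert (H1 := INR_S_pos n0). assert (H2 := INR_S_pos (S n0)). assert (H3 := INR_fact_lt_0 n0).
      assert (E : INR (S (S n0)) = INR (S n0) * (1 + / INR (S n0))) by (rewrite (S_INR (S n0)); field; lra).
      assert (Hi : 0 < / INR (S n0)) by (apply Rinv_0_lt_compat; lra).
      rewrite E, <- Rpower_mult_distr by lra.
      assert (Hb : Rpower (1 + / INR (S n0)) c <= 1 + c * / INR (S n0)).
      { unfold Rpower. rewrite <- (exp_ln (1 + c * / INR (S n0))) by nra.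
        assert (H := ln_1_plus_concave c (/ INR (S n0)) ltac:(lra) ltac:(lra)).
        apply exp_le_mono; lra. }
      replace (c * (INR (S n0) * INR (fact n0)) * (Rpower (INR (S n0)) c * Rpower (1 + / INR (S n0)) c))
        with ((c * INR (fact n0) * Rpower (INR (S n0)) c) * (INR (S n0) * Rpower (1 + / INR (S n0)) c)) by ring.
      apply Rmult_le_compat; auto.
      + apply Rmult_le_pos; [nra | unfold Rpower; apply Rlt_le, exp_pos].
      + apply Rmult_le_pos; [lra | unfold Rpower; apply Rlt_le, exp_pos].
      + apply Rle_trans with (INR (S n0) * (1 + c * / INR (S n0))).
        * apply Rmult_le_compat_l; lra.
        * right. field. lra. }
  assert (H1 := INR_S_pos n). assert (H3 := INR_fact_lt_0 (S n)).
  assert (P := exp_pos (c * ln (INR (S n)))). fold (Rpower (INR (S n)) c) in P.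
  apply Rle_div_r; [nra|]. eapply Rle_trans; [|apply H].
  rewrite <- Rmult_assoc. apply Rmult_le_compat_l; [nra|].
  apply Rle_Rpower_l; [lra|]. rewrite (S_INR (S n)). lra.
Qed.

Lemma rgam_pos (c : R) : 0 < c -> 0 < rgam c.
Proof.
  assert (H01 : forall c, 0 < c <= 1 -> 0 < rgam c).
  { intros d Hd. apply Rlt_le_trans with d; [lra|].
    refine (is_lim_seq_le _ _ _ _ _ (is_lim_seq_const d) (proj1 (is_lim_seq_incr_1 _ _) (rgam_lim d))).
    intros n. apply rGR_lower; auto. }
  assert (H : forall n c, 0 < c <= INR (S n) -> 0 < rgam c).
  { induction n; intros d Hd; [apply H01; simpl in Hd; auto|].
    destruct (Rle_dec d 1) as [L|L]; [apply H01; lra|].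
    assert (Hp : 0 < rgam (d - 1)) by (apply IHn; rewrite (S_INR (S n)) in Hd; lra).
    rewrite rgam_succ in Hp. replace (d - 1 + 1) with d in Hp by ring.
    destruct (Rlt_dec 0 (rgam d)); auto. exfalso. nra. }
  intros Hc. destruct (nfloor_ex c) as [n Hn]; [lra|]. apply (H n). rewrite S_INR. lra.
Qed.

Lemma rgam_neq_0 (r : R) : (forall n : nat, r <> - INR n) -> rgam r <> 0.
Proof.
  intros H. assert (Hk : forall k r, (forall n : nat, r <> - INR n) -> 0 < r + INR k -> rgam r <> 0).
  { induction k; intros s Hs Hp.
    - simpl in Hp. assert (P := rgam_pos s ltac:(lra)). lra.
    - rewrite rgam_succ. apply Rmult_integral_contrapositive. split.
      + specialize (Hs 0%nat). simpl in Hs. lra.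
      + apply IHk; [|rewrite S_INR in Hp; lra].
        intros n E. apply (Hs (S n)). rewrite S_INR. lra. }
  destruct (Rlt_dec 0 r) as [L|L]; [apply (Hk 0%nat); simpl; auto; lra|].
  destruct (nfloor_ex (- r)) as [n Hn]; [lra|]. apply (Hk (S n)); auto. rewrite S_INR. lra.
Qed.

(** * Growth of 1/Gamma along vertical lines *)

Fixpoint prodn (f : nat -> R) (n : nat) : R :=
  match n with 0%nat => 1 | S k => prodn f k * f k end.

Lemma prodn_ge_1 (f : nat -> R) (n : nat) : (forall k, 1 <= f k) -> 1 <= prodn f n.
Proof. intros H; induction n; simpl; [lra|]. specialize (H n). nra. Qed.

Lemma prodn_mono (f : nat -> R) (n m : nat) : (forall k, 1 <= f k) -> (n <= m)%nat -> prodn f n <= prodn f m.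
Proof.
  intros H Hnm. induction Hnm; [lra|]. simpl. specialize (H m) as Hm.
  assert (P := prodn_ge_1 f m H). nra.
Qed.

Lemma prodn_mult (f g : nat -> R) (n : nat) : prodn (fun k => f k * g k) n = prodn f n * prodn g n.
Proof. induction n; simpl; [ring|]. rewrite IHn. ring. Qed.

(* The squared modulus of [rG n (c + i t)], relative to its value at [t = 0]. *)
Definition vert (c t : R) (n : nat) : R := prodn (fun k => 1 + t ^ 2 / (c + INR k) ^ 2) n.

Lemma vert_S (c t : R) (n : nat) : vert c t (S n) = vert c t n * (1 + t ^ 2 / (c + INR n) ^ 2).
Proof. reflexivity. Qed.

Lemma vert_factor_ge_1 (c t : R) (k : nat) : 0 < c -> 1 <= 1 + t ^ 2 / (c + INR k) ^ 2.
Proof.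
  intros. assert (0 <= t ^ 2 / (c + INR k) ^ 2); [|lra].
  apply Rdiv_le_0_compat; [nra|]. assert (P := pos_INR k). nra.
Qed.

Lemma vert_ge_1 (c t : R) (n : nat) : 0 < c -> 1 <= vert c t n.
Proof. intros. apply prodn_ge_1. intros; apply vert_factor_ge_1; auto. Qed.

Lemma Cmod_ris_vert (c t : R) (n : nat) : 0 < c ->
  Cmod (ris (c, t) n) ^ 2 = Cmod (ris (RtoC c) n) ^ 2 * vert c t n.
Proof.
  intros Hc. induction n.
  - unfold ris, vert. simpl. ring.
  - rewrite !ris_S, !Cmod_mult, !Rpow_mult_distr, IHn, vert_S.
    assert (P := pos_INR n).
    assert (E : Cmod ((c, t) + RtoC (INR n)) ^ 2 = Cmod (RtoC c + RtoC (INR n)) ^ 2 * (1 + t ^ 2 / (c + INR n) ^ 2)).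
    { rewrite (Cmod2_alt ((c, t) + _)), <- RtoC_plus, Cmod_R, pow2_abs.
      change (Re ((c, t) + RtoC (INR n))) with (c + INR n). change (Im ((c, t) + RtoC (INR n))) with (t + 0).
      field. lra. }
    rewrite E. ring.
Qed.

Lemma Cmod_rG_vert (c t : R) (n : nat) : 0 < c ->
  Cmod (rG n (c, t)) ^ 2 = rGR n c ^ 2 * vert c t (S n).
Proof.
  intros Hc.
  assert (E : rGR n c ^ 2 = Cmod (rG n (RtoC c)) ^ 2) by (rewrite rG_R, Cmod_R, pow2_abs; auto).
  rewrite E, !rG_ris.
  assert (N : forall z, (RtoC (INR (fact n)) * cpow (INR n) z)%C <> 0%C).
  { intros z. apply Cmult_neq_0; [apply RtoC_neq_0, INR_fact_neq_0 | apply cpow_neq_0]. }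
  rewrite !Cmod_div by auto. unfold Rdiv. rewrite !Rpow_mult_distr, (Cmod_ris_vert c t) by auto.
  replace (Cmod (RtoC (INR (fact n)) * cpow (INR n) (c, t))) with (Cmod (RtoC (INR (fact n)) * cpow (INR n) (RtoC c))); [ring|].
  rewrite !Cmod_mult, !Cmod_cpow. reflexivity.
Qed.

(** All factors of the infinite product for |Gamma(c) / Gamma(c + i t)|^2 are at least 1, so any
    finite number of them may be kept as a lower bound. How many are kept is decided later,
    according to t. *)
Lemma rgammaC_vert_lower (c t : R) (N : nat) : 0 < c ->
  rgam c ^ 2 * vert c t N <= Cmod (rgammaC (c, t)) ^ 2.
Proof.
  intros Hc.
  assert (H1 : is_lim_seq (fun n => rGR n c ^ 2 * vert c t N) (rgam c ^ 2 * vert c t N)).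
  { apply (is_lim_seq_mult' _ _ (rgam c ^ 2) (vert c t N)); [|apply is_lim_seq_const].
    assert (L := rgam_lim c). simpl.
    apply (is_lim_seq_mult' _ _ _ _ L). apply (is_lim_seq_mult' _ _ _ _ L). apply is_lim_seq_const. }
  assert (H2 : is_lim_seq (fun n => Cmod (rG n (c, t)) ^ 2) (Cmod (rgammaC (c, t)) ^ 2)).
  { assert (L := Clim_Cmod _ _ (rgammaC_lim (c, t))). simpl.
    apply (is_lim_seq_mult' _ _ _ _ L). apply (is_lim_seq_mult' _ _ _ _ L). apply is_lim_seq_const. }
  refine (is_lim_seq_le_loc _ _ (rgam c ^ 2 * vert c t N) (Cmod (rgammaC (c, t)) ^ 2) _ H1 H2).
  - exists N. intros n Hn. rewrite Cmod_rG_vert by auto.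
    apply Rmult_le_compat_l; [apply pow2_ge_0|]. apply prodn_mono; [|lia].
    intros; apply vert_factor_ge_1; auto.
Qed.

Lemma rgammaC_vert_ge (c t : R) : 0 < c -> rgam c <= Cmod (rgammaC (c, t)).
Proof.
  intros Hc. assert (H := rgammaC_vert_lower c t 0 Hc). unfold vert in H; simpl prodn in H.
  assert (P := rgam_pos c Hc). assert (P' := Cmod_ge_0 (rgammaC (c, t))). nra.
Qed.

Lemma rgammaC_neq_0 (z : C) : 0 < Re z -> rgammaC z <> 0%C.
Proof.
  destruct z as [c t]. simpl. intros Hc. apply Cmod_gt_0.
  assert (H := rgammaC_vert_ge c t Hc). assert (P := rgam_pos c Hc). lra.
Qed.

(** * Continuity of complex functions of a real variable *)

Definition Ccont (f : R -> C) : Prop :=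
  continuity (fun t => Re (f t)) /\ continuity (fun t => Im (f t)).

Lemma Ccont_const (a : C) : Ccont (fun _ => a).
Proof. split; apply continuity_cst. Qed.

Lemma Ccont_plus (f g : R -> C) : Ccont f -> Ccont g -> Ccont (fun t => f t + g t)%C.
Proof. intros [H1 H2] [H3 H4]. split; apply continuity_plus; auto. Qed.

Lemma Ccont_mult (f g : R -> C) : Ccont f -> Ccont g -> Ccont (fun t => f t * g t)%C.
Proof.
  intros [H1 H2] [H3 H4]. split.
  - apply (continuity_minus (fun t => Re (f t) * Re (g t)) (fun t => Im (f t) * Im (g t)));
      apply continuity_mult; auto.
  - apply (continuity_plus (fun t => Re (f t) * Im (g t)) (fun t => Im (f t) * Re (g t)));
      apply continuity_mult; auto.
Qed.

Lemma Ccont_cexp (f : R -> C) : Ccont f -> Ccont (fun t => cexp (f t)).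
Proof.
  intros [H1 H2]. assert (He : continuity (fun t => exp (Re (f t)))).
  { apply (continuity_comp (fun t => Re (f t)) exp); auto. apply derivable_continuous, derivable_exp. }
  split; simpl; apply continuity_mult; auto.
  - apply (continuity_comp (fun t => Im (f t)) cos); auto. apply continuity_cos.
  - apply (continuity_comp (fun t => Im (f t)) sin); auto. apply continuity_sin.
Qed.

Lemma Ccont_cpow (x : R) (f : R -> C) : Ccont f -> Ccont (fun t => cpow x (f t)).
Proof.
  intros H. assert (E : Ccont (fun t => cexp (f t * RtoC (ln x)))).
  { apply Ccont_cexp, Ccont_mult; auto. apply Ccont_const. }
  destruct E as [E1 E2]. split; intros t.
  - apply (continuity_pt_ext (fun t => Re (cexp (f t * RtoC (ln x))))); auto.
    intros; rewrite cpow_cexp; auto.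
  - apply (continuity_pt_ext (fun t => Im (cexp (f t * RtoC (ln x))))); auto.
    intros; rewrite cpow_cexp; auto.
Qed.

Lemma Ccont_inv (f : R -> C) : Ccont f -> (forall t, f t <> 0%C) -> Ccont (fun t => / f t)%C.
Proof.
  intros [H1 H2] Hn.
  assert (Hd : forall t, Re (f t) ^ 2 + Im (f t) ^ 2 <> 0).
  { intros t E. apply (Hn t). apply Cmod_eq_0. unfold Cmod. change (fst (f t)) with (Re (f t)).
    change (snd (f t)) with (Im (f t)). rewrite E. apply sqrt_0. }
  assert (Hc : continuity (fun t => Re (f t) ^ 2 + Im (f t) ^ 2)).
  { simpl. apply continuity_plus; apply continuity_mult; auto; apply continuity_mult; auto;
      apply continuity_cst. }
  split.
  - apply (continuity_div (fun t => Re (f t)) (fun t => Re (f t) ^ 2 + Im (f t) ^ 2)); auto.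
  - apply (continuity_div (fun t => - Im (f t)) (fun t => Re (f t) ^ 2 + Im (f t) ^ 2)); auto.
    apply continuity_opp; auto.
Qed.

Lemma Ccont_ris (f : R -> C) (n : nat) : Ccont f -> Ccont (fun t => ris (f t) n).
Proof.
  intros H. induction n.
  - apply (Ccont_const 1).
  - assert (E : Ccont (fun t => ris (f t) n * (f t + RtoC (INR n)))%C).
    { apply Ccont_mult; auto. apply Ccont_plus; auto. apply Ccont_const. }
    destruct E as [E1 E2]. split; intros t.
    + apply (continuity_pt_ext (fun t => Re (ris (f t) n * (f t + RtoC (INR n))))); auto.
      intros; rewrite ris_S; auto.
    + apply (continuity_pt_ext (fun t => Im (ris (f t) n * (f t + RtoC (INR n))))); auto.
      intros; rewrite ris_S; auto.
Qed.

Lemma Ccont_rG (f : R -> C) (n : nat) : Ccont f -> Ccont (fun t => rG n (f t)).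
Proof.
  intros H. apply (Ccont_mult (fun t => ris (f t) (S n)) (fun t => / (RtoC (INR (fact n)) * cpow (INR n) (f t)))%C).
  - apply Ccont_ris; auto.
  - apply Ccont_inv.
    + apply Ccont_mult; [apply Ccont_const | apply Ccont_cpow; auto].
    + intros t. apply Cmult_neq_0; [apply RtoC_neq_0, INR_fact_neq_0 | apply cpow_neq_0].
Qed.

Lemma Ccont_locally_bounded (f : R -> C) (a : R) : Ccont f ->
  exists r d, 0 < d /\ forall t, Rabs (t - a) < d -> Cmod (f t) <= r.
Proof.
  intros [H1 H2].
  destruct (H1 a 1 Rlt_0_1) as [d1 [D1 K1]]. destruct (H2 a 1 Rlt_0_1) as [d2 [D2 K2]].
  exists ((Rabs (Re (f a)) + 1) + (Rabs (Im (f a)) + 1)), (Rmin d1 d2).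
  split; [apply Rmin_pos; auto|]. intros t Ht.
  assert (A : forall (g : R -> R) d, (forall x, D_x no_cond a x /\ Rabs (x - a) < d -> Rabs (g x - g a) < 1) ->
              Rabs (t - a) < d -> Rabs (g t) <= Rabs (g a) + 1).
  { intros g d K Hd. destruct (Req_dec a t) as [->|Ne]; [lra|].
    specialize (K t (conj (conj I Ne) Hd)).
    replace (g t) with ((g t - g a) + g a) by ring. eapply Rle_trans; [apply Rabs_triang|]. lra. }
  eapply Rle_trans; [apply Cmod_Re_Im|]. apply Rplus_le_compat.
  - apply (A (fun t => Re (f t)) d1); auto. eapply Rlt_le_trans; [apply Ht | apply Rmin_l].
  - apply (A (fun t => Im (f t)) d2); auto. eapply Rlt_le_trans; [apply Ht | apply Rmin_r].
Qed.

Lemma continuity_pt_uniform_approx (f : R -> R) (a d : R) : 0 < d ->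
  (forall eps, 0 < eps -> exists g, continuity_pt g a /\ forall t, Rabs (t - a) < d -> Rabs (f t - g t) < eps) ->
  continuity_pt f a.
Proof.
  intros Hd H eps Heps.
  destruct (H (eps / 3) ltac:(lra)) as [g [Hg Hfg]].
  destruct (Hg (eps / 3) ltac:(lra)) as [d' [Hd' K]].
  exists (Rmin d d'). split; [apply Rmin_pos; auto|]. intros x [Hx Hxa].
  specialize (K x (conj Hx (Rlt_le_trans _ _ _ Hxa (Rmin_r _ _)))).
  assert (H1 := Hfg x (Rlt_le_trans _ _ _ Hxa (Rmin_l _ _))).
  assert (H2 := Hfg a ltac:(rewrite Rminus_diag_eq, Rabs_R0 by auto; auto)).
  simpl in *. unfold R_dist in *.
  replace (f x - f a) with ((f x - g x) + (g x - g a) - (f a - g a)) by ring.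
  eapply Rle_lt_trans; [apply Rabs_triang|]. rewrite Rabs_Ropp.
  eapply Rle_lt_trans; [apply Rplus_le_compat_r, Rabs_triang|]. lra.
Qed.

Lemma exists_div_INR_S_lt (e eps : R) : 0 < eps -> exists n : nat, e / INR (S n) < eps.
Proof.
  intros H. assert (L := is_lim_seq_const_div_INR_S e). apply is_lim_seq_spec in L.
  destruct (L (mkposreal eps H)) as [N HN]. exists N. specialize (HN N (le_n _)). simpl in HN.
  rewrite Rminus_0_r in HN. eapply Rle_lt_trans; [apply Rle_abs | apply HN].
Qed.

(** Near each point f stays in a disc, and there the continuous approximants converge uniformly. *)
Lemma Ccont_rgammaC (f : R -> C) : Ccont f -> Ccont (fun t => rgammaC (f t)).
Proof.
  intros H. split; intros a; destruct (Ccont_locally_bounded f a H) as [r [d [Hd Hr]]];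
    apply (continuity_pt_uniform_approx _ a d Hd); intros eps Heps;
    destruct (exists_div_INR_S_lt (rG_err r) eps Heps) as [n Hn].
  - exists (fun t => Re (rG (S n) (f t))). split; [apply (Ccont_rG f (S n) H)|].
    intros t Ht. eapply Rle_lt_trans; [|apply Hn].
    eapply Rle_trans; [apply (re_le_Cmod (rgammaC (f t) - rG (S n) (f t)))|]. apply rG_rgammaC_err; auto.
  - exists (fun t => Im (rG (S n) (f t))). split; [apply (Ccont_rG f (S n) H)|].
    intros t Ht. eapply Rle_lt_trans; [|apply Hn].
    eapply Rle_trans; [apply (Rabs_Im_le (rgammaC (f t) - rG (S n) (f t)))|]. apply rG_rgammaC_err; auto.
Qed.

Lemma Ccont_id : Ccont RtoC.
Proof. split; [apply derivable_continuous, derivable_id | apply (continuity_cst 0)]. Qed.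

Lemma rgam_continuous (r : R) : continuity_pt rgam r.
Proof. apply (Ccont_rgammaC RtoC Ccont_id). Qed.

(** * Stirling's formula and Gauss's multiplication formula *)

(** Wallis's integrals; they fix the constant in Stirling's formula. *)
Definition sin_int (n : nat) : R := RInt (fun x => sin x ^ n) 0 (PI / 2).

Lemma continuous_sin_pow (n : nat) (x : R) : continuous (fun x => sin x ^ n) x.
Proof. apply (ex_derive_continuous (fun x => sin x ^ n)). auto_derive. auto. Qed.

Lemma ex_RInt_sin_pow (n : nat) : ex_RInt (fun x => sin x ^ n) 0 (PI / 2).
Proof. apply (ex_RInt_continuous (V := R_CompleteNormedModule)). intros; apply continuous_sin_pow. Qed.

Lemma sin_int_0 : sin_int 0 = PI / 2.
Proof. unfold sin_int. simpl. rewrite RInt_const. unfold scal; simpl; unfold mult; simpl. ring. Qed.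

Lemma sin_int_1 : sin_int 1 = 1.
Proof.
  unfold sin_int. apply is_RInt_unique.
  replace 1 with (minus (- cos (PI / 2)) (- cos 0)).
  2: { rewrite cos_PI2, cos_0. unfold minus, plus, opp; simpl. ring. }
  apply (is_RInt_derive (fun x => - cos x)).
  - intros. auto_derive; auto. ring.
  - intros. apply continuous_sin_pow.
Qed.

(** The derivative of cos x sin^(n+1) x is (n+1) sin^n x - (n+2) sin^(n+2) x, and the function
    vanishes at both ends. *)
Lemma sin_int_SS (n : nat) : INR (S (S n)) * sin_int (S (S n)) = INR (S n) * sin_int n.
Proof.
  assert (H : is_RInt (fun x => INR (S n) * sin x ^ n - INR (S (S n)) * sin x ^ (S (S n))) 0 (PI / 2)
                      (minus (cos (PI / 2) * sin (PI / 2) ^ (S n)) (cos 0 * sin 0 ^ (S n)))).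
  { apply (is_RInt_derive (fun x => cos x * sin x ^ (S n))).
    - intros. auto_derive; auto. change (match n with 0%nat => 1 | S _ => INR n + 1 end) with (INR (S n)).
      assert (Hc := sin2_cos2 x). unfold Rsqr in Hc. rewrite (S_INR (S n)).
      replace (cos x * (1 * cos x * (INR (S n) * sin x ^ n))) with (INR (S n) * sin x ^ n * (cos x * cos x)) by ring.
      replace (cos x * cos x) with (1 - sin x * sin x) by lra.
      change (sin x ^ S (S n)) with (sin x * (sin x * sin x ^ n)). ring.
    - intros. apply (ex_derive_continuous (fun x => INR (S n) * sin x ^ n - INR (S (S n)) * sin x ^ (S (S n)))).
      auto_derive. auto. }
  rewrite cos_PI2, sin_0 in H.
  replace (minus _ _) with 0 in H by (unfold minus, plus, opp; simpl; ring).
  assert (H' : is_RInt (fun x => INR (S n) * sin x ^ n - INR (S (S n)) * sin x ^ (S (S n))) 0 (PI / 2)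
                 (INR (S n) * sin_int n - INR (S (S n)) * sin_int (S (S n)))).
  { apply (is_RInt_minus (V := R_NormedModule) (fun x => INR (S n) * sin x ^ n) (fun x => INR (S (S n)) * sin x ^ (S (S n)))).
    - apply (is_RInt_scal (V := R_NormedModule) (fun x => sin x ^ n)). apply (RInt_correct (V := R_CompleteNormedModule)), ex_RInt_sin_pow.
    - apply (is_RInt_scal (V := R_NormedModule) (fun x => sin x ^ (S (S n)))). apply (RInt_correct (V := R_CompleteNormedModule)), ex_RInt_sin_pow. }
  apply (is_RInt_unique (V := R_CompleteNormedModule)) in H. apply (is_RInt_unique (V := R_CompleteNormedModule)) in H'. rewrite H in H'. lra.
Qed.

Lemma sin_int_decr (n : nat) : sin_int (S n) <= sin_int n.
Proof.
  assert (P := PI_RGT_0).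
  apply RInt_le; [lra | apply ex_RInt_sin_pow | apply ex_RInt_sin_pow |].
  intros x Hx. assert (0 <= sin x) by (apply sin_ge_0; lra). assert (sin x <= 1) by apply SIN_bound.
  simpl. assert (0 <= sin x ^ n) by (apply pow_le; auto). nra.
Qed.

(** This is 4^n divided by the central binomial coefficient (2n choose n). *)
Definition wall (n : nat) : R := 4 ^ n * INR (fact n) ^ 2 / INR (fact (2 * n)).

Lemma wall_pos (n : nat) : 0 < wall n.
Proof.
  unfold wall. apply Rdiv_lt_0_compat; [|apply INR_fact_lt_0].
  apply Rmult_lt_0_compat; apply pow_lt; [lra | apply INR_fact_lt_0].
Qed.

Lemma wall_S (n : nat) : wall (S n) * INR (2 * n + 1) = wall n * INR (2 * n + 2).
Proof.
  unfold wall. replace (2 * S n)%nat with (S (S (2 * n))) by lia.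
  change (fact (S (S (2 * n)))) with (S (S (2 * n)) * (S (2 * n) * fact (2 * n)))%nat.
  change (fact (S n)) with (S n * fact n)%nat.
  rewrite !mult_INR, !S_INR, !plus_INR, !mult_INR. simpl (INR 2). simpl (INR 1).
  assert (P := pos_INR n). assert (F1 := INR_fact_lt_0 (2 * n)). assert (F2 := INR_fact_lt_0 n).
  simpl pow. field. lra.
Qed.

Lemma sin_int_wall (n : nat) : sin_int (2 * n) = PI / 2 / wall n /\ sin_int (2 * n + 1) = wall n / INR (2 * n + 1).
Proof.
  induction n as [|n [IH1 IH2]].
  - split; [change (2 * 0)%nat with 0%nat; rewrite sin_int_0 | change (2 * 0 + 1)%nat with 1%nat; rewrite sin_int_1];
      unfold wall; simpl; field.
  - assert (P := pos_INR n). assert (Hw := wall_pos n). assert (Hw' := wall_pos (S n)).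
    assert (HS := wall_S n).
    assert (E1 : INR (2 * n + 1) = 2 * INR n + 1) by (rewrite plus_INR, mult_INR; simpl; ring).
    assert (E2 : INR (2 * n + 2) = 2 * INR n + 2) by (rewrite plus_INR, mult_INR; simpl; ring).
    assert (E3 : INR (2 * n + 3) = 2 * INR n + 3) by (rewrite plus_INR, mult_INR; simpl; ring).
    assert (HW : wall (S n) = wall n * INR (2 * n + 2) / INR (2 * n + 1)).
    { rewrite <- HS. field. lra. }
    split.
    + assert (H := sin_int_SS (2 * n)). rewrite IH1 in H.
      replace (2 * S n)%nat with (S (S (2 * n))) by lia.
      replace (S (S (2 * n))) with (2 * n + 2)%nat in * by lia. replace (S (2 * n)) with (2 * n + 1)%nat in * by lia.
      apply (Rmult_eq_reg_l (INR (2 * n + 2))); [|lra]. rewrite H, HW. field. lra.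
    + assert (H := sin_int_SS (2 * n + 1)). rewrite IH2 in H.
      replace (2 * S n + 1)%nat with (S (S (2 * n + 1))) by lia.
      replace (S (S (2 * n + 1))) with (2 * n + 3)%nat in * by lia. replace (S (2 * n + 1)) with (2 * n + 2)%nat in * by lia.
      apply (Rmult_eq_reg_l (INR (2 * n + 3))); [|lra]. rewrite H, HW. field. lra.
Qed.

(** Monotonicity of the integrals at 2m, 2m + 1, 2m + 2 encloses the square of [wall m] between
    (PI/2) (2m+1)^2 / (2m+2) and (PI/2) (2m+1). *)
Lemma wallis : is_lim_seq (fun n => wall (S n) ^ 2 / INR (S n)) PI.
Proof.
  assert (Pp := PI_RGT_0).
  apply (is_lim_seq_le_le (fun n => PI - PI / INR (S n)) _ (fun n => PI + PI / INR (S n))).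
  - intros n. assert (Hw := wall_pos (S n)). set (m := S n) in *.
    destruct (sin_int_wall m) as [H1 H2]. destruct (sin_int_wall (S m)) as [H3 _].
    assert (D1 := sin_int_decr (2 * m)). assert (D2 := sin_int_decr (2 * m + 1)).
    replace (S (2 * m)) with (2 * m + 1)%nat in D1 by lia.
    replace (S (2 * m + 1)) with (2 * S m)%nat in D2 by lia.
    rewrite H1, H2 in D1. rewrite H2, H3 in D2.
    assert (P : 0 < INR m) by apply INR_S_pos. assert (HS := wall_S m).
    assert (E1 : INR (2 * m + 1) = 2 * INR m + 1) by (rewrite plus_INR, mult_INR; simpl; ring).
    assert (E2 : INR (2 * m + 2) = 2 * INR m + 2) by (rewrite plus_INR, mult_INR; simpl; ring).
    assert (HW : wall (S m) = wall m * INR (2 * m + 2) / INR (2 * m + 1)).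
    { rewrite <- HS. field. lra. }
    rewrite HW, E1, E2 in *. set (x := INR m) in *. set (w := wall m) in *. clearbody x w.
    clear H1 H2 H3 HS HW.
    assert (K1 : w ^ 2 <= PI / 2 * (2 * x + 1)).
    { apply (Rmult_le_compat_r (w * (2 * x + 1))) in D1; [|nra].
      replace (w / (2 * x + 1) * (w * (2 * x + 1))) with (w ^ 2) in D1 by (field; lra).
      replace (PI / 2 / w * (w * (2 * x + 1))) with (PI / 2 * (2 * x + 1)) in D1 by (field; lra). auto. }
    assert (K2 : PI / 2 * (2 * x + 1) ^ 2 <= w ^ 2 * (2 * x + 2)).
    { apply (Rmult_le_compat_r (w * (2 * x + 1) * (2 * x + 2))) in D2; [|apply Rmult_le_pos; nra].
      replace (w / (2 * x + 1) * (w * (2 * x + 1) * (2 * x + 2))) with (w ^ 2 * (2 * x + 2)) in D2 by (field; lra).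
      replace (PI / 2 / (w * (2 * x + 2) / (2 * x + 1)) * (w * (2 * x + 1) * (2 * x + 2)))
        with (PI / 2 * (2 * x + 1) ^ 2) in D2 by (field; lra). auto. }
    split.
    + apply Rle_div_r; auto. replace ((PI - PI / x) * x) with (PI * (x - 1)) by (field; lra).
      apply (Rmult_le_reg_r (2 * x + 2)); [lra|]. eapply Rle_trans; [|apply K2]. nra.
    + apply Rle_div_l; auto. replace ((PI + PI / x) * x) with (PI * (x + 1)) by (field; lra). nra.
  - replace (Finite PI) with (Finite (PI - 0)) by (f_equal; ring).
    apply is_lim_seq_minus'; [apply is_lim_seq_const | apply is_lim_seq_const_div_INR_S].
  - replace (Finite PI) with (Finite (PI + 0)) by (f_equal; ring).
    apply is_lim_seq_plus'; [apply is_lim_seq_const | apply is_lim_seq_const_div_INR_S].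
Qed.

(** * Stirling's formula *)

Definition stir (n : nat) : R := ln (INR (fact n)) - (INR n + / 2) * ln (INR n) + INR n.

Lemma ln_1_plus_taylor (x : R) : 0 < x -> 0 <= ln (1 + x) - x + x ^ 2 / 2 <= x ^ 3.
Proof.
  intros Hx.
  destruct (MVT_gen (fun x => ln (1 + x) - x + x ^ 2 / 2) 0 x (fun x => x ^ 2 / (1 + x))) as [y [Hy H]].
  - intros y Hy. rewrite Rmin_left, Rmax_right in Hy by lra. auto_derive; [lra | field; lra].
  - intros y Hy. rewrite Rmin_left, Rmax_right in Hy by lra.
    apply derivable_continuous_pt. exists (y ^ 2 / (1 + y)). apply is_derive_Reals.
    auto_derive; [lra | field; lra].
  - rewrite Rmin_left, Rmax_right in Hy by lra. rewrite Rplus_0_r, ln_1 in H.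
    replace (ln (1 + x) - x + x ^ 2 / 2) with (y ^ 2 / (1 + y) * x) by lra.
    assert (0 <= y ^ 2 / (1 + y) <= y ^ 2).
    { split; [apply Rdiv_le_0_compat; nra|]. apply Rle_div_l; nra. }
    split; [nra|]. simpl pow in *. assert (y * y <= x * x) by nra. nra.
Qed.

(** The difference is 1 - (N + 1/2) ln (1 + 1/N). The weight N + 1/2 cancels the term of order 1/N
    and leaves O(1/N^2), bounded here in telescoping form. *)
Lemma stir_diff (n : nat) : Rabs (stir (S (S n)) - stir (S n)) <= 4 * (/ INR (S n) - / INR (S (S n))).
Proof.
  unfold stir. change (fact (S (S n))) with (S (S n) * fact (S n))%nat.
  assert (P := INR_S_pos n). assert (P' := INR_S_pos (S n)). assert (F := INR_fact_lt_0 (S n)).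
  rewrite mult_INR, ln_mult by auto.
  assert (E : INR (S (S n)) = INR (S n) + 1) by (rewrite (S_INR (S n)); ring).
  assert (Hone : 1 <= INR (S n)) by (rewrite S_INR; assert (H := pos_INR n); lra).
  rewrite E in *. set (N := INR (S n)) in *. clearbody N.
  assert (T := ln_1_plus_taylor (/ N) ltac:(apply Rinv_0_lt_compat; auto)).
  assert (L : ln (N + 1) = ln N + ln (1 + / N)).
  { rewrite <- ln_mult; [f_equal; field; lra | auto |]. assert (0 < / N) by (apply Rinv_0_lt_compat; auto). lra. }
  rewrite L. set (g := ln (1 + / N) - / N + (/ N) ^ 2 / 2) in *.
  replace (ln (1 + / N)) with (g + / N - (/ N) ^ 2 / 2) by (unfold g; ring). clearbody g.
  match goal with |- Rabs ?e <= _ => replace e with ((/ N) ^ 2 / 4 - (N + / 2) * g) by (field; lra) end.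
  replace (4 * (/ N - / (N + 1))) with (4 * N / (N + 1) * (/ N) ^ 2) by (field; lra).
  assert (Hn : 0 < / N) by (apply Rinv_0_lt_compat; auto).
  assert (Hn1 : / N <= 1) by (rewrite <- Rinv_1; apply Rinv_le_contravar; lra).
  assert (HNi : N * / N = 1) by (field; lra).
  assert (G1 : (N + / 2) * g <= 3 / 2 * (/ N) ^ 2).
  { apply Rle_trans with ((N + / 2) * (/ N) ^ 3); [apply Rmult_le_compat_l; lra|].
    replace ((N + / 2) * (/ N) ^ 3) with ((1 + / 2 * / N) * (/ N) ^ 2) by (field; lra).
    apply Rmult_le_compat_r; nra. }
  assert (G0 : 0 <= (N + / 2) * g) by (apply Rmult_le_pos; lra).
  assert (K : 2 <= 4 * N / (N + 1)) by (apply Rle_div_r; lra).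
  assert (S : 0 < (/ N) ^ 2) by nra.
  apply Rabs_le. split; nra.
Qed.

(** The limit d exists by the rate. Its value follows by doubling the index: 2 stir(n) - stir(2n)
    tends to d, while it is also a function of [wall n], so that Wallis's product gives exp (2 d) /
    2 = PI. *)
Lemma stir_lim : is_lim_seq stir (ln (2 * PI) / 2).
Proof.
  assert (Pp := PI_RGT_0).
  destruct (ex_lim_of_rate (fun n => stir (S n)) 4) as [d Hd].
  { intros n k.
    assert (H : Rabs (stir (S (k + n)) - stir (S n)) <= 4 * (/ INR (S n) - / INR (S (k + n)))).
    { induction k; [simpl; rewrite Rminus_diag_eq, Rabs_R0 by auto; lra|].
      replace (stir (S (S k + n)) - stir (S n)) with
        ((stir (S (S (k + n))) - stir (S (k + n))) + (stir (S (k + n)) - stir (S n))) by (simpl; ring).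
      eapply Rle_trans; [apply Rabs_triang|]. assert (H := stir_diff (k + n)). change (S k + n)%nat with (S (k + n)). lra. }
    eapply Rle_trans; [apply H|]. assert (0 < / INR (S (k + n))) by (apply Rinv_0_lt_compat, INR_S_pos).
    unfold Rdiv. nra. }
  apply is_lim_seq_incr_1 in Hd.
  replace (ln (2 * PI) / 2) with d; auto.
  assert (H2 : is_lim_seq (fun n => exp (2 * (2 * stir (S n) - stir (2 * S n))) / 2) (exp (2 * (2 * d - d)) / 2)).
  { assert (H1 := proj1 (is_lim_seq_incr_1 _ _) Hd).
    assert (H3 : is_lim_seq (fun n => stir (2 * S n)) d).
    { apply (is_lim_seq_subseq stir d (fun n => (2 * S n)%nat)); auto.
      apply eventually_subseq_loc. exists 0%nat. intros; lia. }
    apply (is_lim_seq_div' _ _ (exp (2 * (2 * d - d))) 2); [|apply is_lim_seq_const|lra].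
    apply (is_lim_seq_continuous exp _ (2 * (2 * d - d))).
    - apply derivable_continuous, derivable_exp.
    - apply (is_lim_seq_scal_l _ 2 (2 * d - d)). apply is_lim_seq_minus'; auto.
      apply (is_lim_seq_scal_l _ 2 d). auto. }
  assert (E : forall n, wall (S n) ^ 2 / INR (S n) = exp (2 * (2 * stir (S n) - stir (2 * S n))) / 2).
  { intros n. assert (P := INR_S_pos n). unfold wall. set (m := S n) in *.
    assert (F1 := INR_fact_lt_0 m). assert (F2 := INR_fact_lt_0 (2 * m)).
    assert (H4 : 0 < 4 ^ m) by (apply pow_lt; lra).
    set (w := 4 ^ m * INR (fact m) ^ 2 / INR (fact (2 * m))).
    assert (Hw : 0 < w) by apply (wall_pos m).
    assert (Lw : ln w = INR m * (2 * ln 2) + 2 * ln (INR (fact m)) - ln (INR (fact (2 * m)))).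
    { unfold w. rewrite ln_div, ln_mult, !ln_pow; try lra; try (apply pow_lt; lra); [|apply Rmult_lt_0_compat; auto; apply pow_lt; auto].
      replace 4 with (2 * 2) by ring. rewrite ln_mult by lra. simpl (INR 2). ring. }
    replace (w ^ 2 / INR m) with (exp (ln (w ^ 2 / INR m / / 2)) / 2).
    2: { rewrite exp_ln; [field; lra|]. apply Rdiv_lt_0_compat; [|lra]. apply Rdiv_lt_0_compat; auto. apply pow_lt; auto. }
    do 2 f_equal. rewrite ln_div, ln_div, ln_pow, ln_Rinv, Lw; try lra; try (apply pow_lt; auto).
    2: { apply Rdiv_lt_0_compat; auto. apply pow_lt; auto. }
    unfold stir. rewrite mult_INR, ln_mult by (solve [lra | simpl; lra]). replace (INR 2) with 2 by (simpl; ring). field. }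
  assert (H3 := is_lim_seq_ext _ _ _ E wallis).
  apply is_lim_seq_unique in H2. apply is_lim_seq_unique in H3. rewrite H2 in H3.
  injection H3 as H3. replace (2 * PI) with (exp (2 * (2 * d - d))) by lra. rewrite ln_exp. field.
Qed.

(** * Gauss's multiplication formula *)

Lemma Clim_inv (u : nat -> C) (l : C) : l <> 0%C -> Clim u l -> Clim (fun n => / u n)%C (/ l)%C.
Proof.
  intros Hl [H1 H2].
  assert (Hd : Re l ^ 2 + Im l ^ 2 <> 0).
  { intros E. apply Hl, Cmod_eq_0. unfold Cmod. change (fst l) with (Re l). change (snd l) with (Im l).
    rewrite E. apply sqrt_0. }
  assert (L : is_lim_seq (fun n => Re (u n) ^ 2 + Im (u n) ^ 2) (Re l ^ 2 + Im l ^ 2)).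
  { apply (is_lim_seq_plus' _ _ (Re l ^ 2) (Im l ^ 2)); simpl;
      apply (is_lim_seq_mult' _ _ _ _); auto; apply (is_lim_seq_mult' _ _ _ _); auto; apply is_lim_seq_const. }
  split.
  - apply (is_lim_seq_div' (fun n => Re (u n)) (fun n => Re (u n) ^ 2 + Im (u n) ^ 2) (Re l) (Re l ^ 2 + Im l ^ 2)); auto.
  - apply (is_lim_seq_div' (fun n => - Im (u n)) (fun n => Re (u n) ^ 2 + Im (u n) ^ 2) (- Im l) (Re l ^ 2 + Im l ^ 2)); auto.
    apply (is_lim_seq_opp (fun n => Im (u n)) (Im l)); auto.
Qed.

Lemma Clim_prodC {A : Type} (f : A -> nat -> C) (g : A -> C) (l : list A) :
  (forall a, Clim (f a) (g a)) -> Clim (fun n => prodC (map (fun a => f a n) l)) (prodC (map g l)).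
Proof.
  intros H. induction l; simpl.
  - apply (Clim_const 1).
  - apply (Clim_mult (f a) (fun n => prodC (map (fun a => f a n) l))); auto.
Qed.

(* Gauss's approximants with [n] instead of [n + 1] factors: for these the multiplication formula is exact
   up to a constant factor. *)
Definition gG (n : nat) (z : C) : C :=
  (ris z n * RtoC (INR n) / (RtoC (INR (fact n)) * cpow (INR n) z))%C.

Lemma gG_lim (z : C) : Clim (fun n => gG (S n) z) (rgammaC z).
Proof.
  assert (H : Clim (fun n => rG (S n) z * / (1 + z * RtoC (/ INR (S n))))%C (rgammaC z * / 1)%C).
  { apply Clim_mult.
    - apply (Clim_subseq (fun n => rG n z) _ S); [|apply rgammaC_lim].
      apply eventually_subseq_loc. exists 0%nat; intros; lia.
    - apply Clim_inv; [apply RtoC_neq_0; lra|].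
      apply (Clim_of_Cmod _ _ (fun n => Cmod z / INR (S n))); [|apply is_lim_seq_const_div_INR_S].
      intros n. right. replace (1 + z * RtoC (/ INR (S n)) - 1)%C with (z * RtoC (/ INR (S n)))%C by ring.
      rewrite Cmod_mult, Cmod_R, Rabs_pos_eq; [reflexivity|].
      apply Rlt_le, Rinv_0_lt_compat, INR_S_pos. }
  replace (rgammaC z * / 1)%C with (rgammaC z) in H by (field; apply RtoC_neq_0; lra).
  (* Only for n > |z| is it certain that n + z, the factor by which the two approximants differ,
     does not vanish. *)
  destruct (nfloor_ex (Cmod z) (Cmod_ge_0 z)) as [N HN].
  apply (Clim_ext_loc _ _ _ N) with (2 := H).
  intros n Hn. rewrite rG_ris, ris_S. unfold gG.
  assert (P := INR_S_pos n). rewrite RtoC_inv by lra.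
  assert (Ne : (RtoC (INR (S n)) + z)%C <> 0%C).
  { intros E. assert (E' : z = (- RtoC (INR (S n)))%C) by (replace z with ((RtoC (INR (S n)) + z) - RtoC (INR (S n)))%C by ring; rewrite E; ring).
    assert (M : Cmod z = INR (S n)) by (rewrite E', Cmod_opp, Cmod_R, Rabs_pos_eq; lra).
    assert (INR (S N) <= INR (S n)) by (apply le_INR; lia). rewrite S_INR in H0. lra. }
  field. repeat split; auto.
  - apply cpow_neq_0. - apply RtoC_neq_0, INR_fact_neq_0. - apply RtoC_neq_0; lra.
Qed.

Lemma ris_add (z : C) (a b : nat) : ris z (a + b) = (ris z a * ris (z + RtoC (INR a)) b)%C.
Proof.
  induction b.
  - rewrite Nat.add_0_r. unfold ris at 3. simpl. ring.
  - rewrite Nat.add_succ_r, !ris_S, IHb, plus_INR, RtoC_plus. ring.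
Qed.

Lemma prodC_ext {A : Type} (f g : A -> C) (l : list A) :
  (forall a, In a l -> f a = g a) -> prodC (map f l) = prodC (map g l).
Proof. intros H. f_equal. apply map_ext_in. auto. Qed.

Lemma prodC_mult {A : Type} (f g : A -> C) (l : list A) :
  prodC (map (fun a => f a * g a)%C l) = (prodC (map f l) * prodC (map g l))%C.
Proof.
  induction l; simpl; [ring|]. unfold prodC in *; simpl; rewrite IHl. ring.
Qed.

Lemma prodC_const {A : Type} (a : R) (l : list A) :
  prodC (map (fun _ => RtoC a) l) = RtoC (a ^ length l).
Proof. induction l; simpl; [reflexivity|]. rewrite IHl, <- RtoC_mult. reflexivity. Qed.

Lemma prodC_inv (f : list C) : prodC (map Cinv f) = (/ prodC f)%C.
Proof.
  assert (I1 : (/ RtoC 1)%C = RtoC 1) by (rewrite <- RtoC_inv, Rinv_1 by lra; auto).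
  assert (Iz : (/ RtoC 0)%C = RtoC 0).
  { apply C_ext; unfold Cinv; simpl; unfold Rdiv; ring. }
  induction f; simpl; [auto|]. unfold prodC in *; simpl; rewrite IHf.
  set (p := fold_right _ _ _).
  destruct (Ceq_dec a 0) as [E|E]; [rewrite E, Iz, !Cmult_0_l; auto|].
  destruct (Ceq_dec p 0) as [E'|E']; [rewrite E', Iz, !Cmult_0_r; auto|].
  field. auto.
Qed.

(** Multiplied by q, the factors z + k/q + i become q z + m with m = k + q i, and each m below q n
    occurs exactly once. *)
Lemma ris_scale (q n : nat) (z : C) : (0 < q)%nat ->
  (prodC (map (fun k => ris (z + RtoC (INR k / INR q)) n) (seq 0 q)) * RtoC (INR q ^ (q * n)))%C
  = ris (RtoC (INR q) * z) (q * n).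
Proof.
  intros Hq. assert (Hq' : INR q <> 0) by (apply not_0_INR; lia).
  induction n.
  - rewrite Nat.mul_0_r. unfold ris; simpl.
    rewrite prodC_const, pow1, <- RtoC_mult. f_equal; ring.
  - rewrite Nat.mul_succ_r, ris_add, <- IHn, pow_add, RtoC_mult.
    assert (E : ris (RtoC (INR q) * z + RtoC (INR (q * n))) q =
      (prodC (map (fun k => z + RtoC (INR k / INR q) + RtoC (INR n)) (seq 0 q)) * RtoC (INR q ^ q))%C).
    { unfold ris. replace (INR q ^ q) with (INR q ^ length (seq 0 q)) by (rewrite length_seq; auto). rewrite <- prodC_const, <- prodC_mult.
      apply prodC_ext. intros k _. rewrite RtoC_div by auto. rewrite mult_INR, RtoC_mult. field.
      apply RtoC_neq_0; auto. }
    rewrite E.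
    rewrite (prodC_ext _ (fun k => ris (z + RtoC (INR k / INR q)) n * (z + RtoC (INR k / INR q) + RtoC (INR n)))%C).
    2: { intros k _. apply ris_S. }
    rewrite prodC_mult. ring.
Qed.

Lemma cpow_prod_shift (x : R) (z : C) (q m : nat) :
  prodC (map (fun k => cpow x (z + RtoC (INR k / INR q))) (seq 0 m))
  = cpow x (RtoC (INR m) * z + RtoC (INR m * (INR m - 1) / 2 / INR q)).
Proof.
  induction m.
  - simpl. rewrite cpow_cexp. replace (0 * (0 - 1) / 2 / INR q) with 0 by (unfold Rdiv; ring).
    replace ((RtoC 0 * z + RtoC 0) * RtoC (ln x))%C with (RtoC 0) by ring. now rewrite cexp_0.
  - rewrite seq_S, map_app, prodC_app, IHm. simpl map. unfold prodC at 1; simpl fold_right.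
    rewrite Cmult_1_r, <- cpow_add. f_equal. rewrite S_INR.
    replace ((INR m + 1) * (INR m + 1 - 1) / 2 / INR q) with (INR m * (INR m - 1) / 2 / INR q + INR m / INR q)
      by (unfold Rdiv; set (i := / INR q); field).
    rewrite !RtoC_plus. ring.
Qed.

(** The constant in Gauss's formula for 1/Gamma once the power q^(q z) has been split off. *)
Definition mulc (q : nat) : R := Rpower (2 * PI) ((1 - INR q) / 2) * Rpower (INR q) (- / 2).

Lemma mulc_pos (q : nat) : 0 < mulc q.
Proof. apply Rmult_lt_0_compat; apply exp_pos. Qed.

(** The factor of the multiplication formula for the approximants that does not depend on z. Its
    logarithm is stir(q n) - q stir(n) - (ln q)/2, so Stirling's formula gives its limit. *)
Definition mulc_seq (q n : nat) : R :=
  INR n ^ q * INR (fact (q * n)) / (INR q ^ (q * n) * INR (fact n) ^ q * Rpower (INR n) ((INR q - 1) / 2) * INR (q * n)).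

Lemma mulc_seq_lim (q : nat) : (0 < q)%nat -> is_lim_seq (fun n => mulc_seq q (S n)) (mulc q).
Proof.
  intros Hq. assert (Q : 0 < INR q) by (apply lt_0_INR; auto).
  apply is_lim_seq_ext with (fun n => exp (stir (q * S n) - INR q * stir (S n) - / 2 * ln (INR q))).
  - intros n. symmetry. unfold mulc_seq, stir. assert (P := INR_S_pos n). set (m := S n) in *.
    assert (F1 := INR_fact_lt_0 m). assert (F2 := INR_fact_lt_0 (q * m)).
    assert (Pr : 0 < Rpower (INR m) ((INR q - 1) / 2)) by apply exp_pos.
    assert (P1 : 0 < INR m ^ q) by (apply pow_lt; auto).
    assert (P2 : 0 < INR q ^ (q * m)) by (apply pow_lt; auto).
    assert (P3 : 0 < INR (fact m) ^ q) by (apply pow_lt; auto).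
    rewrite mult_INR. assert (P4 : 0 < INR q * INR m) by (apply Rmult_lt_0_compat; auto).
    match goal with |- ?e = _ => rewrite <- (exp_ln e) end.
    2: { apply Rdiv_lt_0_compat; repeat apply Rmult_lt_0_compat; auto. }
    f_equal. rewrite ln_div; [|repeat apply Rmult_lt_0_compat; auto..].
    rewrite !ln_mult; auto; [|repeat apply Rmult_lt_0_compat; auto..].
    rewrite !ln_pow by auto. unfold Rpower. rewrite ln_exp, mult_INR. field.
  - assert (E : mulc q = exp (ln (2 * PI) / 2 - INR q * (ln (2 * PI) / 2) - / 2 * ln (INR q))).
    { unfold mulc, Rpower. rewrite <- exp_plus. f_equal. field. }
    rewrite E. apply (is_lim_seq_continuous exp _ (ln (2 * PI) / 2 - INR q * (ln (2 * PI) / 2) - / 2 * ln (INR q))).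
    + apply derivable_continuous, derivable_exp.
    + apply is_lim_seq_minus'; [|apply is_lim_seq_const]. apply is_lim_seq_minus'.
      * apply (is_lim_seq_subseq stir _ (fun n => (q * S n)%nat)); [|apply stir_lim].
        apply eventually_subseq_loc. exists 0%nat. intros; nia.
      * apply (is_lim_seq_scal_l _ (INR q) (ln (2 * PI) / 2)). apply (is_lim_seq_incr_1 stir), stir_lim.
Qed.

Lemma gG_multiplication (q n : nat) (z : C) : (0 < q)%nat ->
  prodC (map (fun k => gG (S n) (z + RtoC (INR k / INR q))) (seq 0 q))
  = (RtoC (mulc_seq q (S n)) * cpow (INR q) (RtoC (INR q) * z) * gG (q * S n) (RtoC (INR q) * z))%C.
Proof.
  intros Hq. assert (Q : 0 < INR q) by (apply lt_0_INR; auto).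
  assert (P := INR_S_pos n). set (m := S n) in *.
  assert (F1 := INR_fact_lt_0 m). assert (F2 := INR_fact_lt_0 (q * m)).
  unfold gG, Cdiv.
  rewrite (prodC_mult (fun k => ris (z + RtoC (INR k / INR q)) m * RtoC (INR m))%C
             (fun k => / (RtoC (INR (fact m)) * cpow (INR m) (z + RtoC (INR k / INR q))))%C).
  rewrite prodC_mult, prodC_const, length_seq.
  rewrite <- (map_map (fun k => RtoC (INR (fact m)) * cpow (INR m) (z + RtoC (INR k / INR q)))%C Cinv), prodC_inv.
  rewrite prodC_mult, prodC_const, length_seq, cpow_prod_shift, <- ris_scale by auto.
  rewrite mult_INR, (cpow_mult (INR q) (INR m)) by auto.
  rewrite cpow_add, (cpow_R (INR m) (INR q * (INR q - 1) / 2 / INR q)).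
  replace (INR q * (INR q - 1) / 2 / INR q) with ((INR q - 1) / 2) by (field; lra).
  unfold mulc_seq. rewrite mult_INR.
  assert (Pr : 0 < Rpower (INR m) ((INR q - 1) / 2)) by apply exp_pos.
  assert (P1 : 0 < INR m ^ q) by (apply pow_lt; auto).
  assert (P2 : 0 < INR q ^ (q * m)) by (apply pow_lt; auto).
  assert (P3 : 0 < INR (fact m) ^ q) by (apply pow_lt; auto).
  rewrite RtoC_div.
  2: { assert (0 < INR q ^ (q * m) * INR (fact m) ^ q * Rpower (INR m) ((INR q - 1) / 2) * (INR q * INR m)); [|lra].
       repeat apply Rmult_lt_0_compat; auto. }
  rewrite !RtoC_mult. field.
  repeat split; try apply cpow_neq_0; apply RtoC_neq_0; lra.
Qed.

Theorem rgammaC_multiplication (q : nat) (z : C) : (0 < q)%nat ->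
  prodC (map (fun k => rgammaC (z + RtoC (INR k / INR q))) (seq 0 q))
  = (RtoC (mulc q) * cpow (INR q) (RtoC (INR q) * z) * rgammaC (RtoC (INR q) * z))%C.
Proof.
  intros Hq.
  apply (Clim_unique (fun n => prodC (map (fun k => gG (S n) (z + RtoC (INR k / INR q))) (seq 0 q)))).
  - apply (Clim_prodC (fun k n => gG (S n) (z + RtoC (INR k / INR q)))). intros k. apply gG_lim.
  - apply Clim_ext_loc with (fun n => RtoC (mulc_seq q (S n)) * cpow (INR q) (RtoC (INR q) * z) * gG (q * S n) (RtoC (INR q) * z))%C 0%nat.
    { intros. symmetry. apply gG_multiplication; auto. }
    apply Clim_mult; [apply Clim_mult; [|apply Clim_const]|].
    + apply Clim_RtoC, mulc_seq_lim; auto.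
    + apply Clim_ext_loc with (fun n => (fun m => gG (S m) (RtoC (INR q) * z)) (q * S n - 1)%nat) 0%nat.
      { intros n _. f_equal. nia. }
      apply (Clim_subseq (fun m => gG (S m) (RtoC (INR q) * z))); [|apply gG_lim].
      apply eventually_subseq_loc. exists 0%nat. intros; nia.
Qed.

(** The argument is moved by 1/q so that k runs from 1 to q: the last factor is then 1/Gamma(z + 1),
    as in the parameter lists of the Fox functions. *)
Lemma rgammaC_multiplication_1 (q : nat) (z : C) : (0 < q)%nat ->
  prodC (map (fun k => rgammaC (z + RtoC (INR k / INR q))) (seq 1 q))
  = (RtoC (mulc q) * cpow (INR q) (RtoC (INR q) * z + 1) * rgammaC (RtoC (INR q) * z + 1))%C.
Proof.
  intros Hq. assert (Q : INR q <> 0) by (apply not_0_INR; lia).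
  replace (RtoC (INR q) * z + 1)%C with (RtoC (INR q) * (z + RtoC (/ INR q)))%C.
  2: { rewrite RtoC_inv by auto. field. apply RtoC_neq_0; auto. }
  rewrite <- rgammaC_multiplication by auto. rewrite <- seq_shift, map_map.
  apply prodC_ext. intros k _. f_equal. rewrite S_INR.
  replace ((INR k + 1) / INR q) with (/ INR q + INR k / INR q) by (field; auto). rewrite RtoC_plus. ring.
Qed.

Lemma rgam_multiplication_1 (q : nat) (z : R) : (0 < q)%nat ->
  prodR (map (fun k => rgam (z + INR k / INR q)) (seq 1 q))
  = mulc q * Rpower (INR q) (INR q * z + 1) * rgam (INR q * z + 1).
Proof.
  intros Hq. assert (H := rgammaC_multiplication_1 q (RtoC z) Hq).
  rewrite <- RtoC_mult, <- RtoC_plus, cpow_R, rgammaC_R, <- !RtoC_mult in H.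
  rewrite (prodC_ext _ (fun k => RtoC (rgam (z + INR k / INR q)))) in H.
  2: { intros k _. rewrite <- RtoC_plus. apply rgammaC_R. }
  rewrite prodC_RtoC in H. apply (f_equal Re) in H. exact H.
Qed.

(** * The multiplication formula at its poles *)

Lemma prodR_cons (a : R) (l : list R) : prodR (a :: l) = a * prodR l.
Proof. reflexivity. Qed.

Lemma poch_S_l (r : R) (n : nat) : poch r (S n) = r * poch (r + 1) n.
Proof.
  induction n; [rewrite poch_S; unfold poch; simpl; ring|].
  rewrite poch_S, IHn, poch_S, S_INR. ring.
Qed.

Lemma rgam_poch (r : R) (n : nat) : rgam r = poch r n * rgam (r + INR n).
Proof.
  induction n; [unfold poch; simpl; rewrite Rplus_0_r; ring|].
  rewrite IHn, (rgam_succ (r + INR n)), poch_S, S_INR, Rplus_assoc. ring.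
Qed.

Lemma poch_opp_INR (n : nat) : poch (- INR n) n = (-1) ^ n * INR (fact n).
Proof.
  induction n; [unfold poch; simpl; ring|].
  rewrite poch_S_l, S_INR. replace (- (INR n + 1) + 1) with (- INR n) by ring. rewrite IHn.
  change (fact (S n)) with (S n * fact n)%nat. rewrite mult_INR, S_INR. simpl. ring.
Qed.

Lemma continuity_prodR {A : Type} (f : A -> R -> R) (l : list A) :
  (forall a, continuity (f a)) -> continuity (fun y => prodR (map (fun a => f a y) l)).
Proof.
  intros H. induction l; simpl.
  - apply continuity_cst.
  - apply continuity_mult; auto.
Qed.

Lemma continuity_affine (a b : R) : continuity (fun y => a + b * y).
Proof. apply derivable_continuous. intros y. exists b. apply is_derive_Reals. auto_derive; auto. ring. Qed.

Lemma continuity_rgam_affine (a b : R) : continuity (fun y => rgam (a + b * y)).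
Proof.
  apply (continuity_comp (fun y => a + b * y) rgam); [apply continuity_affine | intros x; apply rgam_continuous].
Qed.

Lemma continuity_poch_affine (a b : R) (n : nat) : continuity (fun y => poch (a + b * y) n).
Proof.
  apply (continuity_prodR (fun k y => a + b * y + INR k)). intros k.
  apply continuity_plus; [apply continuity_affine | apply continuity_cst].
Qed.

Lemma continuity_eq_at_0 (F G : R -> R) :
  continuity F -> continuity G -> (forall y, y <> 0 -> F y = G y) -> F 0 = G 0.
Proof.
  intros HF HG H. destruct (Req_dec (F 0) (G 0)) as [E|E]; auto. exfalso.
  assert (C := continuity_minus F G HF HG 0).
  destruct (C (Rabs (F 0 - G 0))) as [d [Hd K]]; [apply Rabs_pos_lt; lra|].
  specialize (K (d / 2)). simpl in K. unfold R_dist, minus_fct in K.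
  assert (K' := K ltac:(split; [split; [exact I | lra] | rewrite Rminus_0_r, Rabs_pos_eq; lra])).
  rewrite H in K' by lra. replace (G (d / 2) - G (d / 2) - (F 0 - G 0)) with (- (F 0 - G 0)) in K' by ring.
  rewrite Rabs_Ropp in K'. lra.
Qed.

(* The multiplication formula at the pole [- N / q] of the [j]-th factor, both sides divided by the
   distance to the pole. *)
Lemma rgam_multiplication_residue (q j n : nat) : (1 <= j <= q)%nat ->
  let f := fun k => rgam ((INR k - INR j) / INR q - INR n) in
  let N := (q * n + j)%nat in
  (-1) ^ n * INR (fact n) * (prodR (map f (seq 1 (j - 1))) * prodR (map f (seq (S j) (q - j))))
  = mulc q * Rpower (INR q) (1 - INR N) * INR q * ((-1) ^ (N - 1) * INR (fact (N - 1))).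
Proof.
  intros Hj f N. assert (Q : INR q <> 0) by (apply not_0_INR; lia).
  set (fy := fun k y => rgam ((INR k - INR j) / INR q - INR n + 1 * y)).
  set (P := fun y => prodR (map (fun k => fy k y) (seq 1 (j - 1))) * prodR (map (fun k => fy k y) (seq (S j) (q - j)))).
  set (M := (N - 1)%nat). assert (HM : N = S M) by (unfold M, N; lia).
  (* The vanishing factor is y on the left and q y on the right, which leaves the additional q in
     [G]. Equality for y <> 0 reaches y = 0 by continuity. *)
  set (F := fun y => poch (- INR n + 1 * y) n * rgam (1 + 1 * y) * P y).
  set (G := fun y => mulc q * Rpower (INR q) (1 - INR N + INR q * y) * (INR q * (poch (- INR M + INR q * y) M * rgam (1 + INR q * y)))).
  assert (E : F 0 = G 0).
  { apply continuity_eq_at_0.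
    - apply continuity_mult; [apply continuity_mult|].
      + apply continuity_poch_affine. + apply continuity_rgam_affine.
      + apply continuity_mult; apply continuity_prodR; intros k; apply continuity_rgam_affine.
    - apply continuity_mult; [apply continuity_mult|].
      + apply continuity_cst.
      + apply derivable_continuous. intros y. exists (INR q * ln (INR q) * Rpower (INR q) (1 - INR N + INR q * y)).
        apply is_derive_Reals. unfold Rpower. auto_derive; auto. ring.
      + apply continuity_mult; [apply continuity_cst|].
        apply continuity_mult; [apply continuity_poch_affine | apply continuity_rgam_affine].
    - intros y Hy. apply (Rmult_eq_reg_l y); auto.
      assert (H := rgam_multiplication_1 q (- INR N / INR q + y) ltac:(lia)).
      assert (HN : INR N = INR q * INR n + INR j) by (unfold N; rewrite plus_INR, mult_INR; auto).
      replace (seq 1 q) with (seq 1 (j - 1) ++ j :: seq (S j) (q - j)) in H.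
      2: { replace (j :: seq (S j) (q - j)) with (seq (1 + (j - 1)) (S (q - j))) by (simpl; f_equal; try f_equal; lia).
           rewrite <- seq_app. f_equal. lia. }
      rewrite map_app, prodR_app, map_cons, prodR_cons in H.
      assert (HE : forall l, map (fun k => rgam (- INR N / INR q + y + INR k / INR q)) l = map (fun k => fy k y) l).
      { apply map_ext. intros k. unfold fy. f_equal. rewrite HN. field. auto. }
      rewrite !HE in H.
      replace (- INR N / INR q + y + INR j / INR q) with (- INR n + 1 * y) in H by (rewrite HN; field; auto).
      replace (INR q * (- INR N / INR q + y) + 1) with (1 - INR N + INR q * y) in H by (field; auto).
      (* Splitting off n + 1 factors makes the zero y visible; the last argument becomes 1 + y,
         where 1/Gamma is close to 1. The right side is treated likewise with M + 1 factors. *)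
      rewrite (rgam_poch (- INR n + 1 * y) (S n)), poch_S in H.
      replace (1 - INR N + INR q * y) with (- INR M + INR q * y) in H at 2 by (rewrite HM, S_INR; ring).
      rewrite (rgam_poch (- INR M + INR q * y) (S M)), poch_S, !S_INR in H.
      replace (- INR n + 1 * y + (INR n + 1)) with (1 + 1 * y) in H by ring.
      replace (- INR M + INR q * y + (INR M + 1)) with (1 + INR q * y) in H by ring.
      replace (- INR n + 1 * y + INR n) with y in H by ring.
      replace (- INR M + INR q * y + INR M) with (INR q * y) in H by ring.
      unfold F, G, P.
      match type of H with ?l = _ => match goal with |- ?l' = _ => replace l' with l by ring end end.
      rewrite H. ring. }
  assert (HE : forall l, map (fun k => fy k 0) l = map f l).
  { apply map_ext. intros k. unfold f, fy. f_equal. ring. }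
  unfold F, G, P in E. rewrite !HE, !Rmult_0_r, !Rplus_0_r, rgam_1, !poch_opp_INR in E.
  fold M. lra.
Qed.

(** * Dominated improper integrals *)

(** Symmetric limits are taken because Perron's integrand, with which everything starts, is not
    absolutely integrable. *)
Definition sint (f : R -> R) (v : R) : Prop := is_lim (fun T => RInt f (- T) T) p_infty v.

Lemma continuity_ex_RInt (f : R -> R) (a b : R) : continuity f -> ex_RInt f a b.
Proof.
  intros H. apply (ex_RInt_continuous (V := R_CompleteNormedModule)). intros t _.
  apply continuity_pt_filterlim, H.
Qed.

Lemma sint_ext (f g : R -> R) (v : R) : (forall t, f t = g t) -> sint f v -> sint g v.
Proof.
  intros E H. unfold sint. eapply is_lim_ext; [|apply H]. intros T. apply RInt_ext. auto.
Qed.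

Lemma sint_plus (f g : R -> R) (v w : R) : continuity f -> continuity g ->
  sint f v -> sint g w -> sint (fun t => f t + g t) (v + w).
Proof.
  intros Cf Cg Hf Hg. unfold sint.
  apply is_lim_ext with (fun T => RInt f (- T) T + RInt g (- T) T).
  - intros T. symmetry. apply (RInt_plus f g); apply continuity_ex_RInt; auto.
  - apply (is_lim_plus' _ _ p_infty v w); auto.
Qed.

Lemma sint_scal (f : R -> R) (a v : R) : continuity f -> sint f v -> sint (fun t => a * f t) (a * v).
Proof.
  intros Cf Hf. unfold sint.
  apply is_lim_ext with (fun T => a * RInt f (- T) T).
  - intros T. symmetry. apply (RInt_scal f); apply continuity_ex_RInt; auto.
  - apply (is_lim_scal_l _ a p_infty v); auto.
Qed.

Lemma RInt_lorentz (a b : R) : is_RInt (fun t => / (1 + t ^ 2)) a b (atan b - atan a).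
Proof.
  apply (is_RInt_derive atan).
  - intros t _. apply is_derive_Reals, derivable_pt_lim_atan.
  - intros t _. apply (ex_derive_continuous (fun t => / (1 + t ^ 2))). auto_derive.
    assert (H := pow2_ge_0 t). simpl in H. lra.
Qed.

(** Majorants always have the form K / (1 + t^2): the primitive K atan t makes every tail
    explicit. *)
Lemma RInt_dominated (f : R -> R) (K a b : R) : continuity f -> a <= b ->
  (forall t, Rabs (f t) <= K / (1 + t ^ 2)) -> Rabs (RInt f a b) <= K * (atan b - atan a).
Proof.
  intros Cf Hab HK.
  assert (HI : is_RInt (fun t => K / (1 + t ^ 2)) a b (K * (atan b - atan a))).
  { apply (is_RInt_scal (V := R_NormedModule) (fun t => / (1 + t ^ 2)) a b K), RInt_lorentz. }
  apply (norm_RInt_le (V := R_NormedModule) f (fun t => K / (1 + t ^ 2)) a b); auto.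
  apply (RInt_correct (V := R_CompleteNormedModule)), continuity_ex_RInt, Cf.
Qed.

Lemma RInt_split3 (f : R -> R) (a b c d : R) : continuity f ->
  RInt f a d = RInt f a b + RInt f b c + RInt f c d.
Proof.
  intros Cf.
  rewrite <- (RInt_Chasles f a c d), <- (RInt_Chasles f a b c); try (apply continuity_ex_RInt; auto).
  reflexivity.
Qed.

Lemma RInt_tail (f : R -> R) (K T a b : R) : continuity f -> 0 <= K ->
  (forall t, Rabs (f t) <= K / (1 + t ^ 2)) -> a <= - T -> T <= b ->
  Rabs (RInt f a b - RInt f (- T) T) <= 2 * K * (PI / 2 - atan T).
Proof.
  intros Cf K0 HK Ha Hb. rewrite (RInt_split3 f a (- T) T b Cf).
  replace (RInt f a (- T) + RInt f (- T) T + RInt f T b - RInt f (- T) T) with (RInt f a (- T) + RInt f T b) by ring.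
  eapply Rle_trans; [apply Rabs_triang|].
  assert (H1 := RInt_dominated f K a (- T) Cf Ha HK). assert (H2 := RInt_dominated f K T b Cf Hb HK).
  rewrite atan_opp in H1. assert (A1 := atan_bound a). assert (A2 := atan_bound b).
  assert (K * (- atan T - atan a) <= K * (PI / 2 - atan T)) by (apply Rmult_le_compat_l; lra).
  assert (K * (atan b - atan T) <= K * (PI / 2 - atan T)) by (apply Rmult_le_compat_l; lra). lra.
Qed.

Lemma is_lim_atan_p_infty : is_lim atan p_infty (PI / 2).
Proof.
  assert (Pp := PI_RGT_0). apply is_lim_spec. intros eps. set (e := Rmin eps (PI / 2)).
  assert (He : 0 < e) by (apply Rmin_pos; [apply cond_pos | lra]).
  assert (He1 := Rmin_l eps (PI / 2)). assert (He2 := Rmin_r eps (PI / 2)). fold e in He1, He2.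
  exists (tan (PI / 2 - e / 2)). intros x Hx. apply atan_increasing in Hx. rewrite atan_tan in Hx by lra.
  assert (A := atan_bound x). apply Rabs_def1; lra.
Qed.

Lemma atan_tail_lim (K : R) : is_lim (fun T => 2 * K * (PI / 2 - atan T)) p_infty 0.
Proof.
  replace (Finite 0) with (Finite (2 * K * (PI / 2 - PI / 2))) by (f_equal; ring).
  apply (is_lim_scal_l (fun T => PI / 2 - atan T) (2 * K) p_infty (PI / 2 - PI / 2)).
  apply (is_lim_minus' (fun _ => PI / 2) atan p_infty (PI / 2) (PI / 2)); [apply is_lim_const | apply is_lim_atan_p_infty].
Qed.

Lemma sint_tail (f : R -> R) (K v T : R) : continuity f -> 0 <= K ->
  (forall t, Rabs (f t) <= K / (1 + t ^ 2)) -> sint f v ->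
  Rabs (RInt f (- T) T - v) <= 2 * K * (PI / 2 - atan T).
Proof.
  intros Cf K0 HK Hv.
  apply Rnot_lt_le. intros Hlt. set (B := 2 * K * (PI / 2 - atan T)) in *.
  apply is_lim_spec in Hv. destruct (Hv (mkposreal _ (Rlt_Rminus _ _ Hlt))) as [M HM]. simpl in HM.
  specialize (HM (Rmax (M + 1) T)).
  assert (M < Rmax (M + 1) T) by (eapply Rlt_le_trans; [|apply Rmax_l]; lra).
  assert (TT := Rmax_r (M + 1) T). set (T' := Rmax (M + 1) T) in *.
  assert (H1 := RInt_tail f K T (- T') T' Cf K0 HK ltac:(lra) ltac:(lra)). fold B in H1.
  specialize (HM H).
  assert (H2 := Rabs_triang (RInt f (- T) T - RInt f (- T') T') (RInt f (- T') T' - v)).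
  replace (RInt f (- T) T - RInt f (- T') T' + (RInt f (- T') T' - v)) with (RInt f (- T) T - v) in H2 by ring.
  rewrite (Rabs_minus_sym (RInt f (- T) T) (RInt f (- T') T')) in H2. lra.
Qed.

Lemma sint_of_tail (f : R -> R) (K v : R) :
  (forall T, 0 < T -> Rabs (RInt f (- T) T - v) <= 2 * K * (PI / 2 - atan T)) -> sint f v.
Proof.
  intros H. apply is_lim_spec. intros eps.
  assert (L := atan_tail_lim K). apply is_lim_spec in L. destruct (L eps) as [M HM].
  exists (Rmax M 0). intros T HT.
  assert (M < T) by (eapply Rle_lt_trans; [apply Rmax_l | apply HT]).
  assert (0 < T) by (eapply Rle_lt_trans; [apply Rmax_r | apply HT]).
  specialize (HM T H0). rewrite Rminus_0_r in HM. specialize (H T H1).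
  eapply Rle_lt_trans; [apply H|]. eapply Rle_lt_trans; [apply Rle_abs | apply HM].
Qed.

(** Dominated convergence: the common majorant controls the integrals beyond T, uniform convergence
    the part inside [-T, T]. The resulting bound on the distance to w yields existence and value of
    the limit integral together. *)
Lemma sint_dominated (f : nat -> R -> R) (g : R -> R) (K : R) (v : nat -> R) (w : R) :
  (forall n, continuity (f n)) -> continuity g -> 0 <= K ->
  (forall n t, Rabs (f n t) <= K / (1 + t ^ 2)) ->
  (forall T eps, 0 < T -> 0 < eps -> exists N, forall n t, (N <= n)%nat -> Rabs t <= T -> Rabs (f n t - g t) <= eps) ->
  (forall n, sint (f n) (v n)) -> is_lim_seq v w -> sint g w.
Proof.
  intros Cf Cg K0 HK HU Hv Hw. apply (sint_of_tail g K). intros T HT.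
  apply le_epsilon. intros eps Heps.
  (* Over an interval of length 2 T this accuracy costs eps/2; the other half is spent on the
     convergence of v. *)
  destruct (HU T (eps / (4 * T)) HT ltac:(apply Rdiv_lt_0_compat; lra)) as [N1 HN1].
  apply is_lim_seq_spec in Hw. destruct (Hw (mkposreal (eps / 2) ltac:(lra))) as [N2 HN2]. simpl in HN2.
  set (n := max N1 N2). specialize (HN2 n ltac:(unfold n; lia)).
  assert (H1 := sint_tail (f n) K (v n) T (Cf n) K0 (HK n) (Hv n)).
  assert (H2 : Rabs (RInt g (- T) T - RInt (f n) (- T) T) <= eps / 2).
  { rewrite <- (RInt_minus g (f n)) by (apply continuity_ex_RInt; auto).
    replace (eps / 2) with ((T - - T) * (eps / (4 * T))) by (field; lra).
    apply (norm_RInt_le_const (V := R_NormedModule) (fun t => minus (g t) (f n t))); [lra| |].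
    - intros t Ht. change (Rabs (g t - f n t) <= eps / (4 * T)). rewrite Rabs_minus_sym.
      apply (HN1 n t); [unfold n; lia|]. apply Rabs_le; lra.
    - apply (RInt_correct (V := R_CompleteNormedModule)).
      apply (continuity_ex_RInt (fun t => g t - f n t)), continuity_minus; auto. }
  replace (RInt g (- T) T - w) with ((RInt g (- T) T - RInt (f n) (- T) T) + (RInt (f n) (- T) T - v n) + (v n - w)) by ring.
  eapply Rle_trans; [apply Rabs_triang|].
  eapply Rle_trans; [apply Rplus_le_compat_r, Rabs_triang|]. lra.
Qed.

Lemma sint_scale (f : R -> R) (v a : R) : continuity f -> 0 < a -> sint f v -> sint (fun t => f (a * t)) (v / a).
Proof.
  intros Cf Ha Hf. unfold sint.
  apply is_lim_ext with (fun T => / a * RInt f (- (a * T)) (a * T)).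
  - intros T. assert (H := RInt_comp_lin f a 0 (- T) T (continuity_ex_RInt _ _ _ Cf)).
    replace (RInt f (- (a * T)) (a * T)) with (RInt f (a * - T + 0) (a * T + 0)) by (f_equal; ring). rewrite <- H.
    rewrite <- (RInt_scal (fun y => scal a (f (a * y + 0)))).
    + apply RInt_ext. intros t _. unfold scal; simpl; unfold mult; simpl. rewrite Rplus_0_r. field. lra.
    + apply (continuity_ex_RInt (fun y => a * f (a * y + 0))). apply continuity_mult; [apply continuity_cst|].
      apply (continuity_comp (fun y => a * y + 0) f); auto.
      intros y. apply derivable_continuous_pt. exists a. apply is_derive_Reals. auto_derive; auto. ring.
  - replace (Finite (v / a)) with (Rbar_mult (/ a) v) by (simpl; f_equal; field; lra).
    apply is_lim_scal_l.
    apply (is_lim_comp (fun T => RInt f (- T) T) (fun T => a * T) p_infty v p_infty); auto.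
    + apply is_lim_spec. intros M. exists (M / a). intros T HT. apply (Rmult_lt_compat_l a) in HT; auto.
      replace (a * (M / a)) with M in HT by (field; lra). auto.
    + exists 0. intros T _ E. discriminate.
Qed.

Lemma sint_reflect (f : R -> R) (v : R) : continuity f -> sint f v -> sint (fun t => f (- t)) v.
Proof.
  intros Cf Hf. unfold sint. eapply is_lim_ext; [|apply Hf]. intros T.
  assert (H := RInt_comp_lin f (-1) 0 T (- T) (continuity_ex_RInt _ _ _ Cf)).
  replace (-1 * T + 0) with (- T) in H by ring. replace (-1 * - T + 0) with T in H by ring.
  cbv beta. rewrite <- H.
  assert (Cr : continuity (fun t => f (- t))).
  { apply (continuity_comp Ropp f); auto. intros y. apply derivable_continuous_pt. exists (-1).
    apply is_derive_Reals. auto_derive; auto. }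
  rewrite <- (opp_RInt_swap (fun t => f (- t)) T (- T)) by (apply continuity_ex_RInt; auto).
  rewrite <- (RInt_opp (V := R_CompleteNormedModule) (fun t => f (- t))) by (apply continuity_ex_RInt; auto).
  apply RInt_ext. intros t _. unfold opp, scal; simpl; unfold mult; simpl.
  replace (-1 * t + 0) with (- t) by ring. ring.
Qed.

(** [MB_line] lets the two ends go to infinity independently. With the majorant, the integral from a
    to b differs from a symmetric one by a small tail, so the symmetric limit suffices. *)
Lemma is_RInt_gen_of_sint (f : R -> C) (K : R) (v : C) : Ccont f -> 0 <= K ->
  (forall t, Cmod (f t) <= K / (1 + t ^ 2)) ->
  sint (fun t => Re (f t)) (Re v) -> sint (fun t => Im (f t)) (Im v) ->
  is_RInt_gen (V := C_R_NormedModule) f (Rbar_locally m_infty) (Rbar_locally p_infty) v.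
Proof.
  intros [C1 C2] K0 HK S1 S2.
  assert (A : forall g w, continuity g -> (forall t, Rabs (g t) <= K / (1 + t ^ 2)) -> sint g w ->
     forall eps, 0 < eps -> exists M, 0 < M /\ forall a b, a < - M -> M < b -> Rabs (RInt g a b - w) < eps).
  { intros g w Cg HKg Sg eps Heps.
    assert (L := atan_tail_lim K). apply is_lim_spec in L. destruct (L (mkposreal (eps / 2) ltac:(lra))) as [M HM]. simpl in HM.
    exists (Rmax (M + 1) 1). split; [eapply Rlt_le_trans; [apply Rlt_0_1 | apply Rmax_r]|]. intros a b Ha Hb.
    set (T := Rmax (M + 1) 1) in *. assert (TM : M < T) by (eapply Rlt_le_trans; [|apply Rmax_l]; lra).
    specialize (HM T TM). rewrite Rminus_0_r in HM. assert (HM' := Rle_lt_trans _ _ _ (Rle_abs _) HM).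
    assert (H1 := RInt_tail g K T a b Cg K0 HKg ltac:(lra) ltac:(lra)).
    assert (H2 := sint_tail g K w T Cg K0 HKg Sg).
    replace (RInt g a b - w) with ((RInt g a b - RInt g (- T) T) + (RInt g (- T) T - w)) by ring.
    eapply Rle_lt_trans; [apply Rabs_triang|]. lra. }
  intros P [eps HP].
  destruct (A (fun t => Re (f t)) (Re v) C1 (fun t => Rle_trans _ _ _ (re_le_Cmod _) (HK t)) S1 eps (cond_pos eps)) as [M1 [P1 H1]].
  destruct (A (fun t => Im (f t)) (Im v) C2 (fun t => Rle_trans _ _ _ (Rabs_Im_le _) (HK t)) S2 eps (cond_pos eps)) as [M2 [P2 H2]].
  set (M := Rmax M1 M2). assert (L1 := Rmax_l M1 M2). assert (L2 := Rmax_r M1 M2). fold M in L1, L2.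
  exists (fun a => a < - M) (fun b => M < b).
  - exists (- M). auto.
  - exists M. auto.
  - intros a b Ha Hb. simpl.
    exists (RInt (fun t => Re (f t)) a b, RInt (fun t => Im (f t)) a b). split.
    + apply (is_RInt_fct_extend_pair (U := R_NormedModule) (V := R_NormedModule) f);
        apply (RInt_correct (V := R_CompleteNormedModule)); apply continuity_ex_RInt; auto.
    + apply HP. split; simpl; [apply H1 | apply H2]; lra.
Qed.

(** * Perron's integral *)

(** Real and imaginary part of exp (y w) / w at w = c + i t. *)
Definition perron_re (y c t : R) : R := exp (y * c) * (c * cos (y * t) + t * sin (y * t)) / (c ^ 2 + t ^ 2).
Definition perron_im (y c t : R) : R := exp (y * c) * (c * sin (y * t) - t * cos (y * t)) / (c ^ 2 + t ^ 2).

(** Common value of the c-derivative of the real part and the t-derivative of the imaginary part. *)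
Definition perron_dc (y c t : R) : R :=
  exp (y * c) * ((y * (c * cos (y * t) + t * sin (y * t)) + cos (y * t)) * / (c ^ 2 + t ^ 2)
                 - (c * cos (y * t) + t * sin (y * t)) * (2 * c) * (/ (c ^ 2 + t ^ 2)) ^ 2).

Lemma sum_sqr_pos (c t : R) : c <> 0 -> 0 < c ^ 2 + t ^ 2.
Proof. intros H. assert (H1 := pow2_ge_0 t). assert (H2 : 0 < c ^ 2) by (apply pow2_gt_0; auto). lra. Qed.

Lemma perron_re_derive (y c t : R) : c <> 0 -> is_derive (fun c => perron_re y c t) c (perron_dc y c t).
Proof.
  intros Hc. assert (P := sum_sqr_pos c t Hc). unfold perron_re, perron_dc. auto_derive.
  - simpl in P. lra.
  - field. lra.
Qed.

(* Cauchy-Riemann *)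
Lemma perron_im_derive (y c t : R) : c <> 0 -> is_derive (perron_im y c) t (perron_dc y c t).
Proof.
  intros Hc. assert (P := sum_sqr_pos c t Hc). unfold perron_im, perron_dc. auto_derive.
  - simpl in P. lra.
  - field. lra.
Qed.

Lemma perron_re_continuity (y c : R) : c <> 0 -> continuity (perron_re y c).
Proof.
  intros Hc t. apply continuity_pt_filterlim.
  apply (ex_derive_continuous (perron_re y c)). assert (P := sum_sqr_pos c t Hc). unfold perron_re. auto_derive.
  simpl in P. lra.
Qed.

Lemma perron_im_continuity (y c : R) : c <> 0 -> continuity (perron_im y c).
Proof.
  intros Hc t. apply continuity_pt_filterlim.
  apply (ex_derive_continuous (perron_im y c)). eexists. apply perron_im_derive; auto.
Qed.

Lemma locally_neq_0 (c : R) : c <> 0 -> locally c (fun x => x <> 0).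
Proof.
  intros Hc. assert (P : 0 < Rabs c) by (apply Rabs_pos_lt; auto).
  exists (mkposreal _ P). intros x Hx E. subst x. unfold ball in Hx; simpl in Hx. unfold AbsRing_ball, abs, minus, plus, opp in Hx; simpl in Hx.
  rewrite Rplus_0_l, Rabs_Ropp in Hx. lra.
Qed.

Lemma perron_dc_2d (y c t : R) : c <> 0 ->
  continuity_2d_pt (fun u v => Derive (fun z => perron_re y z v) u) c t.
Proof.
  intros Hc. assert (P := sum_sqr_pos c t Hc).
  apply continuity_2d_pt_ext_loc with (perron_dc y).
  - destruct (locally_neq_0 c Hc) as [e He]. exists e. intros u v Hu Hv. symmetry.
    apply is_derive_unique, perron_re_derive, He, Hu.
  - assert (C1 := continuity_2d_pt_id1 c t). assert (C2 := continuity_2d_pt_id2 c t).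
    assert (Cy := continuity_2d_pt_const c t y).
    assert (Cc : continuity_2d_pt (fun u v => cos (y * v)) c t).
    { apply (continuity_1d_2d_pt_comp cos (fun u v => y * v)); [apply continuity_cos|]. apply continuity_2d_pt_mult; auto. }
    assert (Cs : continuity_2d_pt (fun u v => sin (y * v)) c t).
    { apply (continuity_1d_2d_pt_comp sin (fun u v => y * v)); [apply continuity_sin|]. apply continuity_2d_pt_mult; auto. }
    assert (Ce : continuity_2d_pt (fun u v => exp (y * u)) c t).
    { apply (continuity_1d_2d_pt_comp exp (fun u v => y * u)); [apply derivable_continuous, derivable_exp|]. apply continuity_2d_pt_mult; auto. }
    assert (Cm : continuity_2d_pt (fun u v => u * cos (y * v) + v * sin (y * v)) c t).
    { apply continuity_2d_pt_plus; apply continuity_2d_pt_mult; auto. }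
    assert (Ci : continuity_2d_pt (fun u v => / (u ^ 2 + v ^ 2)) c t).
    { apply continuity_2d_pt_inv; [|lra]. simpl. apply continuity_2d_pt_plus; repeat (apply continuity_2d_pt_mult; auto);
        apply continuity_2d_pt_const. }
    unfold perron_dc. apply continuity_2d_pt_mult; auto. apply continuity_2d_pt_minus.
    + apply continuity_2d_pt_mult; auto. apply continuity_2d_pt_plus; auto. apply continuity_2d_pt_mult; auto.
    + apply continuity_2d_pt_mult.
      * apply continuity_2d_pt_mult; auto. apply continuity_2d_pt_mult; auto. apply continuity_2d_pt_const.
      * simpl. repeat (apply continuity_2d_pt_mult; auto). apply continuity_2d_pt_const.
Qed.

Definition perron_int (y T c : R) : R := RInt (perron_re y c) (- T) T.

(** This replaces Cauchy's theorem on a rectangle: by the Cauchy-Riemann equation the c-derivative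
    of the integrand is a t-derivative, so only boundary values at T and -T remain, and they add up
    because the imaginary part is odd in t. *)
Lemma perron_int_derive (y T c : R) : c <> 0 -> 0 < T ->
  is_derive (perron_int y T) c (2 * perron_im y c T).
Proof.
  intros Hc HT.
  replace (2 * perron_im y c T) with (RInt (fun t => Derive (fun u => perron_re y u t) c) (- T) T).
  - apply (is_derive_RInt_param (fun u t => perron_re y u t)).
    + destruct (locally_neq_0 c Hc) as [e He]. exists e. intros x Hx t _. eexists. apply perron_re_derive, He, Hx.
    + intros t _. apply perron_dc_2d; auto.
    + destruct (locally_neq_0 c Hc) as [e He]. exists e. intros x Hx.
      apply (continuity_ex_RInt (perron_re y x)), perron_re_continuity, He, Hx.
  - rewrite (RInt_ext _ (perron_dc y c)) by (intros t _; apply is_derive_unique, perron_re_derive; auto).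
    apply is_RInt_unique.
    replace (2 * perron_im y c T) with (minus (perron_im y c T) (perron_im y c (- T))).
    + apply (is_RInt_derive (perron_im y c)).
      * intros t _. apply perron_im_derive; auto.
      * intros t _. apply (ex_derive_continuous (perron_dc y c)). assert (P := sum_sqr_pos c t Hc).
        unfold perron_dc. auto_derive. simpl in P. lra.
    + unfold minus, plus, opp, perron_im; simpl. replace (y * - T) with (- (y * T)) by ring.
      rewrite sin_neg, cos_neg. assert (P := sum_sqr_pos c T Hc). simpl in P. field. lra.
Qed.

Lemma perron_im_bound (y c T : R) : c <> 0 -> 0 < T -> Rabs (perron_im y c T) <= exp (y * c) / T.
Proof.
  intros Hc HT. assert (P := sum_sqr_pos c T Hc). unfold perron_im, Rdiv.
  rewrite Rmult_assoc, Rabs_mult, (Rabs_pos_eq (exp _)) by apply Rlt_le, exp_pos.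
  apply Rmult_le_compat_l; [apply Rlt_le, exp_pos|].
  set (a := c * sin (y * T) - T * cos (y * T)).
  (* Cauchy-Schwarz: |a| <= |w|, and T |a| <= |w|^2. *)
  assert (Ha : a ^ 2 <= c ^ 2 + T ^ 2).
  { assert (E : a ^ 2 + (c * cos (y * T) + T * sin (y * T)) ^ 2 = (c ^ 2 + T ^ 2) * ((sin (y * T))² + (cos (y * T))²)).
    { unfold a, Rsqr. ring. }
    rewrite sin2_cos2, Rmult_1_r in E. assert (H := pow2_ge_0 (c * cos (y * T) + T * sin (y * T))). lra. }
  rewrite Rabs_mult, (Rabs_pos_eq (/ _)) by (apply Rlt_le, Rinv_0_lt_compat; auto).
  apply (Rmult_le_reg_r (c ^ 2 + T ^ 2)); auto. rewrite Rmult_assoc, Rinv_l, Rmult_1_r by lra.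
  apply (Rmult_le_reg_l T); auto. rewrite <- Rmult_assoc, Rinv_r, Rmult_1_l by lra.
  rewrite <- (pow2_abs a) in Ha. assert (A0 := Rabs_pos a).
  assert (Hs := pow2_ge_0 (T - Rabs a)). assert (C2 := pow2_ge_0 c).
  assert (T * Rabs a <= (T ^ 2 + Rabs a ^ 2) / 2) by nra. nra.
Qed.

(** The derivative in c is at most 2 e^(y c) / T in modulus, and the bound is the integral of this
    quantity. The last hypothesis keeps the pole 0 outside [c1, c2]. *)
Lemma perron_int_shift (y T c1 c2 : R) : 0 < y -> 0 < T -> c1 <= c2 -> (0 < c1 \/ c2 < 0) ->
  Rabs (perron_int y T c2 - perron_int y T c1) <= 2 / (y * T) * (exp (y * c2) - exp (y * c1)).
Proof.
  intros Hy HT H12 Hs.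
  (* With s = 1 and s = -1 this gives both signs: [h] below has nonnegative derivative, hence
     increases. *)
  assert (D : forall s, Rabs s = 1 -> s * (perron_int y T c2 - perron_int y T c1) <= 2 / (y * T) * (exp (y * c2) - exp (y * c1))).
  { intros s Hs1.
    set (h := fun c => 2 / (y * T) * exp (y * c) - s * perron_int y T c).
    assert (Hd : forall c, c1 <= c <= c2 -> is_derive h c (2 / T * exp (y * c) - s * (2 * perron_im y c T))).
    { intros c Hc. assert (Nc : c <> 0) by (destruct Hs; lra). unfold h.
      apply (is_derive_minus (V := R_NormedModule) (fun c => 2 / (y * T) * exp (y * c)) (fun c => s * perron_int y T c)).
      - auto_derive; auto. field. lra.
      - apply (is_derive_scal (perron_int y T)). apply perron_int_derive; auto. }
    destruct (MVT_gen h c1 c2 (fun c => 2 / T * exp (y * c) - s * (2 * perron_im y c T))) as [c [Hc E]].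
    - intros c Hc. rewrite Rmin_left, Rmax_right in Hc by auto. apply Hd; lra.
    - intros c Hc. rewrite Rmin_left, Rmax_right in Hc by auto. apply continuity_pt_filterlim.
      apply (ex_derive_continuous h). eexists. apply Hd; auto.
    - rewrite Rmin_left, Rmax_right in Hc by auto.
      assert (Nc : c <> 0) by (destruct Hs; lra).
      assert (B := perron_im_bound y c T Nc HT).
      assert (B' : s * perron_im y c T <= exp (y * c) / T).
      { eapply Rle_trans; [apply Rle_abs|]. rewrite Rabs_mult, Hs1, Rmult_1_l. auto. }
      assert (0 <= 2 / T * exp (y * c) - s * (2 * perron_im y c T)).
      { replace (2 / T * exp (y * c)) with (2 * (exp (y * c) / T)) by (field; lra). lra. }
      unfold h in E. nra. }
  apply Rabs_le. split.
  - assert (H := D (-1) ltac:(rewrite Rabs_left; lra)). lra.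
  - assert (H := D 1 Rabs_R1). lra.
Qed.

Lemma perron_re_bound (y c t : R) : c < 0 -> Rabs (perron_re y c t) <= exp (y * c) * (2 / - c).
Proof.
  intros Hc. assert (P := sum_sqr_pos c t ltac:(lra)). unfold perron_re, Rdiv.
  rewrite Rmult_assoc, Rabs_mult, (Rabs_pos_eq (exp _)) by apply Rlt_le, exp_pos.
  apply Rmult_le_compat_l; [apply Rlt_le, exp_pos|].
  rewrite Rabs_mult, (Rabs_pos_eq (/ _)) by (apply Rlt_le, Rinv_0_lt_compat; auto).
  apply (Rmult_le_reg_r (c ^ 2 + t ^ 2)); auto. rewrite Rmult_assoc, Rinv_l, Rmult_1_r by lra.
  apply (Rmult_le_reg_l (- c)); [lra|].
  replace (- c * (2 * / - c * (c ^ 2 + t ^ 2))) with (2 * (c ^ 2 + t ^ 2)) by (field; lra).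
  assert (H1 : Rabs (cos (y * t)) <= 1) by apply Rabs_le, COS_bound.
  assert (H2 : Rabs (sin (y * t)) <= 1) by apply Rabs_le, SIN_bound.
  assert (H3 := Rabs_triang (c * cos (y * t)) (t * sin (y * t))). rewrite !Rabs_mult, (Rabs_left c) in H3 by lra.
  assert (P1 := Rabs_pos t). assert (P2 := Rabs_pos (cos (y * t))). assert (P3 := Rabs_pos (sin (y * t))).
  assert (Rabs t * Rabs (sin (y * t)) <= Rabs t) by nra.
  assert (- c * Rabs (cos (y * t)) <= - c) by nra.
  rewrite <- (pow2_abs t). assert (Hsq := pow2_ge_0 (- c - Rabs t)). nra.
Qed.

(** Left of the pole the line can be moved towards minus infinity, where e^(y c) makes the integral
    over [-T, T] disappear; what remains is the cost of the shift. *)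
Lemma perron_int_neg (y T c : R) : 0 < y -> 0 < T -> c < 0 -> Rabs (perron_int y T c) <= 2 / (y * T).
Proof.
  intros Hy HT Hc. apply le_epsilon. intros eps Heps.
  (* The condition c' <= -1 bounds 2 / (- c') by 2; over the length 2 T this makes the integral at
     c' at most 4 T e^(y c'). *)
  assert (Hex : exists c', c' <= c /\ c' <= -1 /\ 4 * T * exp (y * c') <= eps).
  { exists (Rmin (Rmin c (-1)) (ln (eps / (4 * T)) / y)).
    assert (L1 := Rmin_l (Rmin c (-1)) (ln (eps / (4 * T)) / y)). assert (L2 := Rmin_r (Rmin c (-1)) (ln (eps / (4 * T)) / y)).
    assert (L3 := Rmin_l c (-1)). assert (L4 := Rmin_r c (-1)).
    set (c' := Rmin (Rmin c (-1)) _) in *.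
    repeat split; [lra | lra |].
    assert (Hp : 0 < eps / (4 * T)) by (apply Rdiv_lt_0_compat; lra).
    assert (E : exp (y * c') <= eps / (4 * T)).
    { rewrite <- (exp_ln (eps / (4 * T))) by auto.
      assert (y * c' <= ln (eps / (4 * T))).
      { apply (Rmult_le_compat_l y) in L2; [|lra]. replace (y * (ln (eps / (4 * T)) / y)) with (ln (eps / (4 * T))) in L2 by (field; lra). auto. }
      apply exp_le_mono; lra. }
    apply (Rmult_le_compat_l (4 * T)) in E; [|lra].
    replace (4 * T * (eps / (4 * T))) with eps in E by (field; lra). auto. }
  destruct Hex as [c' [H1 [H2 H3]]].
  assert (S := perron_int_shift y T c' c Hy HT H1 (or_intror Hc)).
  assert (B : Rabs (perron_int y T c') <= 4 * T * exp (y * c')).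
  { replace (4 * T * exp (y * c')) with ((T - - T) * (exp (y * c') * 2)) by ring.
    apply (norm_RInt_le_const (V := R_NormedModule) (perron_re y c')); [lra| |].
    - intros t _. eapply Rle_trans; [apply perron_re_bound; lra|]. apply Rmult_le_compat_l; [apply Rlt_le, exp_pos|].
      apply Rle_div_l; lra.
    - apply (RInt_correct (V := R_CompleteNormedModule)), continuity_ex_RInt, perron_re_continuity. lra. }
  assert (E1 : exp (y * c) <= 1).
  { rewrite <- exp_0. left. apply exp_increasing. nra. }
  assert (E2 := exp_pos (y * c')).
  assert (K : 0 < 2 / (y * T)) by (apply Rdiv_lt_0_compat; nra).
  replace (perron_int y T c) with ((perron_int y T c - perron_int y T c') + perron_int y T c') by ring.
  eapply Rle_trans; [apply Rabs_triang|].
  assert (2 / (y * T) * (exp (y * c) - exp (y * c')) <= 2 / (y * T) * 1) by (apply Rmult_le_compat_l; lra). lra.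
Qed.

(** The summand 1/w of exp (y w) / w has real parts e / (e^2 + t^2) and - e / (e^2 + t^2) on the two
    lines, which differ by the Poisson kernel 2 e / (e^2 + t^2). The remainder is entire and changes
    only by O(e). *)
Lemma perron_jump_bound (y e t : R) : 0 < y -> 0 < e <= 1 ->
  Rabs (perron_re y e t - perron_re y (- e) t - 2 * e / (e ^ 2 + t ^ 2)) <= 3 * y ^ 2 * exp y * e.
Proof.
  intros Hy He. assert (P := sum_sqr_pos e t ltac:(lra)).
  set (a := y * e). assert (Ha : 0 < a) by (unfold a; nra).
  assert (X1 := exp_minus_1_minus_id_le a). assert (X2 := exp_minus_1_minus_id_le (- a)).
  assert (X3 := exp_minus_1_le a). assert (X4 := exp_minus_1_le (- a)).
  rewrite Rabs_Ropp in X2, X4. rewrite (Rabs_pos_eq a) in * by lra.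
  assert (EY : exp a <= exp y).
  { assert (a <= y) by (unfold a; nra). apply exp_le_mono; lra. }
  assert (Ep := exp_pos a). assert (E1 := exp_ineq1_le y).
  set (E := exp a + exp (- a) - 2). set (S := exp a - exp (- a)).
  assert (HE : Rabs E <= 2 * a ^ 2 * exp y).
  { unfold E. replace (exp a + exp (- a) - 2) with ((exp a - 1 - a) + (exp (- a) - 1 - - a)) by ring.
    eapply Rle_trans; [apply Rabs_triang|]. replace ((- a) ^ 2) with (a ^ 2) in X2 by ring.
    assert (a ^ 2 * exp a <= a ^ 2 * exp y) by (apply Rmult_le_compat_l; nra). lra. }
  assert (HS : Rabs S <= 2 * a * exp y).
  { unfold S. replace (exp a - exp (- a)) with ((exp a - 1) - (exp (- a) - 1)) by ring.
    eapply Rle_trans; [apply Rabs_triang|]. rewrite Rabs_Ropp.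
    assert (a * exp a <= a * exp y) by (apply Rmult_le_compat_l; lra). lra. }
  replace (perron_re y e t - perron_re y (- e) t - 2 * e / (e ^ 2 + t ^ 2))
    with ((e * (cos (y * t) * E + 2 * (cos (y * t) - 1)) + t * sin (y * t) * S) / (e ^ 2 + t ^ 2)).
  2: { unfold perron_re, E, S, a. replace (y * - e) with (- (y * e)) by ring.
       replace ((- e) ^ 2) with (e ^ 2) by ring. field. lra. }
  unfold Rdiv. rewrite Rabs_mult, (Rabs_pos_eq (/ _)) by (apply Rlt_le, Rinv_0_lt_compat; auto).
  apply Rle_div_l; auto.
  assert (C1 : Rabs (cos (y * t)) <= 1) by apply Rabs_le, COS_bound.
  assert (C2 := Rabs_cos_minus_1_le (y * t)). assert (C3 := Rabs_sin_le (y * t)). rewrite Rabs_mult, (Rabs_pos_eq y) in C3 by lra.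
  eapply Rle_trans; [apply Rabs_triang|]. rewrite !Rabs_mult, (Rabs_pos_eq e) by lra.
  assert (B1 : Rabs (cos (y * t) * E + 2 * (cos (y * t) - 1)) <= 2 * a ^ 2 * exp y + y ^ 2 * t ^ 2).
  { eapply Rle_trans; [apply Rabs_triang|]. rewrite !Rabs_mult, (Rabs_pos_eq 2) by lra.
    assert (Rabs (cos (y * t)) * Rabs E <= 1 * (2 * a ^ 2 * exp y)) by (apply Rmult_le_compat; auto; apply Rabs_pos).
    replace ((y * t) ^ 2) with (y ^ 2 * t ^ 2) in C2 by ring. lra. }
  assert (B2 : Rabs t * Rabs (sin (y * t)) * Rabs S <= y * t ^ 2 * (2 * a * exp y)).
  { apply Rmult_le_compat; auto; try apply Rabs_pos.
    - apply Rmult_le_pos; apply Rabs_pos.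
    - rewrite <- (pow2_abs t). assert (Pt := Rabs_pos t). nra. }
  assert (B1' : e * Rabs (cos (y * t) * E + 2 * (cos (y * t) - 1)) <= e * (2 * a ^ 2 * exp y + y ^ 2 * t ^ 2))
    by (apply Rmult_le_compat_l; lra).
  apply Rle_trans with (e * (2 * a ^ 2 * exp y + y ^ 2 * t ^ 2) + y * t ^ 2 * (2 * a * exp y)); [lra|].
  unfold a.
  replace (3 * y ^ 2 * exp y * e * (e ^ 2 + t ^ 2)) with
    (e * (2 * (y * e) ^ 2 * exp y + y ^ 2 * t ^ 2) + y * t ^ 2 * (2 * (y * e) * exp y) +
     y ^ 2 * e * (exp y * e ^ 2 + (exp y - 1) * t ^ 2)) by ring.
  assert (0 <= y ^ 2 * e * (exp y * e ^ 2 + (exp y - 1) * t ^ 2)).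
  { apply Rmult_le_pos; [nra|]. apply Rplus_le_le_0_compat; apply Rmult_le_pos; try nra. }
  lra.
Qed.

(** The kernel contributes 4 atan (T/e), which tends to 2 PI as e decreases to 0: this is the
    residue at the pole. *)
Lemma perron_jump (y T e : R) : 0 < y -> 0 < T -> 0 < e <= 1 ->
  Rabs (perron_int y T e - perron_int y T (- e) - 4 * atan (T / e)) <= 6 * T * y ^ 2 * exp y * e.
Proof.
  intros Hy HT He.
  assert (I1 : is_RInt (fun t => 2 * e / (e ^ 2 + t ^ 2)) (- T) T (4 * atan (T / e))).
  { replace (4 * atan (T / e)) with (minus (2 * atan (T / e)) (2 * atan (- T / e))).
    2: { replace (- T / e) with (- (T / e)) by (field; lra). rewrite atan_opp. unfold minus, plus, opp; simpl. ring. }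
    apply (is_RInt_derive (fun t => 2 * atan (t / e))).
    - intros t _. assert (P := sum_sqr_pos e t ltac:(lra)).
      replace (2 * e / (e ^ 2 + t ^ 2)) with (2 * (/ (1 + (t / e) ^ 2) * / e)).
      2: { field. simpl in *; repeat split; try lra; nra. }
      apply is_derive_Reals. apply derivable_pt_lim_scal.
      apply (derivable_pt_lim_comp (fun t => t / e) atan t (/ e)); [|apply derivable_pt_lim_atan].
      apply is_derive_Reals. auto_derive; auto. field. lra.
    - intros t _. assert (P := sum_sqr_pos e t ltac:(lra)).
      apply (ex_derive_continuous (fun t => 2 * e / (e ^ 2 + t ^ 2))). auto_derive. simpl in P. lra. }
  assert (Cp := perron_re_continuity y e ltac:(lra)). assert (Cm := perron_re_continuity y (- e) ltac:(lra)).
  replace (6 * T * y ^ 2 * exp y * e) with ((T - - T) * (3 * y ^ 2 * exp y * e)) by ring.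
  apply (norm_RInt_le_const (V := R_NormedModule) (fun t => perron_re y e t - perron_re y (- e) t - 2 * e / (e ^ 2 + t ^ 2))); [lra| |].
  - intros t _. apply perron_jump_bound; auto.
  - apply (is_RInt_minus (V := R_NormedModule) (fun t => perron_re y e t - perron_re y (- e) t)); auto.
    apply (is_RInt_minus (V := R_NormedModule) (perron_re y e) (perron_re y (- e)));
      apply (RInt_correct (V := R_CompleteNormedModule)), continuity_ex_RInt; auto.
Qed.

(** Three contributions: the shift from e to c, the jump from - e to e, and the integral at - e. The
    first costs at most e^(y c) and the last 1, in units of 2 / (y T). *)
Lemma perron_bound (y T c : R) : 0 < y -> 0 < T -> 0 < c ->
  Rabs (perron_int y T c - 2 * PI) <= 2 / (y * T) * (exp (y * c) + 1).
Proof.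
  intros Hy HT Hc. assert (Pp := PI_RGT_0). apply le_epsilon. intros eps Heps.
  assert (K : 0 < 2 / (y * T)) by (apply Rdiv_lt_0_compat; nra).
  assert (L := is_lim_atan_p_infty). apply is_lim_spec in L. destruct (L (mkposreal (eps / 8) ltac:(lra))) as [M HM]. simpl in HM.
  set (B := 6 * T * y ^ 2 * exp y).
  assert (HB : 0 < B) by (unfold B; repeat apply Rmult_lt_0_compat; try lra; apply exp_pos).
  set (M' := Rmax M 0 + 1). assert (M1 := Rmax_l M 0). assert (M2 := Rmax_r M 0).
  (* The four bounds serve the jump estimate, the shift from e to c, an error B e of at most eps/2,
     and T/e > M, which brings atan (T/e) within eps/8 of PI/2. *)
  set (e := Rmin (Rmin 1 c) (Rmin (eps / (2 * B)) (T / M'))).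
  assert (Pe : 0 < e).
  { unfold e. apply Rmin_pos; apply Rmin_pos; try lra; apply Rdiv_lt_0_compat; try lra; unfold M'; lra. }
  assert (e <= 1) by (unfold e; eapply Rle_trans; [apply Rmin_l | apply Rmin_l]).
  assert (e <= c) by (unfold e; eapply Rle_trans; [apply Rmin_l | apply Rmin_r]).
  assert (E1 : e <= eps / (2 * B)) by (unfold e; eapply Rle_trans; [apply Rmin_r | apply Rmin_l]).
  assert (E2 : e <= T / M') by (unfold e; eapply Rle_trans; [apply Rmin_r | apply Rmin_r]).
  assert (HA : M < T / e).
  { apply Rlt_le_trans with M'; [unfold M'; lra|]. apply Rle_div_r; auto. apply Rle_div_r in E2; [lra|]. unfold M'; lra. }
  specialize (HM _ HA).
  assert (J := perron_jump y T e Hy HT (conj Pe H)). fold B in J.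
  assert (BE : B * e <= eps / 2).
  { apply Rle_div_r in E1; lra. }
  assert (S := perron_int_shift y T e c Hy HT H0 (or_introl Pe)).
  assert (N := perron_int_neg y T (- e) Hy HT ltac:(lra)).
  assert (Xp := exp_pos (y * e)).
  assert (S' : 2 / (y * T) * (exp (y * c) - exp (y * e)) <= 2 / (y * T) * exp (y * c)) by (apply Rmult_le_compat_l; lra).
  replace (perron_int y T c - 2 * PI) with
    ((perron_int y T c - perron_int y T e) + (perron_int y T e - perron_int y T (- e) - 4 * atan (T / e))
     + perron_int y T (- e) + 4 * (atan (T / e) - PI / 2)) by field.
  eapply Rle_trans; [apply Rabs_triang|]. eapply Rle_trans; [apply Rplus_le_compat_r, Rabs_triang|].
  eapply Rle_trans; [apply Rplus_le_compat_r, Rplus_le_compat_r, Rabs_triang|].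
  rewrite (Rabs_mult 4), (Rabs_pos_eq 4) by lra. lra.
Qed.

Lemma sint_perron_re (y c : R) : 0 < y -> 0 < c -> sint (perron_re y c) (2 * PI).
Proof.
  intros Hy Hc. apply is_lim_spec. intros eps.
  set (A := 2 / y * (exp (y * c) + 1)). assert (Xp := exp_pos (y * c)).
  assert (HA : 0 < A) by (apply Rmult_lt_0_compat; [apply Rdiv_lt_0_compat; lra | lra]).
  exists (A / eps). intros T HT. assert (Pe := cond_pos eps).
  assert (0 < A / eps) by (apply Rdiv_lt_0_compat; lra). assert (PT : 0 < T) by lra.
  eapply Rle_lt_trans; [apply (perron_bound y T c Hy PT Hc)|].
  replace (2 / (y * T) * (exp (y * c) + 1)) with (A / T) by (unfold A; field; lra).
  apply Rlt_div_l; auto. apply Rlt_div_l in HT; auto. lra.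
Qed.

Lemma sint_odd (f : R -> R) : continuity f -> (forall t, f (- t) = - f t) -> sint f 0.
Proof.
  intros Cf H. unfold sint. apply is_lim_ext with (fun _ => 0); [|apply is_lim_const]. intros T.
  assert (H1 := RInt_comp_lin f (-1) 0 T (- T) (continuity_ex_RInt _ _ _ Cf)).
  replace (-1 * T + 0) with (- T) in H1 by ring. replace (-1 * - T + 0) with T in H1 by ring.
  rewrite (RInt_ext _ f) in H1.
  2: { intros t _. unfold scal; simpl; unfold mult; simpl. replace (-1 * t + 0) with (- t) by ring. rewrite H. ring. }
  assert (H2 := opp_RInt_swap f (- T) T (continuity_ex_RInt _ _ _ Cf)).
  unfold opp in H2; simpl in H2. rewrite H1 in H2. lra.
Qed.

Lemma sint_perron_im (y c : R) : 0 < c -> sint (fun t => - perron_im y c t) 0.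
Proof.
  intros Hc. apply sint_odd.
  - apply continuity_opp, perron_im_continuity. lra.
  - intros t. assert (P := sum_sqr_pos c t ltac:(lra)). unfold perron_im. replace (y * - t) with (- (y * t)) by ring.
    rewrite sin_neg, cos_neg. replace ((- t) ^ 2) with (t ^ 2) by ring. field. lra.
Qed.

(** * Mellin-Barnes integrals of Gamma quotients *)

(** Continuity is included so that the integrals over [-T, T] exist and combine linearly. *)
Definition csint (f : R -> C) (v : C) : Prop :=
  Ccont f /\ sint (fun t => Re (f t)) (Re v) /\ sint (fun t => Im (f t)) (Im v).

Lemma Ccont_ext (f g : R -> C) : (forall t, f t = g t) -> Ccont f -> Ccont g.
Proof.
  intros E [H1 H2]. split; intros t.
  - apply (continuity_pt_ext (fun t => Re (f t))); auto. intros; now rewrite E.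
  - apply (continuity_pt_ext (fun t => Im (f t))); auto. intros; now rewrite E.
Qed.

Lemma csint_ext (f g : R -> C) (v w : C) : (forall t, f t = g t) -> v = w -> csint f v -> csint g w.
Proof.
  intros E <- [C1 [H1 H2]]. split; [|split].
  - apply (Ccont_ext f); auto.
  - apply (sint_ext (fun t => Re (f t))); auto. intros; now rewrite E.
  - apply (sint_ext (fun t => Im (f t))); auto. intros; now rewrite E.
Qed.

Lemma csint_plus (f g : R -> C) (v w : C) : csint f v -> csint g w -> csint (fun t => f t + g t)%C (v + w)%C.
Proof.
  intros [[C1 C2] [H1 H2]] [[C3 C4] [H3 H4]]. split; [apply Ccont_plus; split; auto|].
  split; [apply (sint_plus (fun t => Re (f t)) (fun t => Re (g t))) | apply (sint_plus (fun t => Im (f t)) (fun t => Im (g t)))]; auto.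
Qed.

Lemma csint_scal (a : R) (f : R -> C) (v : C) : csint f v -> csint (fun t => RtoC a * f t)%C (RtoC a * v)%C.
Proof.
  intros [[C1 C2] [H1 H2]]. split; [apply Ccont_mult; [apply Ccont_const | split; auto]|]. split.
  - apply (sint_ext (fun t => a * Re (f t))); [intros; now rewrite Re_scal|]. rewrite Re_scal. apply sint_scal; auto.
  - apply (sint_ext (fun t => a * Im (f t))); [intros; now rewrite Im_scal|]. rewrite Im_scal. apply sint_scal; auto.
Qed.

Lemma csint_dominated (f : nat -> R -> C) (g : R -> C) (K : R) (v : nat -> C) (w : C) :
  Ccont g -> 0 <= K -> (forall n t, Cmod (f n t) <= K / (1 + t ^ 2)) ->
  (forall T eps, 0 < T -> 0 < eps -> exists N, forall n t, (N <= n)%nat -> Rabs t <= T -> Cmod (f n t - g t) <= eps) ->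
  (forall n, csint (f n) (v n)) -> Clim v w -> csint g w.
Proof.
  intros Cg K0 HK HU Hv [Hw1 Hw2]. split; auto. destruct Cg as [Cg1 Cg2]. split.
  - apply (sint_dominated (fun n t => Re (f n t)) _ K (fun n => Re (v n))); auto.
    + intros n. apply (proj1 (Hv n)).
    + intros n t. eapply Rle_trans; [apply re_le_Cmod | apply HK].
    + intros T eps HT He. destruct (HU T eps HT He) as [N HN]. exists N. intros n t Hn Ht.
      eapply Rle_trans; [apply (re_le_Cmod (f n t - g t)) | apply HN; auto].
    + intros n. apply (proj2 (Hv n)).
  - apply (sint_dominated (fun n t => Im (f n t)) _ K (fun n => Im (v n))); auto.
    + intros n. apply (proj1 (Hv n)).
    + intros n t. eapply Rle_trans; [apply Rabs_Im_le | apply HK].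
    + intros T eps HT He. destruct (HU T eps HT He) as [N HN]. exists N. intros n t Hn Ht.
      eapply Rle_trans; [apply (Rabs_Im_le (f n t - g t)) | apply HN; auto].
    + intros n. apply (proj2 (Hv n)).
Qed.

Lemma Ccont_line (c : R) : Ccont (fun t => (c, t)).
Proof. split; simpl; [apply continuity_cst | apply derivable_continuous, derivable_id]. Qed.

Lemma Ccont_exp_line (y c : R) : Ccont (fun t => cexp (RtoC y * (c, t))).
Proof. apply Ccont_cexp, Ccont_mult; [apply Ccont_const | apply Ccont_line]. Qed.

Lemma Re_pos_neq_0 (w : C) : 0 < Re w -> w <> 0%C.
Proof. intros H E. rewrite E in H. simpl in H. lra. Qed.

Lemma ris_neq_0 (w : C) (n : nat) : 0 < Re w -> ris w n <> 0%C.
Proof.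
  intros H. induction n; [apply RtoC_neq_0; lra|]. rewrite ris_S. apply Cmult_neq_0; auto.
  apply Re_pos_neq_0. assert (P := pos_INR n). destruct w; simpl in *. lra.
Qed.

(** * Beta integrals and the Cahen-Mellin integral *)

Definition FF (n : nat) (w : C) : C := (RtoC (INR (fact n)) / ris w (S n))%C.

Lemma FF_S (n : nat) (w : C) : 0 < Re w -> FF (S n) w = (FF n w - FF n (w + 1))%C.
Proof.
  intros H. unfold FF.
  assert (N0 := ris_neq_0 w (S n) H).
  assert (H1 : 0 < Re (w + 1)%C) by (destruct w; simpl in *; lra).
  assert (N1 := ris_neq_0 (w + 1) n H1). assert (N2 := ris_neq_0 (w + 1) (S n) H1).
  assert (Nw := Re_pos_neq_0 w H).
  assert (Nn : (w + RtoC (INR (S n)))%C <> 0%C).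
  { apply Re_pos_neq_0. assert (P := pos_INR (S n)). destruct w; simpl in *; lra. }
  rewrite (ris_S w (S n)), (ris_S (w + 1) n), (ris_S_l w n).
  replace (w + 1 + RtoC (INR n))%C with (w + RtoC (INR (S n)))%C by (rewrite S_INR, RtoC_plus; ring).
  change (fact (S n)) with (S n * fact n)%nat. rewrite mult_INR, RtoC_mult.
  field. auto.
Qed.

Lemma Ccont_FF (n : nat) (c : R) : 0 < c -> Ccont (fun t => FF n (c, t)).
Proof.
  intros Hc. apply Ccont_mult; [apply Ccont_const|]. apply Ccont_inv.
  - apply Ccont_ris, Ccont_line. - intros t. apply ris_neq_0. auto.
Qed.

Lemma line_succ (c t : R) : ((c, t) + 1)%C = ((c + 1)%R, t).
Proof. apply C_ext; simpl; ring. Qed.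

(** The value must not depend on c for the induction: the integral of F_n(w + 1) e^(y w) over Re w =
    c is e^(-y) times that of F_n(w) e^(y w) over Re w = c + 1, so each step multiplies by 1 -
    e^(-y). The case n = 0 is Perron's integral. *)
Lemma csint_FF (n : nat) (y c : R) : 0 < y -> 0 < c ->
  csint (fun t => FF n (c, t) * cexp (RtoC y * (c, t)))%C (RtoC (2 * PI * (1 - exp (- y)) ^ n)).
Proof.
  intros Hy. revert c. induction n; intros c Hc.
  - split; [apply Ccont_mult; [apply Ccont_FF; auto | apply Ccont_exp_line]|].
    assert (E : forall t, (FF 0 (c, t) * cexp (RtoC y * (c, t)))%C = (perron_re y c t, perron_im y c t)).
    { intros t. assert (P := sum_sqr_pos c t ltac:(lra)).
      unfold FF. replace (ris (c, t) 1) with (c, t) by (unfold ris; simpl; apply C_ext; simpl; ring).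
      apply C_ext; unfold perron_re, perron_im, cexp, Cdiv, Cinv; simpl;
        replace (y * c - 0 * t) with (y * c) by ring; replace (y * t + 0 * c) with (y * t) by ring;
        simpl in P; field; lra. }
    split.
    + apply (sint_ext (perron_re y c)); [intros; now rewrite E|]. simpl. rewrite Rmult_1_r. apply sint_perron_re; auto.
    + apply (sint_ext (fun t => -1 * - perron_im y c t)); [intros; rewrite E; simpl; ring|].
      replace (Im (RtoC (2 * PI * (1 - exp (- y)) ^ 0))) with (-1 * 0) by (simpl; ring).
      apply sint_scal; [apply continuity_opp, perron_im_continuity; lra | apply sint_perron_im; auto].
  - apply (csint_ext (fun t => FF n (c, t) * cexp (RtoC y * (c, t)) +
             RtoC (- exp (- y)) * (FF n ((c + 1)%R, t) * cexp (RtoC y * ((c + 1)%R, t))))%C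
             _ (RtoC (2 * PI * (1 - exp (- y)) ^ n) + RtoC (- exp (- y)) * RtoC (2 * PI * (1 - exp (- y)) ^ n))%C).
    + intros t. rewrite FF_S by auto. rewrite <- line_succ, Cmult_plus_distr_l, cexp_add, Cmult_1_r, cexp_R.
      assert (E : RtoC (- exp (- y)) = (- / RtoC (exp y))%C).
      { rewrite exp_Ropp, <- RtoC_inv, RtoC_opp; auto. assert (P := exp_pos y); lra. }
      rewrite E. field. apply RtoC_neq_0. assert (P := exp_pos y); lra.
    + rewrite <- RtoC_mult, <- RtoC_plus. f_equal. simpl. ring.
    + apply csint_plus; [apply IHn; auto|]. apply csint_scal, IHn. lra.
Qed.

(** Each of the first m factors is at least (1 + t^2)/A. As [vert] belongs to a squared modulus, m =
    2 yields the decay 1 / (1 + t^2) required of a majorant. *)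
Lemma vert_poly (c : R) (m : nat) : 0 < c -> exists k, 0 < k /\ forall t, k * (1 + t ^ 2) ^ m <= vert c t m.
Proof.
  intros Hc. set (A := 1 + (c + INR m) ^ 2). assert (HA : 0 < A) by (unfold A; assert (Hsq := pow2_ge_0 (c + INR m)); lra).
  exists ((/ A) ^ m). split; [apply pow_lt, Rinv_0_lt_compat; auto|]. intros t.
  rewrite <- Rpow_mult_distr.
  assert (H : forall j, (j <= m)%nat -> 0 <= (/ A * (1 + t ^ 2)) ^ j <= vert c t j).
  { assert (Hp : 0 <= / A * (1 + t ^ 2)) by (apply Rmult_le_pos; [apply Rlt_le, Rinv_0_lt_compat; auto | nra]).
    induction j; intros Hj; [unfold vert; simpl; lra|].
    rewrite vert_S, <- tech_pow_Rmult, Rmult_comm. destruct (IHj ltac:(lia)) as [I1 I2].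
    split; [apply Rmult_le_pos; auto|]. apply Rmult_le_compat; auto.
    apply (Rmult_le_reg_l A); auto. rewrite <- Rmult_assoc, Rinv_r, Rmult_1_l by lra.
    assert (P := pos_INR j). assert (Hjm : INR j <= INR m) by (apply le_INR; lia).
    assert (0 < (c + INR j) ^ 2) by nra.
    assert (0 <= t ^ 2 / (c + INR j) ^ 2) by (apply Rdiv_le_0_compat; nra).
    assert ((c + INR j) ^ 2 <= (c + INR m) ^ 2) by nra.
    assert ((c + INR j) ^ 2 * (t ^ 2 / (c + INR j) ^ 2) = t ^ 2) by (field; lra).
    unfold A. nra. }
  apply H; auto.
Qed.

Lemma Cmod_exp_line (y c t : R) : Cmod (cexp (RtoC y * (c, t))) = exp (y * c).
Proof. rewrite Cmod_cexp. f_equal. simpl. ring. Qed.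

Lemma rGR_eventually_ge (c : R) : 0 < c -> exists N, forall n, (N <= n)%nat -> rgam c / 2 <= rGR n c.
Proof.
  intros Hc. assert (P := rgam_pos c Hc). assert (L := rgam_lim c). apply is_lim_seq_spec in L.
  destruct (L (mkposreal (rgam c / 2) ltac:(lra))) as [N HN]. exists N. intros n Hn. specialize (HN n Hn). simpl in HN.
  apply Rabs_def2 in HN. lra.
Qed.

Lemma is_lim_seq_exp_compound (a : R) : is_lim_seq (fun n => (1 - a / INR (S n)) ^ S n) (exp (- a)).
Proof.
  apply is_lim_seq_ext_loc with (fun n => exp (INR (S n) * ln (1 - a / INR (S n)))).
  - assert (L := is_lim_seq_const_div_INR_S a). apply is_lim_seq_spec in L.
    destruct (L (mkposreal 1 Rlt_0_1)) as [N HN]. exists N. intros n Hn. specialize (HN n Hn). simpl in HN.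
    rewrite Rminus_0_r in HN. apply Rabs_def2 in HN. rewrite <- Rpower_pow by (simpl INR; lra). reflexivity.
  - apply (is_lim_seq_continuous exp _ (- a)); [apply derivable_continuous, derivable_exp|].
    destruct (Req_dec a 0) as [->|Ha].
    + apply is_lim_seq_ext with (fun _ => - 0); [|apply is_lim_seq_const].
      intros n. unfold Rdiv. rewrite Rmult_0_l, Rminus_0_r, ln_1. ring.
    + (* difference quotient of [ln] at 1 along [h = - a / n] *)
      assert (D : derivable_pt_lim ln 1 1).
      { assert (H := derivable_pt_lim_ln 1 Rlt_0_1). rewrite Rinv_1 in H. exact H. }
      apply is_lim_seq_spec. intros eps.
      assert (Pa : 0 < Rabs a) by (apply Rabs_pos_lt; auto).
      destruct (D (eps / Rabs a)) as [d Hd]; [apply Rdiv_lt_0_compat; [apply cond_pos | auto]|].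
      assert (L := is_lim_seq_const_div_INR_S a). apply is_lim_seq_spec in L.
      destruct (L d) as [N HN]. exists N. intros n Hn. specialize (HN n Hn). rewrite Rminus_0_r in HN.
      assert (Pn := INR_S_pos n).
      assert (Hh : - a / INR (S n) <> 0) by (intro E; apply Ha; apply (f_equal (fun z => - z * INR (S n))) in E; field_simplify in E; lra).
      specialize (Hd (- a / INR (S n)) Hh). rewrite ln_1 in Hd.
      replace (- a / INR (S n)) with (- (a / INR (S n))) in Hd by (field; lra). rewrite Rabs_Ropp in Hd. specialize (Hd HN).
      replace (1 + - (a / INR (S n))) with (1 - a / INR (S n)) in Hd by ring.
      set (l := ln (1 - a / INR (S n))) in *.
      replace (INR (S n) * l - - a) with (- a * ((l - 0) / - (a / INR (S n)) - 1)) by (field; split; lra).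
      rewrite Rabs_mult, Rabs_Ropp. apply (Rmult_lt_compat_l (Rabs a)) in Hd; auto.
      replace (Rabs a * (eps / Rabs a)) with (pos eps) in Hd by (field; lra). auto.
Qed.

Lemma Cmod_line_le (c t T : R) : 0 < c -> Rabs t <= T -> Cmod (c, t) <= c + T.
Proof.
  intros Hc Ht. eapply Rle_trans; [apply Cmod_Re_Im|]. simpl. rewrite (Rabs_pos_eq c) by lra. lra.
Qed.

(* The Cahen-Mellin integral, as the limit of the Beta integrals [csint_FF] rescaled by [n]. *)
Lemma csint_gamma (y c : R) : 0 < c ->
  csint (fun t => / rgammaC (c, t) * cexp (RtoC y * (c, t)))%C (RtoC (2 * PI * exp (- exp (- y)))).
Proof.
  intros Hc. assert (Pg := rgam_pos c Hc). assert (Pp := PI_RGT_0).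
  destruct (rGR_eventually_ge c Hc) as [N1 HN1].
  destruct (nfloor_ex (exp (- y))) as [N2 HN2]; [apply Rlt_le, exp_pos|].
  (* N1 keeps the real approximant above half its limit, N2 makes y + ln n positive as Perron's
     integral demands, and 2 provides the factors for [vert_poly]. *)
  set (N := (N1 + N2 + 2)%nat).
  destruct (vert_poly c 2 Hc) as [k [Hk Hvp]].
  set (f := fun n t => (/ rG (S (n + N)) (c, t) * cexp (RtoC y * (c, t)))%C).
  set (K := exp (y * c) / (rgam c / 2 * sqrt k)).
  assert (Sk := sqrt_lt_R0 k Hk).
  assert (HK : 0 < K) by (apply Rdiv_lt_0_compat; [apply exp_pos | apply Rmult_lt_0_compat; lra]).
  assert (Hrn : forall t, rgammaC (c, t) <> 0%C) by (intros; apply rgammaC_neq_0; auto).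
  assert (HrG2 : forall n t, rgam c / 2 * sqrt k * (1 + t ^ 2) <= Cmod (rG (S (n + N)) (c, t))).
  { intros n t. apply Rsqr_incr_0_var; [|apply Cmod_ge_0]. rewrite !Rsqr_pow2, Cmod_rG_vert by auto.
    rewrite !Rpow_mult_distr, pow2_sqrt by lra. rewrite Rmult_assoc. apply Rmult_le_compat.
    - apply pow2_ge_0. - apply Rmult_le_pos; [lra | apply pow2_ge_0].
    - apply pow_incr. split; [lra|]. apply HN1. unfold N; lia.
    - eapply Rle_trans; [apply Hvp|]. apply prodn_mono; [intros; apply vert_factor_ge_1; auto | unfold N; lia]. }
  assert (HrG1 : forall n t, rgam c / 2 <= Cmod (rG (S (n + N)) (c, t))).
  { intros n t. apply Rsqr_incr_0_var; [|apply Cmod_ge_0]. rewrite !Rsqr_pow2, Cmod_rG_vert by auto.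
    rewrite <- (Rmult_1_r ((rgam c / 2) ^ 2)). apply Rmult_le_compat; try lra; [apply pow2_ge_0| |apply vert_ge_1; auto].
    apply pow_incr. split; [lra|]. apply HN1. unfold N; lia. }
  assert (HrGn : forall n t, rG (S (n + N)) (c, t) <> 0%C).
  { intros n t. apply Cmod_gt_0. specialize (HrG1 n t). lra. }
  apply (csint_dominated f _ K (fun n => RtoC (2 * PI * (1 - exp (- y) / INR (S (n + N))) ^ S (n + N)))).
  - apply Ccont_mult; [|apply Ccont_exp_line]. apply Ccont_inv; auto. apply Ccont_rgammaC, Ccont_line.
  - lra.
  - intros n t. unfold f. rewrite Cmod_mult, Cmod_inv, Cmod_exp_line by auto.
    unfold K. replace (exp (y * c) / (rgam c / 2 * sqrt k) / (1 + t ^ 2))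
      with (/ (rgam c / 2 * sqrt k * (1 + t ^ 2)) * exp (y * c)) by (field; nra).
    apply Rmult_le_compat_r; [apply Rlt_le, exp_pos|]. apply Rinv_le_contravar; auto.
    repeat apply Rmult_lt_0_compat; nra.
  - intros T eps HT Heps.
    destruct (exists_div_INR_S_lt (rG_err (c + T) * exp (y * c) / (rgam c / 2 * rgam c)) eps Heps) as [M HM].
    exists M. intros n t Hn Ht. unfold f.
    replace (/ rG (S (n + N)) (c, t) * cexp (RtoC y * (c, t)) - / rgammaC (c, t) * cexp (RtoC y * (c, t)))%C
      with ((rgammaC (c, t) - rG (S (n + N)) (c, t)) / (rG (S (n + N)) (c, t) * rgammaC (c, t)) * cexp (RtoC y * (c, t)))%C
      by (field; auto).
    rewrite Cmod_mult, Cmod_div, Cmod_mult, Cmod_exp_line by (apply Cmult_neq_0; auto).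
    assert (A1 := rG_rgammaC_err (c + T) (c, t) (n + N) (Cmod_line_le c t T Hc Ht)).
    assert (A2 := rgammaC_vert_ge c t Hc). specialize (HrG1 n t).
    assert (Ep := rG_err_pos (c + T) ltac:(lra)).
    assert (Xp := exp_pos (y * c)).
    apply Rle_trans with (rG_err (c + T) / INR (S M) / (rgam c / 2 * rgam c) * exp (y * c)).
    + apply Rmult_le_compat_r; [lra|]. apply Rmult_le_compat.
      * apply Cmod_ge_0.
      * apply Rlt_le, Rinv_0_lt_compat, Rmult_lt_0_compat; lra.
      * eapply Rle_trans; [apply A1|]. apply Rmult_le_compat_l; auto. apply Rinv_le_contravar; [apply INR_S_pos|].
        apply le_INR. lia.
      * apply Rinv_le_contravar; [apply Rmult_lt_0_compat; lra|]. apply Rmult_le_compat; lra.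
    + replace (rG_err (c + T) / INR (S M) / (rgam c / 2 * rgam c) * exp (y * c))
        with (rG_err (c + T) * exp (y * c) / (rgam c / 2 * rgam c) / INR (S M)); [lra|].
      field. split; [|lra]. assert (P := INR_S_pos M). lra.
  - intros n. set (m := S (n + N)). assert (Pm : 0 < INR m) by apply INR_S_pos.
    assert (Hy : 0 < y + ln (INR m)).
    { assert (exp (- y) < INR m).
      { eapply Rlt_le_trans; [apply HN2|]. change (INR N2 + 1) with (INR N2 + INR 1). rewrite <- plus_INR. apply le_INR. unfold m, N; lia. }
      assert (- y < ln (INR m)) by (rewrite <- (ln_exp (- y)); apply ln_increasing; [apply exp_pos | auto]). lra. }
    (* Since 1 / rG m w = m^w F_m(w), the approximant is a Beta integral with y replaced by y + ln
       m, and 1 - e^(-y) by 1 - e^(-y)/m. *)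
    apply (csint_ext (fun t => FF m (c, t) * cexp (RtoC (y + ln (INR m)) * (c, t)))%C _ (RtoC (2 * PI * (1 - exp (- (y + ln (INR m)))) ^ m))).
    + intros t. unfold f, FF. fold m. rewrite rG_ris, cpow_cexp.
      rewrite RtoC_plus, Cmult_plus_distr_r, cexp_add, (Cmult_comm (RtoC (ln (INR m)))). field.
      repeat split; solve [apply ris_neq_0; auto | apply cexp_neq_0 | apply RtoC_neq_0, INR_fact_neq_0].
    + do 4 f_equal. rewrite Ropp_plus_distr, exp_plus, <- (ln_Rinv (INR m)), exp_ln by (auto using Rinv_0_lt_compat). reflexivity.
    + apply csint_FF; auto.
  - apply Clim_RtoC. apply (is_lim_seq_scal_l _ (2 * PI) (exp (- exp (- y)))).
    apply (is_lim_seq_incr_n (fun n => (1 - exp (- y) / INR (S n)) ^ S n) N). apply is_lim_seq_exp_compound.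
Qed.

(** * Inserting linear factors under the integral *)

Definition linC (ps : list (R * R)) (w : C) : C := prodC (map (fun p => RtoC (fst p) * w + RtoC (snd p))%C ps).
Definition linR (ps : list (R * R)) (x : R) : R := prodR (map (fun p => fst p * x + snd p) ps).

Lemma linC_shift (ps : list (R * R)) (w : C) :
  linC ps w = linC (map (fun p => (fst p, snd p - fst p)) ps) (w + 1).
Proof.
  unfold linC. rewrite map_map. apply prodC_ext. intros p _. simpl. rewrite RtoC_minus. ring.
Qed.

Lemma linR_shift (ps : list (R * R)) (x : R) :
  linR ps (x - 1) = linR (map (fun p => (fst p, snd p - fst p)) ps) x.
Proof.
  unfold linR. rewrite map_map. f_equal. apply map_ext. intros p. simpl. ring.
Qed.

(** For a factor a w + b, the term a w Gamma(w) = a Gamma(w + 1) moves the integral to the line c +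
    1. In the series the same step is an index shift: - a k (-1)^k / k! vanishes at k = 0 and
    otherwise equals a (-1)^(k-1) / (k-1)!. *)
Lemma csint_gamma_lin (ps : list (R * R)) (y c : R) : 0 < c ->
  exists V : R, is_series (fun k => (-1) ^ k / INR (fact k) * linR ps (- INR k) * exp (- y * INR k)) V /\
    csint (fun t => / rgammaC (c, t) * linC ps (c, t) * cexp (RtoC y * (c, t)))%C (RtoC (2 * PI * V)).
Proof.
  (* Induction on the length, because the remaining factors are needed both as they are and
     rewritten in w + 1, and on two different lines. *)
  remember (length ps) as d eqn:Ed. revert ps Ed c.
  induction d; intros ps Ed c Hc.
  - destruct ps; [|discriminate]. exists (exp (- exp (- y))). split.
    + apply is_series_ext with (fun k => scal (pow_n (- exp (- y)) k) (/ INR (fact k))); [|apply is_exp_Reals].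
      intros k. unfold linR, scal; simpl; unfold mult; simpl. rewrite pow_n_pow.
      replace (- exp (- y)) with (-1 * exp (- y)) by ring. rewrite Rpow_mult_distr.
      replace (exp (- y * INR k)) with (exp (- y) ^ k).
      2: { rewrite <- Rpower_pow by apply exp_pos. unfold Rpower. rewrite ln_exp. f_equal. ring. }
      field. apply INR_fact_neq_0.
    + apply (csint_ext (fun t => / rgammaC (c, t) * cexp (RtoC y * (c, t)))%C _ (RtoC (2 * PI * exp (- exp (- y))))); auto.
      * intros t. unfold linC. simpl. ring.
      * apply csint_gamma; auto.
  - destruct ps as [|[a b] ps]; [discriminate|]. injection Ed as Ed.
    set (ps' := map (fun p => (fst p, snd p - fst p)) ps).
    destruct (IHd ps Ed c Hc) as [V0 [S0 I0]].
    destruct (IHd ps' ltac:(unfold ps'; rewrite length_map; auto) (c + 1) ltac:(lra)) as [V1 [S1 I1]].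
    exists (a * exp (- y) * V1 + b * V0). split.
    + apply is_series_ext with (fun k => plus ((- a * INR k) * ((-1) ^ k / INR (fact k) * linR ps (- INR k) * exp (- y * INR k)))
                                 (b * ((-1) ^ k / INR (fact k) * linR ps (- INR k) * exp (- y * INR k)))).
      { intros k. unfold plus; simpl. unfold linR at 3. rewrite map_cons, prodR_cons. simpl. fold (linR ps (- INR k)). ring. }
      apply (is_series_plus (V := R_NormedModule)).
      * apply is_series_decr_1.
        replace (plus _ _) with (a * exp (- y) * V1) by (unfold plus, opp; simpl; ring).
        apply is_series_ext with (fun k => a * exp (- y) * ((-1) ^ k / INR (fact k) * linR ps' (- INR k) * exp (- y * INR k))).
        -- intros k. match goal with |- @eq _ ?u ?v => change (@eq R u v) end. unfold ps'. rewrite <- linR_shift.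
           replace (- INR (S k)) with (- INR k - 1) by (rewrite S_INR; ring).
           replace (- y * INR (S k)) with (- y + - y * INR k) by (rewrite S_INR; ring).
           rewrite exp_plus. change (fact (S k)) with (S k * fact k)%nat. rewrite mult_INR.
           assert (P := INR_S_pos k). assert (F := INR_fact_lt_0 k). simpl pow. field. lra.
        -- apply (is_series_scal (V := R_NormedModule) (a * exp (- y)) (fun k => (-1) ^ k / INR (fact k) * linR ps' (- INR k) * exp (- y * INR k)) V1), S1.
      * apply (is_series_scal (V := R_NormedModule) b (fun k => (-1) ^ k / INR (fact k) * linR ps (- INR k) * exp (- y * INR k)) V0), S0.
    + apply (csint_ext (fun t => RtoC (a * exp (- y)) * (/ rgammaC ((c + 1)%R, t) * linC ps' ((c + 1)%R, t) * cexp (RtoC y * ((c + 1)%R, t)))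
               + RtoC b * (/ rgammaC (c, t) * linC ps (c, t) * cexp (RtoC y * (c, t))))%C _
               (RtoC (a * exp (- y)) * RtoC (2 * PI * V1) + RtoC b * RtoC (2 * PI * V0))%C).
      * intros t. rewrite <- line_succ. unfold ps'. rewrite <- linC_shift.
        change (linC ((a, b) :: ps) (c, t)) with ((RtoC a * (c, t) + RtoC b) * linC ps (c, t))%C.
        rewrite (rgammaC_succ (c, t)), Cmult_plus_distr_l, cexp_add, Cmult_1_r, cexp_R, RtoC_mult.
        assert (E : RtoC (exp (- y)) = (/ RtoC (exp y))%C).
        { rewrite exp_Ropp, <- RtoC_inv; auto. assert (P := exp_pos y); lra. }
        rewrite E. field. repeat split.
        -- apply rgammaC_neq_0. simpl; lra.
        -- apply Re_pos_neq_0. auto.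
        -- apply RtoC_neq_0. assert (P := exp_pos y); lra.
      * rewrite <- !RtoC_mult, <- RtoC_plus. f_equal. ring.
      * apply csint_plus; apply csint_scal; auto.
Qed.

(** * A majorant for the series, uniform in the approximation *)

Lemma tannery (a : nat -> nat -> R) (a' M : nat -> R) (V : nat -> R) :
  (forall m k, Rabs (a m k) <= M k) -> ex_series M ->
  (forall k, is_lim_seq (fun m => a m k) (a' k)) -> (forall m, is_series (a m) (V m)) ->
  (forall k, Rabs (a' k) <= M k) /\ exists W, is_series a' W /\ is_lim_seq V W.
Proof.
  intros HM EM Hl HV.
  assert (HM' : forall k, Rabs (a' k) <= M k).
  { intros k. refine (is_lim_seq_le _ _ (Rabs (a' k)) (M k) (fun m => HM m k) _ (is_lim_seq_const (M k))).
    apply (is_lim_seq_abs _ (a' k)), Hl. }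
  split; auto.
  assert (Ea : ex_series a') by (apply (ex_series_le (V := R_CompleteNormedModule) a' M); auto).
  exists (Series a'). split; [apply Series_correct; auto|].
  apply is_lim_seq_spec. intros eps.
  (* The differences are dominated by 2 M, so a tail of M below eps/4 contributes less than eps/2;
     the finitely many terms before it take the other half. *)
  assert (Ht : exists N, (0 < N)%nat /\ Rabs (Series (fun k => M (N + k)%nat)) < eps / 4).
  { assert (L := Series_correct M EM).
    assert (L' : is_lim_seq (sum_n M) (Series M)) by exact L.
    apply is_lim_seq_spec in L'. destruct (L' (mkposreal (eps / 4) ltac:(assert (P := cond_pos eps); lra))) as [N HN]. simpl in HN.
    exists (S N). split; [lia|]. specialize (HN N (le_n _)).
    rewrite (Series_incr_n M (S N)) in HN by (auto; lia). simpl pred in HN. rewrite sum_n_Reals in HN.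
    rewrite Rabs_minus_sym in HN.
    replace (sum_f_R0 M N + Series (fun k => M (S N + k)%nat) - sum_f_R0 M N) with (Series (fun k => M (S N + k)%nat)) in HN by ring.
    auto. }
  destruct Ht as [N [HN0 HN]].
  assert (Hs : is_lim_seq (fun m => sum_f_R0 (fun k => Rabs (a m k - a' k)) (pred N)) 0).
  { generalize (pred N). intros n. induction n; simpl.
    - apply (is_lim_seq_abs_0 (fun m => a m 0%nat - a' 0%nat)).
      replace (Finite 0) with (Finite (a' 0%nat - a' 0%nat)) by (f_equal; ring).
      apply is_lim_seq_minus'; [apply Hl | apply is_lim_seq_const].
    - replace (Finite 0) with (Finite (0 + 0)) by (f_equal; ring). apply is_lim_seq_plus'; auto.
      apply (is_lim_seq_abs_0 (fun m => a m (S n) - a' (S n))).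
      replace (Finite 0) with (Finite (a' (S n) - a' (S n))) by (f_equal; ring).
      apply is_lim_seq_minus'; [apply Hl | apply is_lim_seq_const]. }
  apply is_lim_seq_spec in Hs. destruct (Hs (mkposreal (eps / 2) ltac:(assert (P := cond_pos eps); lra))) as [m0 Hm0]. simpl in Hm0.
  exists m0. intros m Hm. specialize (Hm0 m Hm). rewrite Rminus_0_r in Hm0. assert (Hm1 := Rle_lt_trans _ _ _ (Rle_abs _) Hm0).
  assert (Em : ex_series (a m)) by (exists (V m); apply HV).
  rewrite <- (is_series_unique _ _ (HV m)), <- Series_minus by auto.
  set (d := fun k => a m k - a' k).
  assert (Hd : forall k, Rabs (d k) <= 2 * M k).
  { intros k. unfold d. eapply Rle_trans; [apply Rabs_triang|]. rewrite Rabs_Ropp. specialize (HM m k). specialize (HM' k). lra. }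
  assert (E2M : ex_series (fun k => 2 * M k)) by (apply (ex_series_scal 2 M); auto).
  assert (Ed : ex_series (fun k => Rabs (d k))).
  { apply (ex_series_le (V := R_CompleteNormedModule) _ (fun k => 2 * M k)); auto.
    intros k. change (Rabs (Rabs (d k)) <= 2 * M k). rewrite Rabs_Rabsolu. auto. }
  eapply Rle_lt_trans; [apply Series_Rabs, Ed|].
  rewrite (Series_incr_n _ N) by auto.
  assert (T : Series (fun k => Rabs (d (N + k)%nat)) <= Series (fun k => 2 * M (N + k)%nat)).
  { apply Series_le; [intros k; split; [apply Rabs_pos | apply Hd]|].
    apply (ex_series_incr_n (V := R_NormedModule) (fun k => 2 * M k) N). auto. }
  rewrite Series_scal_l in T. assert (T' := Rle_abs (Series (fun k => M (N + k)%nat))).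
  unfold d in *. lra.
Qed.

(** The shift [rG_shift] iterated J times; it carries a negative argument back to a bounded
    interval. *)
Lemma rGR_shift (n J : nat) (z : R) :
  rGR (S n) z * poch (z + INR (S n) + 1) J = poch z J * INR (S n) ^ J * rGR (S n) (z + INR J).
Proof.
  assert (P := INR_S_pos n). induction J.
  - assert (E0 : forall r, poch r 0 = 1) by reflexivity. rewrite !E0.
    replace (z + INR 0) with z by (simpl; ring). rewrite pow_O. ring.
  - assert (H := rG_shift n (RtoC (z + INR J))). rewrite <- RtoC_plus, !rG_R, <- !RtoC_mult, <- RtoC_plus, <- RtoC_mult in H.
    apply RtoC_inj in H.
    rewrite !poch_S, <- Rmult_assoc, IHJ, <- tech_pow_Rmult.
    replace (z + INR (S J)) with (z + INR J + 1) by (rewrite (S_INR J); ring).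
    replace (poch z J * (z + INR J) * (INR (S n) * INR (S n) ^ J) * rGR (S n) (z + INR J + 1))
      with (poch z J * INR (S n) ^ J * INR (S n) * ((z + INR J) * rGR (S n) (z + INR J + 1))) by ring.
    rewrite H. field. lra.
Qed.

Lemma poch_prodn (r : R) (n : nat) : poch r n = prodn (fun k => r + INR k) n.
Proof. induction n; [reflexivity|]. rewrite poch_S, IHn. reflexivity. Qed.

Lemma poch_rev (m : R) (J : nat) : poch (m + 1 - INR J) J = prodn (fun a => m - INR a) J.
Proof.
  induction J; [reflexivity|]. rewrite poch_S_l. simpl prodn. rewrite <- IHJ, S_INR.
  replace (m + 1 - (INR J + 1) + 1) with (m + 1 - INR J) by ring. ring.
Qed.

Lemma prodn_bounds (f g : nat -> R) (n : nat) :
  (forall k, (k < n)%nat -> 0 <= f k <= g k) -> 0 <= prodn f n <= prodn g n.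
Proof.
  intros H. induction n; simpl; [lra|].
  assert (H1 := IHn ltac:(intros; apply H; lia)). assert (H2 := H n ltac:(lia)).
  split; [apply Rmult_le_pos; lra | apply Rmult_le_compat; lra].
Qed.

Lemma prodn_const (a : R) (n : nat) : prodn (fun _ => a) n = a ^ n.
Proof. induction n; simpl; [reflexivity|]. rewrite IHn. ring. Qed.

Lemma Rabs_prodn (f : nat -> R) (n : nat) : Rabs (prodn f n) = prodn (fun k => Rabs (f k)) n.
Proof. induction n; simpl; [apply Rabs_R1|]. rewrite Rabs_mult, IHn. reflexivity. Qed.

(* For [J <= m] this is the bound [J! m^J (m-J)!/m! <= J^J], i.e. [(m choose J) >= (m/J)^J]. *)
Lemma rGR_neg_bound_large (n J : nat) (u B : R) : (J <= S n)%nat -> 0 <= u -> (J = 0%nat \/ u <= 1) ->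
  Rabs (rGR (S n) u) <= B -> Rabs (rGR (S n) (u - INR J)) <= B * INR J ^ J.
Proof.
  intros HJ Hu Hu1 HB. assert (P := INR_S_pos n).
  assert (HJm : INR J <= INR (S n)) by (apply le_INR; auto).
  assert (B0 : 0 <= B) by (eapply Rle_trans; [apply Rabs_pos | apply HB]).
  assert (E := rGR_shift n J (u - INR J)). replace (u - INR J + INR J) with u in E by ring.
  set (m := INR (S n)) in *.
  set (D := prodn (fun a => m - INR a) J).
  assert (HD : 0 < D).
  { unfold D. assert (H : forall j, (j <= J)%nat -> 0 < prodn (fun a => m - INR a) j).
    { induction j; intros Hj; simpl; [lra|]. apply Rmult_lt_0_compat; [apply IHj; lia|].
      assert (INR (S j) <= INR J) by (apply le_INR; lia). rewrite S_INR in H. lra. }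
    apply H; auto. }
  assert (HD' : D <= poch (u - INR J + m + 1) J).
  { unfold D. rewrite <- poch_rev, !poch_prodn. apply prodn_bounds. intros k Hk.
    assert (INR k <= INR J) by (apply le_INR; lia). assert (P' := pos_INR k). lra. }
  assert (HN : Rabs (poch (u - INR J) J) <= prodn (fun a => INR J - INR a) J).
  { rewrite poch_prodn, Rabs_prodn. apply prodn_bounds. intros k Hk. split; [apply Rabs_pos|].
    assert (INR (S k) <= INR J) by (apply le_INR; lia). rewrite S_INR in H.
    destruct Hu1 as [->|Hu1]; [lia|]. apply Rabs_le. lra. }
  assert (HC : prodn (fun a => INR J - INR a) J * m ^ J <= D * INR J ^ J).
  { unfold D. rewrite <- !prodn_const, <- !prodn_mult. apply prodn_bounds. intros k Hk.
    assert (INR k <= INR J) by (apply le_INR; lia). assert (P' := pos_INR k).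
    split; [apply Rmult_le_pos; lra|]. nra. }
  apply (f_equal Rabs) in E. rewrite !Rabs_mult in E.
  rewrite (Rabs_pos_eq (poch (u - INR J + m + 1) J)), (Rabs_pos_eq (m ^ J)) in E by (try (apply pow_le; lra); lra).
  apply (Rmult_le_reg_r D); auto.
  apply Rle_trans with (Rabs (rGR (S n) (u - INR J)) * poch (u - INR J + m + 1) J).
  { apply Rmult_le_compat_l; [apply Rabs_pos | auto]. }
  rewrite E. assert (Pm : 0 <= m ^ J) by (apply pow_le; lra).
  apply Rle_trans with (prodn (fun a => INR J - INR a) J * m ^ J * B).
  - apply Rmult_le_compat; auto; [apply Rmult_le_pos; auto; apply Rabs_pos | apply Rabs_pos|].
    apply Rmult_le_compat_r; auto.
  - nra.
Qed.

Lemma pow_div_fact_le_exp (x : R) (n : nat) : 0 <= x -> x ^ n / INR (fact n) <= exp x.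
Proof.
  intros Hx. eapply Rle_trans; [|apply (exp_ge_taylor x n Hx)].
  destruct n; [right; reflexivity|]. rewrite tech5.
  assert (0 <= sum_f_R0 (fun k => x ^ k / INR (fact k)) n); [|lra].
  apply cond_pos_sum. intros k. apply Rdiv_le_0_compat; [apply pow_le; auto | apply INR_fact_lt_0].
Qed.

(** When the product is shorter than the distance to be shifted it is estimated directly: with m = n
    + 1 its modulus is at most x^(m+1), and x^m / m! <= e^x, m^x <= J^J. *)
Lemma rGR_neg_bound_small (n J : nat) (x : R) : (S n < J)%nat -> INR (S n) <= x <= INR J ->
  Rabs (rGR (S n) (- x)) <= INR J * exp (INR J) * INR J ^ J.
Proof.
  intros Hn Hx. assert (P := INR_S_pos n).
  assert (Hone : 1 <= INR (S n)) by (rewrite S_INR; assert (H := pos_INR n); lra).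
  assert (HnJ : INR (S n) <= INR J) by (apply le_INR; lia).
  unfold rGR. set (m := S n) in *.
  assert (E : poch (- x) (S m) / (INR (fact m) * Rpower (INR m) (- x)) = poch (- x) (S m) / INR (fact m) * Rpower (INR m) x).
  { rewrite Rpower_Ropp. field. split; [apply INR_fact_neq_0|]. unfold Rpower. assert (Q := exp_pos (x * ln (INR m))). lra. }
  rewrite E, Rabs_mult, (Rabs_pos_eq (Rpower _ _)) by (apply Rlt_le, exp_pos).
  assert (F := INR_fact_lt_0 m).
  apply Rmult_le_compat; [apply Rabs_pos | apply Rlt_le, exp_pos | |].
  - unfold Rdiv. rewrite Rabs_mult, (Rabs_pos_eq (/ _)) by (apply Rlt_le, Rinv_0_lt_compat; auto).
    apply Rle_trans with (x ^ S m * / INR (fact m)).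
    + apply Rmult_le_compat_r; [apply Rlt_le, Rinv_0_lt_compat; auto|].
      rewrite poch_prodn, Rabs_prodn, <- prodn_const. apply prodn_bounds. intros k Hk. split; [apply Rabs_pos|].
      assert (INR k <= INR m) by (apply le_INR; lia). assert (P' := pos_INR k). rewrite Rabs_left1; lra.
    + rewrite <- tech_pow_Rmult, Rmult_assoc. apply Rmult_le_compat; try lra.
      * apply Rmult_le_pos; [apply pow_le; lra | apply Rlt_le, Rinv_0_lt_compat; auto].
      * eapply Rle_trans; [apply (pow_div_fact_le_exp x m); lra|].
        apply exp_le_mono; lra.
  - rewrite <- Rpower_pow by lra.
    apply Rle_trans with (Rpower (INR m) (INR J)); [apply Rle_Rpower; lra|]. apply Rle_Rpower_l; lra.
Qed.

(** Slightly more than the ceiling: [up] lies strictly above its argument, so an integer x >= 0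
    gives x + 1. Negative values of [up x] are cut off at 0. *)
Definition ceil_nat (x : R) : nat := Z.to_nat (up x).

Lemma ceil_nat_spec (x : R) : x <= INR (ceil_nat x) /\ (ceil_nat x = 0%nat \/ INR (ceil_nat x) <= x + 1).
Proof.
  destruct (archimed x) as [H1 H2]. unfold ceil_nat. destruct (Z.le_gt_cases 0 (up x)) as [H|H].
  - rewrite INR_IZR_INZ, Z2Nat.id by auto. lra.
  - replace (Z.to_nat (up x)) with 0%nat by lia. simpl.
    assert (IZR (up x) <= 0) by (apply IZR_le; lia). split; [lra | auto].
Qed.

(** Shifting by J brings the argument into [0, b + 1], where the approximants are bounded. Whether J
    exceeds the length of the product or not, the cost is J^J up to exponential factors,
    independently of n. *)
Lemma rGR_neg_bound (al b : R) (n k : nat) : 0 < al -> 0 <= b ->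
  let J := ceil_nat (al * INR k - b) in
  Rabs (rGR (S n) (b - al * INR k)) <= (rG_bound (b + 1) + 1) * (INR J + 1) * exp (INR J) * INR J ^ J.
Proof.
  intros Hal Hb J. set (x := al * INR k - b) in *.
  destruct (ceil_nat_spec x) as [H1 H2]. fold J in H1, H2.
  replace (b - al * INR k) with (- x) by (unfold x; ring).
  assert (PJ := pos_INR J). assert (EJ := exp_ineq1_le (INR J)). assert (PJJ : 0 <= INR J ^ J) by (apply pow_le; auto).
  assert (B0 : 0 <= rG_bound (b + 1)).
  { eapply Rle_trans; [apply Cmod_ge_0|]. apply (rG_bounded (b + 1) 0 0). rewrite Cmod_0. lra. }
  destruct (Nat.le_gt_cases J (S n)) as [L|L].
  - assert (Hu : 0 <= INR J - x) by lra.
    assert (Hub : INR J - x <= b + 1).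
    { destruct H2 as [->|H2]; [|lra]. simpl. unfold x. assert (P := pos_INR k). nra. }
    assert (A := rGR_neg_bound_large n J (INR J - x) (rG_bound (b + 1)) L Hu ltac:(destruct H2; [left; auto | right; lra])).
    replace (INR J - x - INR J) with (- x) in A by ring.
    eapply Rle_trans; [apply A|].
    + assert (A' := rG_bounded (b + 1) (RtoC (INR J - x)) n). rewrite rG_R, !Cmod_R in A'. apply A'.
      rewrite Rabs_pos_eq; auto.
    + apply Rmult_le_compat_r; auto.
      assert (rG_bound (b + 1) * 1 <= (rG_bound (b + 1) + 1) * (INR J + 1)) by (apply Rmult_le_compat; lra).
      assert (rG_bound (b + 1) * 1 * 1 <= (rG_bound (b + 1) + 1) * (INR J + 1) * exp (INR J)) by (apply Rmult_le_compat; lra). lra.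
  - assert (HL : INR (S (S n)) <= INR J) by (apply le_INR; lia). rewrite (S_INR (S n)) in HL.
    destruct H2 as [->|H2]; [lia|].
    eapply Rle_trans; [apply (rGR_neg_bound_small n J x L); lra|].
    apply Rmult_le_compat_r; auto. apply Rmult_le_compat_r; [lra|]. nra.
Qed.

(** J^J is about (al k)^(al k) while 1/k! <= e^k k^(-k); as al < 1 the factor k^(-k) wins against
    every exponential. *)
Lemma ex_series_rgam_bound (al b y B : R) : 0 < al < 1 -> 0 <= b -> 0 <= B ->
  ex_series (fun k => / INR (fact k) * (B * (INR (ceil_nat (al * INR k - b)) + 1) * exp (INR (ceil_nat (al * INR k - b)))
     * INR (ceil_nat (al * INR k - b)) ^ ceil_nat (al * INR k - b)) * exp (- y * INR k)).
Proof.
  intros Hal Hb HB.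
  set (be := (1 + al) / 2).
  (* For k > 2 / (1 - al) one has al k + 1 <= be k, with be midway between al and 1, hence J <= be
     k. The bound with N2 gives (1 - be) ln k >= 4 - y, which brings the total exponent down to -
     k. *)
  destruct (nfloor_ex (Rmax 1 (2 / (1 - al)))) as [N1 HN1]; [eapply Rle_trans; [|apply Rmax_l]; lra|].
  destruct (nfloor_ex (exp ((4 - y) / (1 - be)))) as [N2 HN2]; [apply Rlt_le, exp_pos|].
  set (N := (N1 + N2 + 2)%nat).
  apply (ex_series_incr_n (V := R_NormedModule) _ N).
  apply (ex_series_le (V := R_CompleteNormedModule) _ (fun k => B * exp 2 * exp (- 1) ^ (N + k))).
  2: { apply (ex_series_incr_n (V := R_NormedModule) (fun k => B * exp 2 * exp (- 1) ^ k)).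
       apply (ex_series_scal (B * exp 2) (fun k => exp (- 1) ^ k)). apply ex_series_geom.
       rewrite Rabs_pos_eq by apply Rlt_le, exp_pos. rewrite <- exp_0. apply exp_increasing. lra. }
  intros k0. set (k := (N + k0)%nat). set (J := ceil_nat (al * INR k - b)).
  assert (Hk1 : Rmax 1 (2 / (1 - al)) < INR k).
  { eapply Rlt_le_trans; [apply HN1|]. change (INR N1 + 1) with (INR N1 + INR 1). rewrite <- plus_INR. apply le_INR. unfold k, N; lia. }
  assert (Hk2 : exp ((4 - y) / (1 - be)) < INR k).
  { eapply Rlt_le_trans; [apply HN2|]. change (INR N2 + 1) with (INR N2 + INR 1). rewrite <- plus_INR. apply le_INR. unfold k, N; lia. }
  assert (K1 : 1 < INR k) by (eapply Rle_lt_trans; [apply Rmax_l | apply Hk1]).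
  assert (K2 : 2 / (1 - al) < INR k) by (eapply Rle_lt_trans; [apply Rmax_r | apply Hk1]).
  assert (Hbe : be < 1) by (unfold be; lra).
  assert (K3 : 4 - y <= (1 - be) * ln (INR k)).
  { assert ((4 - y) / (1 - be) < ln (INR k)) by (rewrite <- (ln_exp ((4 - y) / (1 - be))); apply ln_increasing; [apply exp_pos | auto]).
    apply Rlt_div_l in H; lra. }
  assert (HJ : INR J <= be * INR k).
  { destruct (ceil_nat_spec (al * INR k - b)) as [_ [E|E]]; fold J in E.
    - rewrite E. simpl. unfold be. nra.
    - apply Rlt_div_l in K2; [|lra]. unfold be. nra. }
  assert (PJ := pos_INR J).
  assert (X1 : INR J + 1 <= exp (INR J)) by (assert (H := exp_ineq1_le (INR J)); lra).
  assert (X2 : INR J ^ J <= exp (be * INR k * ln (INR k))).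
  { apply Rle_trans with (INR k ^ J); [apply pow_incr; nra|].
    rewrite <- Rpower_pow by lra. unfold Rpower. apply exp_le_mono.
    apply Rmult_le_compat_r; auto. rewrite <- ln_1. apply ln_le; lra. }
  assert (X3 : / INR (fact k) <= exp (INR k - INR k * ln (INR k))).
  { assert (H := pow_div_fact_le_exp (INR k) k ltac:(lra)). rewrite <- Rpower_pow in H by lra. unfold Rpower in H.
    unfold Rminus. rewrite exp_plus, exp_Ropp. assert (Q := exp_pos (INR k * ln (INR k))). unfold Rdiv in H.
    apply (Rmult_le_reg_l (exp (INR k * ln (INR k)))); auto. rewrite Rmult_comm in H |- *.
    replace (exp (INR k * ln (INR k)) * (exp (INR k) * / exp (INR k * ln (INR k)))) with (exp (INR k)) by (field; lra). lra. }
  assert (PJJ : 0 <= INR J ^ J) by (apply pow_le; auto). assert (PE := exp_pos (INR J)).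
  assert (PF : 0 < / INR (fact k)) by apply Rinv_0_lt_compat, INR_fact_lt_0.
  assert (PY := exp_pos (- y * INR k)).
  match goal with |- norm ?e <= _ => change (norm e) with (Rabs e) end.
  rewrite Rabs_pos_eq.
  2: { repeat apply Rmult_le_pos; lra. }
  apply Rle_trans with (exp (INR k - INR k * ln (INR k)) * (B * exp (INR J) * exp (INR J) * exp (be * INR k * ln (INR k))) * exp (- y * INR k)).
  - apply Rmult_le_compat_r; [lra|]. apply Rmult_le_compat; auto; try lra.
    + repeat apply Rmult_le_pos; lra.
    + apply Rmult_le_compat; auto; [repeat apply Rmult_le_pos; lra|]. apply Rmult_le_compat_r; [lra|].
      apply Rmult_le_compat_l; auto.
  - replace (exp (INR k - INR k * ln (INR k)) * (B * exp (INR J) * exp (INR J) * exp (be * INR k * ln (INR k))) * exp (- y * INR k))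
      with (B * exp (INR k - INR k * ln (INR k) + INR J + INR J + be * INR k * ln (INR k) + - y * INR k)) by (rewrite !exp_plus; ring).
    rewrite (Rmult_assoc B). apply Rmult_le_compat_l; auto.
    rewrite <- Rpower_pow by apply exp_pos. unfold Rpower. rewrite ln_exp, <- exp_plus. apply exp_le_mono.
    assert (INR J <= INR k) by nra.
    assert (INR k * (4 - y) <= INR k * ((1 - be) * ln (INR k))) by (apply Rmult_le_compat_l; lra).
    nra.
Qed.

(** * A majorant for the integrand, uniform in the approximation *)

Lemma exp_dominates_quartic (r : R) : 1 < r -> exists k, 0 < k /\ forall n, k * (1 + INR n) ^ 4 <= r ^ n.
Proof.
  intros Hr. set (h := sqrt (sqrt r) - 1).
  assert (Hs : 1 < sqrt r) by (rewrite <- sqrt_1; apply sqrt_lt_1; lra).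
  assert (Hh : 0 < h) by (unfold h; assert (1 < sqrt (sqrt r)) by (rewrite <- sqrt_1; apply sqrt_lt_1; lra); lra).
  assert (E : (1 + h) ^ 4 = r).
  { unfold h. replace (1 + (sqrt (sqrt r) - 1)) with (sqrt (sqrt r)) by ring.
    replace (sqrt (sqrt r) ^ 4) with ((sqrt (sqrt r) ^ 2) ^ 2) by ring. rewrite pow2_sqrt by lra. apply pow2_sqrt; lra. }
  exists (Rmin 1 h ^ 4). assert (M1 := Rmin_l 1 h). assert (M2 := Rmin_r 1 h).
  assert (M0 : 0 < Rmin 1 h) by (apply Rmin_pos; lra). split; [apply pow_lt; auto|].
  intros n. rewrite <- Rpow_mult_distr, <- E, <- pow_mult, Nat.mul_comm, pow_mult.
  assert (P := pos_INR n). apply pow_incr. split; [nra|].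
  eapply Rle_trans; [|apply poly; auto]. nra.
Qed.

(** The number th bounds the square of al (c + k) / (al c + b + k) for k >= 1; with b = 0 that
    quotient decreases in k, so its value at k = 1 is taken, while at k = 0 it would be 1. For 1 <=
    k <= n, u = t^2 / (c + k)^2 is at least 1, so (1 + u) / (1 + th u) >= 2 / (1 + th). *)
Lemma vert_ratio (al b c t : R) (n M : nat) : 0 < al < 1 -> 0 <= b -> 0 < c -> (n = 0%nat \/ c + INR n <= Rabs t) ->
  let th := (al * (c + 1) / (al * c + 1)) ^ 2 in
  exists N, (2 / (1 + th)) ^ n * vert (al * c + b) (al * t) M <= vert c t N.
Proof.
  intros Hal Hb Hc Hn th.
  assert (Hq : 0 < al * (c + 1) / (al * c + 1) < 1).
  { split; [apply Rdiv_lt_0_compat; nra|]. apply Rlt_div_l; nra. }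
  assert (Hth : 0 < th < 1) by (unfold th; nra).
  set (rho := 2 / (1 + th)).
  assert (Hrho : 1 <= rho <= 2).
  { unfold rho; split; [apply Rle_div_r; lra | apply Rle_div_l; lra]. }
  set (N := (M + n + 1)%nat). exists N.
  set (sg := al * c + b). assert (Hsg : 0 < sg) by (unfold sg; nra).
  (* Both products on the left are padded with ones up to N factors: [e] carries the gain at the
     indices 1 to n, [B] the factors of the approximant below M. The comparison can then be made
     factor by factor. *)
  set (e := fun k => if (Nat.leb 1 k && Nat.leb k n)%bool then rho else 1).
  set (B := fun k => if Nat.ltb k M then 1 + (al * t) ^ 2 / (sg + INR k) ^ 2 else 1).
  assert (PB : forall j, prodn B (M + j) = vert sg (al * t) M).
  { assert (P0 : forall j, (j <= M)%nat -> prodn B j = vert sg (al * t) j).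
    { induction j; intros Hj; [reflexivity|]. rewrite vert_S. simpl prodn. rewrite IHj by lia. f_equal.
      unfold B. destruct (Nat.ltb_spec j M); [reflexivity | lia]. }
    induction j; [rewrite Nat.add_0_r; auto|]. rewrite Nat.add_succ_r. simpl prodn. rewrite IHj. unfold B.
    destruct (Nat.ltb_spec (M + j) M); [lia | ring]. }
  assert (PE : forall j, prodn e (n + 1 + j) = rho ^ n).
  { assert (P0 : forall j, (j <= n)%nat -> prodn e (S j) = rho ^ j).
    { induction j; intros Hj; [unfold e; simpl; ring|]. change (prodn e (S j) * e (S j) = rho ^ S j). rewrite IHj by lia.
      unfold e. replace (Nat.leb 1 (S j) && Nat.leb (S j) n)%bool with true; [simpl; ring|].
      symmetry. apply andb_true_intro. split; apply Nat.leb_le; lia. }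
    induction j; [rewrite Nat.add_0_r, Nat.add_1_r; auto|]. rewrite Nat.add_succ_r. simpl prodn. rewrite IHj. unfold e.
    replace (Nat.leb 1 (n + 1 + j) && Nat.leb (n + 1 + j) n)%bool with false; [ring|].
    symmetry. apply Bool.andb_false_iff. right. apply Nat.leb_gt. lia. }
  rewrite <- (PE M), <- (PB (n + 1)%nat).
  replace (n + 1 + M)%nat with N by (unfold N; lia). replace (M + (n + 1))%nat with N by (unfold N; lia).
  rewrite <- prodn_mult. apply prodn_bounds. intros k _.
  assert (Pk := pos_INR k).
  set (u := t ^ 2 / (c + INR k) ^ 2). assert (Hck : 0 < (c + INR k) ^ 2) by nra.
  assert (U0 : 0 <= u) by (unfold u; apply Rdiv_le_0_compat; nra).
  (* Applied with w = 1 for every k and with w = th for k >= 1. *)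
  assert (Hw0 : forall w, 0 <= w -> (al * (c + INR k)) ^ 2 <= w * (sg + INR k) ^ 2 -> (al * t) ^ 2 / (sg + INR k) ^ 2 <= w * u).
  { intros w Hw H. apply Rle_div_l; [nra|]. unfold u.
    replace (w * (t ^ 2 / (c + INR k) ^ 2) * (sg + INR k) ^ 2) with (t ^ 2 / (c + INR k) ^ 2 * (w * (sg + INR k) ^ 2)) by (field; lra).
    eapply Rle_trans; [|apply Rmult_le_compat_l; [apply U0 | apply H]]. right. unfold u. field. lra. }
  assert (HB1 : 1 <= B k <= 1 + u).
  { unfold B. destruct (Nat.ltb_spec k M); [|lra].
    assert (0 <= (al * t) ^ 2 / (sg + INR k) ^ 2) by (apply Rdiv_le_0_compat; [apply pow2_ge_0 | nra]).
    assert (H1 := Hw0 1 ltac:(lra)). assert (al * (c + INR k) <= sg + INR k) by (unfold sg; nra).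
    assert ((al * (c + INR k)) ^ 2 <= 1 * (sg + INR k) ^ 2).
    { rewrite Rmult_1_l. apply pow_incr. split; [nra | auto]. }
    specialize (H1 H3). lra. }
  unfold e. destruct (Nat.leb_spec 1 k) as [L1|L1]; simpl; [|lra].
  destruct (Nat.leb_spec k n) as [L2|L2]; [|lra].
  split; [apply Rmult_le_pos; lra|].
  assert (Hkn : INR k <= INR n) by (apply le_INR; auto).
  assert (Hk1 : 1 <= INR k) by (apply (le_INR 1); auto).
  assert (U1 : 1 <= u).
  { destruct Hn as [->|Hn]; [lia|]. unfold u. apply Rle_div_r; auto. rewrite Rmult_1_l, <- (pow2_abs t). apply pow_incr. lra. }
  assert (HB2 : B k <= 1 + th * u).
  { unfold B. destruct (Nat.ltb_spec k M); [|assert (0 <= th * u) by (apply Rmult_le_pos; lra); lra].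
    apply Rplus_le_compat_l. apply Hw0; [lra|]. unfold th. rewrite <- Rpow_mult_distr. apply pow_incr. split; [apply Rmult_le_pos; lra|].
    replace (al * (c + 1) / (al * c + 1) * (sg + INR k)) with (al * (c + 1) * (sg + INR k) / (al * c + 1)) by (field; nra).
    apply (Rmult_le_reg_r (al * c + 1)); [nra|]. unfold Rdiv, sg.
    rewrite (Rmult_assoc _ (/ _)), Rinv_l, Rmult_1_r by nra.
    assert (0 <= c * (INR k - 1) * (1 - al)) by (repeat apply Rmult_le_pos; lra).
    assert (0 <= (c + 1) * b) by (apply Rmult_le_pos; lra).
    assert (0 <= al * (c * (INR k - 1) * (1 - al) + (c + 1) * b)) by (apply Rmult_le_pos; lra). lra. }
  apply Rle_trans with (rho * (1 + th * u)); [apply Rmult_le_compat_l; lra|].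
  unfold rho. replace (2 / (1 + th) * (1 + th * u)) with (2 * (1 + th * u) / (1 + th)) by (field; lra).
  apply Rle_div_l; [lra|]. nra.
Qed.

(** With n about |t| - c the squared quotient decays like a geometric sequence in n, hence
    exponentially in |t|; only the part (1 + t^2)^(-2) of this decay is kept. *)
Lemma gamma_ratio_dominated (al b c : R) : 0 < al < 1 -> 0 <= b -> 0 < c ->
  exists K, 0 < K /\ forall m t,
    Cmod (rG (S m) (al * c + b, al * t)) <= K / (1 + t ^ 2) * Cmod (rgammaC (c, t)).
Proof.
  intros Hal Hb Hc. set (sg := al * c + b). assert (Hsg : 0 < sg) by (unfold sg; nra).
  assert (Pg := rgam_pos c Hc).
  set (th := (al * (c + 1) / (al * c + 1)) ^ 2).
  assert (Hq : 0 < al * (c + 1) / (al * c + 1) < 1).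
  { split; [apply Rdiv_lt_0_compat; nra|]. apply Rlt_div_l; nra. }
  assert (Hth : 0 < th < 1) by (unfold th; nra).
  destruct (exp_dominates_quartic (2 / (1 + th))) as [k [Hk Hkn]]; [apply Rlt_div_r; lra|].
  set (Bd := rG_bound sg).
  assert (B0 : 0 <= Bd).
  { eapply Rle_trans; [apply Cmod_ge_0|]. apply (rG_bounded sg 0 0). rewrite Cmod_0. lra. }
  (* From (1 + t^2)^2 <= (c + 2)^4 (1 + n)^4 and k (1 + n)^4 <= (2 / (1 + th))^n; the square roots
     undo the squared moduli. *)
  set (K := Bd / rgam c * ((c + 2) ^ 2 / sqrt k)).
  assert (Sk := sqrt_lt_R0 k Hk).
  exists (K + 1). assert (HK : 0 <= K).
  { unfold K. apply Rmult_le_pos; apply Rdiv_le_0_compat; try lra. apply pow2_ge_0. }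
  split; [lra|]. intros m t.
  assert (Hn : exists n : nat, (n = 0%nat \/ c + INR n <= Rabs t) /\ Rabs t <= INR n + c + 1).
  { destruct (Rle_dec c (Rabs t)) as [L|L].
    - destruct (nfloor_ex (Rabs t - c)) as [n Hn]; [lra|]. exists n. split; [right|]; lra.
    - exists 0%nat. simpl. split; [auto | lra]. }
  destruct Hn as [n [Hn1 Hn2]].
  destruct (vert_ratio al b c t n (S (S m)) Hal Hb Hc Hn1) as [N HN]. fold sg th in HN.
  assert (L := rgammaC_vert_lower c t N Hc).
  assert (T1 : 0 < 1 + t ^ 2) by (assert (Q := pow2_ge_0 t); lra).
  apply Rle_trans with (K / (1 + t ^ 2) * Cmod (rgammaC (c, t))).
  2: { apply Rmult_le_compat_r; [apply Cmod_ge_0|]. apply Rmult_le_compat_r; [apply Rlt_le, Rinv_0_lt_compat; auto | lra]. }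
  apply Rsqr_incr_0_var; [|apply Rmult_le_pos; [apply Rdiv_le_0_compat; lra | apply Cmod_ge_0]].
  rewrite !Rsqr_pow2, Rpow_mult_distr, Cmod_rG_vert by auto.
  assert (HR : rGR (S m) sg ^ 2 <= Bd ^ 2).
  { rewrite <- pow2_abs. apply pow_incr. split; [apply Rabs_pos|].
    assert (A := rG_bounded sg (RtoC sg) m). rewrite rG_R, !Cmod_R in A. apply A. rewrite Rabs_pos_eq; lra. }
  assert (V0 := vert_ge_1 sg (al * t) (S (S m)) Hsg).
  apply Rle_trans with (Bd ^ 2 * vert sg (al * t) (S (S m))); [apply Rmult_le_compat_r; lra|].
  assert (HT : (1 + t ^ 2) ^ 2 <= (c + 2) ^ 4 * (1 + INR n) ^ 4).
  { replace ((c + 2) ^ 4 * (1 + INR n) ^ 4) with ((((c + 2) * (1 + INR n)) ^ 2) ^ 2) by ring. apply pow_incr. split; [lra|].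
    apply Rle_trans with ((1 + Rabs t) ^ 2); [rewrite <- (pow2_abs t); assert (Q := Rabs_pos t); nra|].
    apply pow_incr. assert (Q := Rabs_pos t). assert (Q' := pos_INR n). split; [lra | nra]. }
  specialize (Hkn n).
  set (r := (2 / (1 + th)) ^ n) in *.
  assert (HT' : (1 + t ^ 2) ^ 2 * k <= (c + 2) ^ 4 * r).
  { apply Rle_trans with ((c + 2) ^ 4 * (1 + INR n) ^ 4 * k); [apply Rmult_le_compat_r; lra|].
    rewrite Rmult_assoc, (Rmult_comm ((1 + INR n) ^ 4)). apply Rmult_le_compat_l; auto. apply pow_le; lra. }
  apply Rle_trans with ((K / (1 + t ^ 2)) ^ 2 * (rgam c ^ 2 * vert c t N)).
  2: { apply Rmult_le_compat_l; [apply pow2_ge_0 | auto]. }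
  apply Rle_trans with ((K / (1 + t ^ 2)) ^ 2 * (rgam c ^ 2 * (r * vert sg (al * t) (S (S m))))).
  2: { apply Rmult_le_compat_l; [apply pow2_ge_0|]. apply Rmult_le_compat_l; [apply pow2_ge_0 | auto]. }
  set (v := vert sg (al * t) (S (S m))) in *.
  replace ((K / (1 + t ^ 2)) ^ 2 * (rgam c ^ 2 * (r * v))) with (Bd ^ 2 * v * ((c + 2) ^ 4 * r / ((1 + t ^ 2) ^ 2 * sqrt k ^ 2))).
  2: { unfold K. field. repeat split; lra. }
  rewrite pow2_sqrt by lra.
  rewrite <- (Rmult_1_r (Bd ^ 2 * v)) at 1. apply Rmult_le_compat_l; [apply Rmult_le_pos; [apply pow2_ge_0 | lra]|].
  apply Rle_div_r; [apply Rmult_lt_0_compat; [apply pow_lt|]; auto|]. lra.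
Qed.

(** * Integrals of Gamma(w) / Gamma(al w + b) *)

Lemma line_affine (al b c t : R) : (RtoC al * (c, t) + RtoC b)%C = ((al * c + b)%R, (al * t)%R).
Proof. apply C_ext; simpl; ring. Qed.

(** At al w + b the approximant is a product of linear factors al w + b + i divided by n! n^b n^(al
    w); the last power is absorbed by replacing y with y - al ln n. *)
Lemma csint_gamma_rG (al b y c : R) (m : nat) : 0 < c ->
  exists V : R, is_series (fun k => (-1) ^ k / INR (fact k) * rGR (S m) (b - al * INR k) * exp (- y * INR k)) V /\
    csint (fun t => / rgammaC (c, t) * rG (S m) (RtoC al * (c, t) + RtoC b) * cexp (RtoC y * (c, t)))%C (RtoC (2 * PI * V)).
Proof.
  intros Hc. set (n := S m). assert (Pn : 0 < INR n) by apply INR_S_pos.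
  set (ps := map (fun i => (al, b + INR i)) (seq 0 (S n))).
  set (L := ln (INR n)).
  set (q := / (INR (fact n) * Rpower (INR n) b)).
  assert (F := INR_fact_lt_0 n). assert (Pr : 0 < Rpower (INR n) b) by apply exp_pos.
  destruct (csint_gamma_lin ps (y - al * L) c Hc) as [V [SV IV]].
  exists (q * V). split.
  - apply is_series_ext with (fun k => q * ((-1) ^ k / INR (fact k) * linR ps (- INR k) * exp (- (y - al * L) * INR k))).
    + intros k. match goal with |- @eq _ ?u ?v => change (@eq R u v) end.
      assert (E : linR ps (- INR k) = poch (b - al * INR k) (S n)).
      { unfold linR, poch, ps. rewrite map_map. f_equal. apply map_ext. intros i. simpl. ring. }
      rewrite E. unfold rGR. fold n.
      replace (- (y - al * L) * INR k) with (- y * INR k + al * INR k * L) by ring. rewrite exp_plus.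
      assert (E2 : Rpower (INR n) (b - al * INR k) = Rpower (INR n) b * / exp (al * INR k * L)).
      { unfold Rminus. rewrite Rpower_plus, Rpower_Ropp. reflexivity. }
      rewrite E2. unfold q. assert (X := exp_pos (al * INR k * L)). field. repeat split; try lra. apply INR_fact_neq_0.
    + apply (is_series_scal (V := R_NormedModule) q _ V), SV.
  - apply (csint_ext (fun t => RtoC q * (/ rgammaC (c, t) * linC ps (c, t) * cexp (RtoC (y - al * L) * (c, t))))%C _
             (RtoC q * RtoC (2 * PI * V))%C).
    + intros t.
      assert (E : linC ps (c, t) = ris (RtoC al * (c, t) + RtoC b) (S n)).
      { unfold linC, ris, ps. rewrite map_map. apply prodC_ext. intros i _. cbn [fst snd]. rewrite RtoC_plus. ring. }
      rewrite E, rG_ris, cpow_add, (cpow_R (INR n) b), cpow_cexp. fold L.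
      assert (E2 : cexp (RtoC (y - al * L) * (c, t)) = (cexp (RtoC y * (c, t)) * / cexp (RtoC al * (c, t) * RtoC L))%C).
      { rewrite <- cexp_opp, <- cexp_add. f_equal. rewrite RtoC_minus, RtoC_mult. ring. }
      rewrite E2. unfold q. rewrite RtoC_inv, RtoC_mult by (apply Rmult_integral_contrapositive; lra).
      field. repeat split; try apply cexp_neq_0; try (apply rgammaC_neq_0; auto); apply RtoC_neq_0; lra.
    + rewrite <- RtoC_mult. f_equal. ring.
    + apply csint_scal, IV.
Qed.

(** Tannery's theorem passes to the limit in the values and dominated convergence in the integrals.
    Both majorants are exported: K turns the symmetric limit into an improper integral, M permits
    the regrouping of the series. *)
Theorem csint_gamma_ratio (al b y c : R) : 0 < al < 1 -> 0 <= b -> 0 < c ->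
  exists (V K : R) (M : nat -> R),
    is_series (fun k => (-1) ^ k / INR (fact k) * rgam (b - al * INR k) * exp (- y * INR k)) V /\
    csint (fun t => / rgammaC (c, t) * rgammaC (RtoC al * (c, t) + RtoC b) * cexp (RtoC y * (c, t)))%C (RtoC (2 * PI * V)) /\
    0 <= K /\
    (forall t, Cmod (/ rgammaC (c, t) * rgammaC (RtoC al * (c, t) + RtoC b) * cexp (RtoC y * (c, t))) <= K / (1 + t ^ 2)) /\
    ex_series M /\
    (forall k, Rabs ((-1) ^ k / INR (fact k) * rgam (b - al * INR k) * exp (- y * INR k)) <= M k).
Proof.
  intros Hal Hb Hc. assert (Pg := rgam_pos c Hc).
  set (a := fun m k => (-1) ^ k / INR (fact k) * rGR (S m) (b - al * INR k) * exp (- y * INR k)).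
  set (f := fun m t => (/ rgammaC (c, t) * rG (S m) (RtoC al * (c, t) + RtoC b) * cexp (RtoC y * (c, t)))%C).
  assert (Hrn : forall t, rgammaC (c, t) <> 0%C) by (intros; apply rgammaC_neq_0; auto).
  set (V := fun m => Series (a m)).
  assert (HV : forall m, is_series (a m) (V m) /\ csint (f m) (RtoC (2 * PI * V m))).
  { intros m. destruct (csint_gamma_rG al b y c m Hc) as [v [H1 H2]].
    replace (V m) with v by (symmetry; apply (is_series_unique _ _ H1)). auto. }
  set (B := rG_bound (b + 1) + 1).
  assert (B0 : 0 <= B).
  { assert (0 <= rG_bound (b + 1)); [|unfold B; lra].
    eapply Rle_trans; [apply Cmod_ge_0|]. apply (rG_bounded (b + 1) 0 0). rewrite Cmod_0. lra. }
  set (M := fun k => / INR (fact k) * (B * (INR (ceil_nat (al * INR k - b)) + 1) * exp (INR (ceil_nat (al * INR k - b)))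
     * INR (ceil_nat (al * INR k - b)) ^ ceil_nat (al * INR k - b)) * exp (- y * INR k)).
  destruct (tannery a (fun k => (-1) ^ k / INR (fact k) * rgam (b - al * INR k) * exp (- y * INR k)) M V) as [HM [W [SW LW]]].
  - intros m k. unfold a, M. rewrite !Rabs_mult.
    rewrite (Rabs_pos_eq (exp _)) by apply Rlt_le, exp_pos. apply Rmult_le_compat_r; [apply Rlt_le, exp_pos|].
    apply Rmult_le_compat; try apply Rabs_pos.
    + unfold Rdiv. rewrite Rabs_mult, pow_1_abs, Rmult_1_l. right. apply Rabs_pos_eq. apply Rlt_le, Rinv_0_lt_compat, INR_fact_lt_0.
    + apply rGR_neg_bound; lra.
  - apply ex_series_rgam_bound; auto.
  - intros k. apply (is_lim_seq_mult' _ _ _ _); [|apply is_lim_seq_const].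
    apply (is_lim_seq_mult' _ _ _ _); [apply is_lim_seq_const|].
    apply (is_lim_seq_incr_1 (fun m => rGR m (b - al * INR k))), rgam_lim.
  - intros m. apply HV.
  - destruct (gamma_ratio_dominated al b c Hal Hb Hc) as [K [HK HKd]].
    assert (Hf : forall m t, Cmod (f m t) <= K * exp (y * c) / (1 + t ^ 2)).
    { intros m t. unfold f. rewrite !Cmod_mult, Cmod_inv, Cmod_exp_line, line_affine by auto.
      specialize (HKd m t). assert (G := rgammaC_vert_ge c t Hc). assert (X := exp_pos (y * c)).
      replace (K * exp (y * c) / (1 + t ^ 2)) with (/ Cmod (rgammaC (c, t)) * (K / (1 + t ^ 2) * Cmod (rgammaC (c, t))) * exp (y * c)).
      2: { field. assert (Q := pow2_ge_0 t). split; lra. }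
      apply Rmult_le_compat_r; [lra|]. apply Rmult_le_compat_l; auto. apply Rlt_le, Rinv_0_lt_compat. lra. }
    assert (X := exp_pos (y * c)).
    exists W, (K * exp (y * c)), M. split; [|split; [|split; [|split; [|split]]]]; auto.
    + apply (csint_dominated f _ (K * exp (y * c)) (fun m => RtoC (2 * PI * V m))); auto.
      * apply Ccont_mult; [|apply Ccont_exp_line]. apply Ccont_mult.
        -- apply Ccont_inv; auto. apply Ccont_rgammaC, Ccont_line.
        -- apply Ccont_rgammaC. apply Ccont_plus; [|apply Ccont_const]. apply Ccont_mult; [apply Ccont_const | apply Ccont_line].
      * apply Rmult_le_pos; lra.
      * intros T eps HT Heps. set (r := al * c + b + T).
        destruct (exists_div_INR_S_lt (rG_err r * exp (y * c) / rgam c) eps Heps) as [N HN].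
        exists N. intros n t Hn Ht. unfold f.
        match goal with |- Cmod (?g * ?u * ?e - ?g * ?v * ?e) <= _ =>
          replace (g * u * e - g * v * e)%C with (- (g * (v - u) * e))%C by ring end.
        rewrite Cmod_opp, !Cmod_mult, Cmod_inv, Cmod_exp_line by auto.
        assert (A1 := rG_rgammaC_err r (RtoC al * (c, t) + RtoC b) n).
        rewrite line_affine in *.
        assert (A2 : Cmod ((al * c + b)%R, (al * t)%R) <= r).
        { unfold r. apply Cmod_line_le; [nra|]. rewrite Rabs_mult, (Rabs_pos_eq al) by lra. assert (Q := Rabs_pos t). nra. }
        specialize (A1 A2). assert (G := rgammaC_vert_ge c t Hc).
        assert (Ep := rG_err_pos r ltac:(unfold r; nra)).
        apply Rle_trans with (/ rgam c * (rG_err r / INR (S N)) * exp (y * c)).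
        -- apply Rmult_le_compat_r; [lra|]. apply Rmult_le_compat.
           ++ apply Rlt_le, Rinv_0_lt_compat. lra.
           ++ apply Cmod_ge_0.
           ++ apply Rinv_le_contravar; auto.
           ++ eapply Rle_trans; [apply A1|]. apply Rmult_le_compat_l; auto. apply Rinv_le_contravar; [apply INR_S_pos|].
              apply le_INR; lia.
        -- replace (/ rgam c * (rG_err r / INR (S N)) * exp (y * c)) with (rG_err r * exp (y * c) / rgam c / INR (S N)); [lra|].
           field. assert (P := INR_S_pos N). split; lra.
      * intros m. apply HV.
      * apply Clim_RtoC. apply (is_lim_seq_scal_l _ (2 * PI) W). auto.
    + apply Rmult_le_pos; lra.
    + intros t. assert (L : Clim (fun m => f m t) (/ rgammaC (c, t) * rgammaC (RtoC al * (c, t) + RtoC b) * cexp (RtoC y * (c, t)))%C).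
      { apply Clim_mult; [|apply Clim_const]. apply Clim_mult; [apply Clim_const|].
        apply (Clim_subseq (fun n => rG n (RtoC al * (c, t) + RtoC b)) _ S); [|apply rgammaC_lim].
        apply eventually_subseq_loc. exists 0%nat; intros; lia. }
      apply Clim_Cmod in L. refine (is_lim_seq_le _ _ _ _ _ L (is_lim_seq_const (K * exp (y * c) / (1 + t ^ 2)))). auto.
    + apply ex_series_rgam_bound; auto.
Qed.

(** * The stable density and the Fox function *)

(** For b = 0 and after division by x these are the terms of the Humbert-Pollard series of the
    stable density. *)
Definition levy_term (al b x : R) (k : nat) : R :=
  (-1) ^ k / INR (fact k) * rgam (b - al * INR k) * exp (- (al * ln x) * INR k).

(** The common reduction: under w = d + i lam t the line Re s = c becomes Re w = d. The slope lam is
    negative for the density, where the line is traversed backwards, and positive for the Fox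
    functions. *)
Lemma MB_line_gamma_ratio (F : C -> C) (al b x d lam kap c : R) :
  0 < al < 1 -> 0 <= b -> 0 < d -> lam <> 0 ->
  (forall t, F (c, t) = RtoC kap * (/ rgammaC (d, (lam * t)%R) * rgammaC (RtoC al * (d, (lam * t)%R) + RtoC b)
               * cexp (RtoC (al * ln x) * (d, (lam * t)%R))))%C ->
  MB_line F c = RtoC (kap / Rabs lam * Series (levy_term al b x)).
Proof.
  intros Hal Hb Hd Hlam HF. assert (Pp := PI_RGT_0).
  assert (Pl : 0 < Rabs lam) by (apply Rabs_pos_lt; auto).
  destruct (csint_gamma_ratio al b (al * ln x) d Hal Hb Hd) as [V [K [M [SV [IV [K0 [HK _]]]]]]].
  rewrite (is_series_unique _ _ SV : Series (levy_term al b x) = V).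
  set (g := fun t => (/ rgammaC (d, t) * rgammaC (RtoC al * (d, t) + RtoC b) * cexp (RtoC (al * ln x) * (d, t)))%C) in *.
  assert (HKg : forall t, Cmod (g t) <= K / (1 + t ^ 2)) by exact HK.
  assert (HFg : forall t, F (c, t) = (RtoC kap * g (lam * t)%R)%C) by exact HF.
  clear HK HF. clearbody g.
  assert (S : forall (h : R -> R) v, continuity h -> sint h v -> sint (fun t => h (lam * t)) (v / Rabs lam)).
  { intros h v Ch Hh. destruct (Rlt_dec 0 lam) as [L|L].
    - rewrite Rabs_pos_eq by lra. apply sint_scale; auto.
    - rewrite Rabs_left by lra. apply (sint_ext (fun t => h (- (- lam * t)))); [intros; f_equal; ring|].
      apply (sint_scale (fun t => h (- t))); [|lra|apply sint_reflect; auto].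
      apply (continuity_comp Ropp h); auto. apply continuity_opp, derivable_continuous, derivable_id. }
  destruct IV as [[Cg1 Cg2] [I1 I2]].
  assert (Cl : continuity (fun t => lam * t)).
  { intros t. apply derivable_continuous_pt. exists lam. apply is_derive_Reals. auto_derive; auto. ring. }
  assert (Cg : Ccont (fun t => g (lam * t))).
  { split; [apply (continuity_comp (fun t => lam * t) (fun t => Re (g t))) | apply (continuity_comp (fun t => lam * t) (fun t => Im (g t)))]; auto. }
  (* It restores the form of the majorant: 1 + t^2 <= (1 + 1/lam^2) (1 + lam^2 t^2). *)
  set (K' := K * (1 + / lam ^ 2)).
  assert (L2 : 0 < lam ^ 2) by (apply pow2_gt_0; auto).
  assert (HI : is_RInt_gen (V := C_R_NormedModule) (fun t => F (c, t)) (Rbar_locally m_infty) (Rbar_locally p_infty)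
                 (RtoC (kap / Rabs lam * (2 * PI * V)))).
  { assert (H1 : csint (fun t => RtoC kap * g (lam * t)%R)%C (RtoC kap * RtoC (2 * PI * V / Rabs lam))%C).
    { apply csint_scal. split; auto. split.
      - apply (S (fun t => Re (g t)) _ Cg1 I1).
      - replace (Im (RtoC (2 * PI * V / Rabs lam))) with (0 / Rabs lam) by (simpl; field; lra).
        apply (S (fun t => Im (g t)) _ Cg2 I2). }
    replace (RtoC kap * RtoC (2 * PI * V / Rabs lam))%C with (RtoC (kap / Rabs lam * (2 * PI * V))) in H1
      by (rewrite <- RtoC_mult; f_equal; field; lra).
    assert (H2 : csint (fun t => F (c, t)) (RtoC (kap / Rabs lam * (2 * PI * V)))).
    { eapply csint_ext; [|reflexivity|exact H1]. intros t. symmetry. apply HFg. }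
    destruct H2 as [C2 [J1 J2]].
    apply (is_RInt_gen_of_sint _ (Rabs kap * K')); auto.
    - apply Rmult_le_pos; [apply Rabs_pos|]. apply Rmult_le_pos; auto. assert (0 < / lam ^ 2) by (apply Rinv_0_lt_compat; auto). lra.
    - intros t. rewrite HFg, Cmod_mult, Cmod_R. unfold Rdiv. rewrite Rmult_assoc.
      apply Rmult_le_compat_l; [apply Rabs_pos|]. eapply Rle_trans; [apply HKg|].
      assert (T := pow2_ge_0 t). rewrite Rpow_mult_distr.
      assert (T' : 0 <= lam ^ 2 * t ^ 2) by (apply Rmult_le_pos; lra).
      apply Rle_div_l; [lra|].
      replace (K' * / (1 + t ^ 2) * (1 + lam ^ 2 * t ^ 2)) with (K * ((1 + / lam ^ 2) * (1 + lam ^ 2 * t ^ 2) / (1 + t ^ 2))).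
      2: { unfold K'. field. split; lra. }
      rewrite <- (Rmult_1_r K) at 1. apply Rmult_le_compat_l; auto. apply Rle_div_r; [lra|].
      replace ((1 + / lam ^ 2) * (1 + lam ^ 2 * t ^ 2)) with (1 + t ^ 2 + lam ^ 2 * t ^ 2 + / lam ^ 2) by (field; lra).
      assert (0 < / lam ^ 2) by (apply Rinv_0_lt_compat; auto). lra. }
  unfold MB_line. rewrite (is_RInt_gen_unique (V := C_R_CompleteNormedModule) _ _ HI), <- RtoC_mult. f_equal. field. lra.
Qed.

(** The substitution w = (1 - s)/al turns Gamma(1/al - s/al) into Gamma(w), 1 - s into al w, and
    x^(-s) into x^(-1) x^(al w); thus b = 0. *)
Lemma levy_series (al c0 x : R) : 0 < al < 1 -> 0 < c0 < al -> 0 < x ->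
  levy al c0 x = RtoC (/ x * Series (levy_term al 0 x)).
Proof.
  intros Hal Hc Hx. unfold levy.
  rewrite (MB_line_gamma_ratio _ al 0 x ((1 - c0) / al) (- / al) (/ (al * x)) c0); auto; try lra.
  - f_equal. rewrite Rabs_Ropp, Rabs_pos_eq; [field; lra|]. apply Rlt_le, Rinv_0_lt_compat; lra.
  - apply Rdiv_lt_0_compat; lra.
  - apply Ropp_neq_0_compat, Rinv_neq_0_compat. lra.
  - intros t. set (w := ((1 - c0) / al, (- / al * t)%R)). set (s := (c0, t)).
    assert (Na : RtoC al <> 0%C) by (apply RtoC_neq_0; lra).
    assert (E1 : (RtoC (/ al) - s / RtoC al)%C = w).
    { unfold Cdiv. rewrite <- RtoC_inv by lra. apply C_ext; simpl; field; lra. }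
    assert (E2 : (1 - s)%C = (RtoC al * w + RtoC 0)%C) by (apply C_ext; simpl; field; lra).
    rewrite E1, E2. unfold GammaC.
    assert (E3 : cpow x (- s) = (RtoC (/ x) * cexp (RtoC (al * ln x) * w))%C).
    { rewrite cpow_cexp. rewrite <- (exp_ln (/ x)) by (apply Rinv_0_lt_compat; auto).
      rewrite <- cexp_R, <- cexp_add, ln_Rinv by auto. f_equal. apply C_ext; simpl; field; lra. }
    rewrite E3, Rinv_mult, (RtoC_mult (/ al) (/ x)), (RtoC_inv al) by lra. unfold Cdiv. ring.
Qed.

(** The functional equation at - al (k + 1) produces the factor - al (k + 1), which lowers the
    factorial and replaces b = 0 by b = 1 - al. This is where the density and the Fox function
    meet. *)
Lemma levy_term_shift (al x : R) (k : nat) : 0 < x ->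
  levy_term al 0 x (S k) = al * exp (- (al * ln x)) * levy_term al (1 - al) x k.
Proof.
  intros Hx. unfold levy_term.
  rewrite (rgam_succ (0 - al * INR (S k))).
  replace (0 - al * INR (S k) + 1) with (1 - al - al * INR k) by (rewrite S_INR; ring).
  replace (- (al * ln x) * INR (S k)) with (- (al * ln x) + - (al * ln x) * INR k) by (rewrite S_INR; ring).
  rewrite exp_plus. change (fact (S k)) with (S k * fact k)%nat. rewrite mult_INR.
  assert (P := INR_S_pos k). assert (F := INR_fact_lt_0 k). rewrite <- tech_pow_Rmult. field. lra.
Qed.

Lemma levy_term_0 (al x : R) : levy_term al 0 x 0 = 0.
Proof. unfold levy_term. simpl. rewrite Rmult_0_r, Rminus_0_r, rgam_0. ring. Qed.

Lemma levy_term_dominated (al b x : R) : 0 < al < 1 -> 0 <= b ->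
  exists M, ex_series M /\ forall k, Rabs (levy_term al b x k) <= M k.
Proof.
  intros Hal Hb. destruct (csint_gamma_ratio al b (al * ln x) 1 Hal Hb Rlt_0_1) as [V [K [M [_ [_ [_ [_ HM]]]]]]].
  exists M. exact HM.
Qed.

Lemma Series_levy_shift (al x : R) : 0 < al < 1 -> 0 < x ->
  Series (levy_term al 0 x) = al * exp (- (al * ln x)) * Series (levy_term al (1 - al) x).
Proof.
  intros Hal Hx. destruct (levy_term_dominated al 0 x Hal (Rle_refl 0)) as [M [EM HM]].
  rewrite Series_incr_1.
  2: { apply (ex_series_le (V := R_CompleteNormedModule) _ M); auto. }
  rewrite levy_term_0, Rplus_0_l, <- Series_scal_l. apply Series_ext. intros k. apply levy_term_shift; auto.
Qed.

(** The prefactor of (i). It equals l q / x times the quotient [mulc q / mulc p] of the two Gauss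
    constants. *)
Definition Kcst (p q : nat) (l x : R) : R :=
  l * sqrt (INR p * INR q) / (x * Rpower (2 * PI) ((INR q - INR p) / 2)).

Lemma Rpower_half (a : R) : 0 < a -> Rpower a (- / 2) = / sqrt a.
Proof. intros H. rewrite Rpower_Ropp, Rpower_sqrt; auto. Qed.

Lemma Kcst_mulc (p q : nat) (l x : R) : (0 < p)%nat -> (0 < q)%nat -> 0 < x ->
  Kcst p q l x * mulc p * INR p = mulc q * INR q * (INR p * l) / x.
Proof.
  intros Hp Hq Hx. assert (P : 0 < INR p) by (apply lt_0_INR; auto). assert (Q : 0 < INR q) by (apply lt_0_INR; auto).
  unfold Kcst, mulc. rewrite !Rpower_half by auto.
  replace ((1 - INR p) / 2) with ((1 - INR q) / 2 + (INR q - INR p) / 2) by field. rewrite Rpower_plus.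
  assert (R1 : 0 < Rpower (2 * PI) ((INR q - INR p) / 2)) by apply exp_pos.
  assert (Sp := sqrt_lt_R0 _ P). assert (Sq := sqrt_lt_R0 _ Q).
  assert (Hs : / sqrt (INR q) * INR q = sqrt (INR q)).
  { rewrite <- (sqrt_sqrt (INR q)) at 2 by lra. field. lra. }
  rewrite sqrt_mult, (Rmult_assoc _ (/ sqrt (INR q))), Hs by lra. field. lra.
Qed.

Lemma prodC_rgammaC_full (n : nat) (z : C) : (0 < n)%nat ->
  (rgammaC (z + 1) * prodC (map (fun k => rgammaC (z + RtoC (INR k / INR n))) (seq 1 (n - 1))))%C
  = (RtoC (mulc n) * cpow (INR n) (RtoC (INR n) * z + 1) * rgammaC (RtoC (INR n) * z + 1))%C.
Proof.
  intros Hn. rewrite <- rgammaC_multiplication_1 by auto.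
  replace (seq 1 n) with (seq 1 (n - 1) ++ [n]).
  2: { replace (seq 1 n) with (seq 1 (S (n - 1))) by (f_equal; lia). rewrite seq_S. repeat f_equal. lia. }
  rewrite map_app, prodC_app. simpl. replace (INR n / INR n) with 1 by (field; apply not_0_INR; lia). ring.
Qed.

Lemma prodR_rgam_full (n : nat) (z : R) : (0 < n)%nat ->
  rgam (z + 1) * prodR (map (fun k => rgam (z + INR k / INR n)) (seq 1 (n - 1)))
  = mulc n * Rpower (INR n) (INR n * z + 1) * rgam (INR n * z + 1).
Proof.
  intros Hn. rewrite <- rgam_multiplication_1 by auto.
  replace (seq 1 n) with (seq 1 (n - 1) ++ [n]).
  2: { replace (seq 1 n) with (seq 1 (S (n - 1))) by (f_equal; lia). rewrite seq_S. repeat f_equal. lia. }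
  rewrite map_app, prodR_app. simpl. replace (INR n / INR n) with 1 by (field; apply not_0_INR; lia). ring.
Qed.

(** The integrand of (i), to which those of (ii) and (iii) are reduced as well. *)
Definition H_integrand (p q : nat) (l z : R) (s : C) : C :=
  (/ (rgammaC (s + 1) * prodC (map (fun k => rgammaC (s + RtoC (INR k / INR q))) (seq 1 (q - 1)))) *
   (rgammaC (RtoC l * s + 1) * prodC (map (fun k => rgammaC (RtoC l * s + RtoC (INR k / INR p))) (seq 1 (p - 1)))) *
   cpow z (- s))%C.

(** The multiplication formula at q and at p gives Gamma(v) / Gamma(al v + 1 - al) with v = 1 + q s,
    and Re v > 0 is the condition c > -1/q. The constant kap is 1 in (i) and [mulc L * INR L] in the
    integral cases. *)
Lemma MB_line_H (p q : nat) (l x z c kap : R) (F : C -> C) :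
  (0 < p)%nat -> (0 < q)%nat -> 0 < l -> INR p * l < INR q -> 0 < x -> - / INR q < c ->
  ln z = INR p * l * ln (INR p) - INR p * l * ln x - INR q * ln (INR q) ->
  (forall t, F (c, t) = RtoC kap * H_integrand p q l z (c, t))%C ->
  (RtoC (Kcst p q l x) * MB_line F c)%C = RtoC (kap * (/ x * Series (levy_term (INR p * l / INR q) 0 x))).
Proof.
  intros Hp Hq Hl Hpq Hx Hc Hz HF.
  assert (P : 0 < INR p) by (apply lt_0_INR; auto). assert (Q : 0 < INR q) by (apply lt_0_INR; auto).
  set (al := INR p * l / INR q).
  assert (Hal : 0 < al < 1).
  { unfold al. split; [apply Rdiv_lt_0_compat; nra|]. apply Rlt_div_l; lra. }
  assert (Mq := mulc_pos q). assert (Mp := mulc_pos p).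
  rewrite (MB_line_gamma_ratio F al (1 - al) x (1 + INR q * c) (INR q)
             (kap * (mulc p / mulc q * (INR p / INR q) * exp (- (al * ln x)))) c); auto; try lra.
  - rewrite <- RtoC_mult, (Rabs_pos_eq (INR q)) by lra. f_equal. rewrite Series_levy_shift by auto.
    set (V := Series _). set (X := exp _).
    assert (E := Kcst_mulc p q l x Hp Hq Hx).
    replace (Kcst p q l x * (kap * (mulc p / mulc q * (INR p / INR q) * X) / INR q * V))
      with (Kcst p q l x * mulc p * INR p * (kap * X * V / (mulc q * INR q * INR q))) by (field; lra).
    rewrite E. unfold al. field. lra.
  - apply (Rmult_lt_compat_l (INR q)) in Hc; auto. replace (INR q * - / INR q) with (-1) in Hc by (field; lra). lra.
  - intros t. rewrite HF. set (s := (c, t)). set (v := ((1 + INR q * c)%R, (INR q * t)%R)).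
    assert (E1 : (RtoC (INR q) * s + 1)%C = v) by (apply C_ext; simpl; ring).
    assert (E2 : (RtoC (INR p) * (RtoC l * s) + 1)%C = (RtoC al * v + RtoC (1 - al))%C).
    { unfold al. apply C_ext; simpl; field; lra. }
    unfold H_integrand. rewrite !prodC_rgammaC_full by auto. rewrite E1, E2.
    assert (Hv : rgammaC v <> 0%C).
    { apply rgammaC_neq_0. simpl. apply (Rmult_lt_compat_l (INR q)) in Hc; auto. replace (INR q * - / INR q) with (-1) in Hc by (field; lra). lra. }
    (* The powers left by the two multiplication formulas cancel against z^(-s) down to x^(al v) and
       a constant; z has this form for that reason. *)
    assert (E3 : (/ cpow (INR q) v * cpow (INR p) (RtoC al * v + RtoC (1 - al)) * cpow z (- s))%C
                 = (RtoC (INR p / INR q * exp (- (al * ln x))) * cexp (RtoC (al * ln x) * v))%C).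
    { rewrite !cpow_cexp, <- cexp_opp, Hz.
      rewrite <- (exp_ln (INR p / INR q)) by (apply Rdiv_lt_0_compat; auto).
      rewrite <- exp_plus, <- cexp_R, <- !cexp_add, ln_div by auto. f_equal. unfold al.
      apply C_ext; simpl; field; lra. }
    rewrite !RtoC_mult, RtoC_div by lra.
    transitivity (RtoC kap * (RtoC (mulc p) / RtoC (mulc q)) * (/ rgammaC v * rgammaC (RtoC al * v + RtoC (1 - al))) *
       (/ cpow (INR q) v * cpow (INR p) (RtoC al * v + RtoC (1 - al)) * cpow z (- s)))%C.
    + field. repeat split; auto; [apply cpow_neq_0 | apply RtoC_neq_0; lra].
    + rewrite E3, !RtoC_mult, (RtoC_div (INR p)) by lra. ring.
Qed.

(** For an integer l = L the multiplication formula also resolves 1/Gamma(L s + 1). The factor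
    Gamma(s + 1) cancels, which lowers the order of the Fox function, and L^(-L s) goes into its
    argument. *)
Lemma H_integrand_int (p q L : nat) (z : R) (s : C) :
  (0 < p)%nat -> (1 < q)%nat -> (1 <= L)%nat -> (L <= q)%nat -> - / INR q < Re s -> 0 < z ->
  (/ prodC (map (fun k => rgammaC (s + RtoC (INR k / INR q))) (seq 1 (q - 1))) *
   (prodC (map (fun k => rgammaC (s + RtoC (INR k / INR L))) (seq 1 (L - 1))) *
    prodC (map (fun k => rgammaC (RtoC (INR L) * s + RtoC (INR k / INR p))) (seq 1 (p - 1)))) *
   cpow (z * Rpower (INR L) (INR L)) (- s))%C
  = (RtoC (mulc L * INR L) * H_integrand p q (INR L) z s)%C.
Proof.
  intros Hp Hq HL HLq Hs Hz. assert (Q : 1 < INR q) by (apply (lt_INR 1); auto).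
  assert (PL : 1 <= INR L) by (apply (le_INR 1); auto). assert (LQ : INR L <= INR q) by (apply le_INR; auto).
  assert (Hq1 : / INR q < 1) by (rewrite <- Rinv_1; apply Rinv_lt_contravar; lra).
  (* L <= q and Re s > -1/q keep L s + 1 in the right half plane. *)
  assert (HLc : - 1 < INR L * Re s).
  { assert (INR L * / INR q <= 1) by (apply (Rle_div_l (INR L)); lra).
    assert (INR L * - / INR q < INR L * Re s) by (apply Rmult_lt_compat_l; lra). lra. }
  assert (N1 : rgammaC (s + 1) <> 0%C) by (apply rgammaC_neq_0; destruct s; simpl in *; lra).
  assert (N2 : rgammaC (RtoC (INR L) * s + 1) <> 0%C).
  { apply rgammaC_neq_0. destruct s; simpl in *. replace (INR L * r - 0 * r0 + 1) with (INR L * r + 1) by ring. lra. }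
  assert (N3 : prodC (map (fun k => rgammaC (s + RtoC (INR k / INR q))) (seq 1 (q - 1))) <> 0%C).
  { assert (A : forall l, (forall k, In k l -> (1 <= k)%nat) -> prodC (map (fun k => rgammaC (s + RtoC (INR k / INR q))) l) <> 0%C).
    { induction l; intros Hl; [apply RtoC_neq_0; lra|]. simpl. apply Cmult_neq_0.
      - apply rgammaC_neq_0. assert (1 <= INR a) by (apply (le_INR 1), Hl; simpl; auto).
        assert (/ INR q <= INR a / INR q).
        { unfold Rdiv. rewrite <- (Rmult_1_l (/ INR q)) at 1. apply Rmult_le_compat_r; auto. apply Rlt_le, Rinv_0_lt_compat; lra. }
        destruct s; simpl in *. lra.
      - apply IHl. intros; apply Hl; simpl; auto. }
    apply A. intros k Hk. apply in_seq in Hk. lia. }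
  assert (E := prodC_rgammaC_full L s HL).
  unfold H_integrand. set (PL' := prodC (map (fun k => rgammaC (s + RtoC (INR k / INR L))) (seq 1 (L - 1)))) in *.
  set (Pq := prodC (map (fun k => rgammaC (s + RtoC (INR k / INR q))) (seq 1 (q - 1)))) in *.
  set (Pp := prodC _).
  assert (E' : PL' = (RtoC (mulc L) * cpow (INR L) (RtoC (INR L) * s + 1) * rgammaC (RtoC (INR L) * s + 1) / rgammaC (s + 1))%C).
  { rewrite <- E. field. auto. }
  rewrite E', cpow_mult by (auto; apply exp_pos).
  assert (E4 : (cpow (INR L) (RtoC (INR L) * s + 1) * cpow (Rpower (INR L) (INR L)) (- s))%C = RtoC (INR L)).
  { rewrite !cpow_cexp, <- cexp_add. unfold Rpower. rewrite ln_exp.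
    transitivity (cexp (RtoC (ln (INR L)))); [|rewrite cexp_R, exp_ln; auto; lra].
    f_equal. rewrite RtoC_mult. ring. }
  set (A := cpow (INR L) _) in *. set (B := cpow (Rpower (INR L) (INR L)) _) in *.
  replace (RtoC (mulc L * INR L)) with (RtoC (mulc L) * (A * B))%C by (rewrite E4, RtoC_mult; reflexivity).
  field. auto.
Qed.

(** * Residue series *)

Lemma Series_0 (a : nat -> R) : (forall n, a n = 0) -> Series a = 0.
Proof.
  intros H. rewrite (Series_ext _ (fun n => 0 * a n)) by (intros; rewrite H; ring). rewrite Series_scal_l. ring.
Qed.

(** Sums of exactly n terms, so that the first q n terms form n full blocks; [sum_n] has one term
    more. *)
Fixpoint sumn (f : nat -> R) (n : nat) : R :=
  match n with 0%nat => 0 | S k => sumn f k + f k end.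

Lemma sum_n_sumn (f : nat -> R) (n : nat) : sum_n f n = sumn f (S n).
Proof.
  induction n; [rewrite sum_O; simpl; ring|]. rewrite sum_Sn, IHn. reflexivity.
Qed.

Lemma is_series_sumn (f : nat -> R) (l : R) : is_series f l <-> is_lim_seq (sumn f) l.
Proof.
  split; intros H.
  - apply is_lim_seq_incr_1. apply is_lim_seq_ext with (sum_n f); [intros; apply sum_n_sumn | exact H].
  - apply is_lim_seq_incr_1 in H. assert (H' : is_lim_seq (sum_n f) l); [|exact H'].
    apply is_lim_seq_ext with (fun n => sumn f (S n)); auto. intros; symmetry; apply sum_n_sumn.
Qed.

Definition sumR (l : list R) : R := fold_right Rplus 0 l.

Lemma sumR_app (a b : list R) : sumR (a ++ b) = sumR a + sumR b.
Proof. induction a; simpl; [ring|]. rewrite IHa. unfold sumR; simpl; ring. Qed.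

(** A residue class modulo q, not a residue of a function. Terms outside the class become 0 instead
    of being dropped, so that the parts of different classes add up termwise. *)
Definition residue_part (q j : nat) (v : nat -> R) (k : nat) : R :=
  if Nat.eqb (k mod q) j then v k else 0.

Lemma residue_part_le (q j : nat) (v M : nat -> R) (k : nat) :
  (forall k, Rabs (v k) <= M k) -> Rabs (residue_part q j v k) <= M k.
Proof.
  intros H. unfold residue_part. destruct (Nat.eqb _ _); auto.
  rewrite Rabs_R0. eapply Rle_trans; [apply Rabs_pos | apply H].
Qed.

Lemma sumn_residue_part (q j : nat) (v : nat -> R) (n : nat) : (j < q)%nat ->
  sumn (residue_part q j v) (q * n) = sumn (fun i => v (q * i + j)%nat) n.
Proof.
  intros Hj.
  assert (A : forall n m, (m <= q)%nat -> sumn (residue_part q j v) (q * n + m) =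
     sumn (residue_part q j v) (q * n) + (if Nat.ltb j m then v (q * n + j)%nat else 0)).
  { intros i. induction m; intros Hm; [rewrite Nat.add_0_r; simpl; ring|].
    rewrite Nat.add_succ_r. simpl sumn. rewrite IHm by lia. unfold residue_part at 2.
    replace ((q * i + m) mod q)%nat with m.
    2: { symmetry. rewrite (Nat.mul_comm q i), Nat.add_comm, Nat.Div0.mod_add. apply Nat.mod_small. lia. }
    destruct (Nat.eqb_spec m j) as [->|Ne].
    - destruct (Nat.ltb_spec j j); [lia|]. destruct (Nat.ltb_spec j (S j)); [ring | lia].
    - destruct (Nat.ltb_spec j m); destruct (Nat.ltb_spec j (S m)); try lia; ring. }
  induction n; [rewrite Nat.mul_0_r; reflexivity|].
  rewrite Nat.mul_succ_r, A, IHn by lia. destruct (Nat.ltb_spec j q); [reflexivity | lia].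
Qed.

(** The partial sums over one class are the partial sums of the padded series along the subsequence
    q n, and the padded series converges by domination. *)
Lemma Series_residue_part (q j : nat) (v M : nat -> R) : (j < q)%nat -> ex_series M -> (forall k, Rabs (v k) <= M k) ->
  Series (fun n => v (q * n + j)%nat) = Series (residue_part q j v).
Proof.
  intros Hj EM HM. apply is_series_unique, is_series_sumn.
  assert (E : ex_series (residue_part q j v)).
  { apply (ex_series_le (V := R_CompleteNormedModule) _ M); auto. intros k; apply residue_part_le; auto. }
  assert (L := proj1 (is_series_sumn _ _) (Series_correct _ E)).
  apply is_lim_seq_ext with (fun n => sumn (residue_part q j v) (q * n)); [intros; apply sumn_residue_part; auto|].
  apply (is_lim_seq_subseq (sumn (residue_part q j v)) _ (fun n => (q * n)%nat)); auto.
  apply eventually_subseq_loc. exists 0%nat. intros; nia.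
Qed.

Lemma Series_regroup (q : nat) (v M : nat -> R) : (0 < q)%nat -> ex_series M -> (forall k, Rabs (v k) <= M k) ->
  sumR (map (fun j => Series (fun n => v (q * n + j)%nat)) (seq 0 q)) = Series v.
Proof.
  intros Hq EM HM.
  assert (A : forall m, (m <= q)%nat -> sumR (map (fun j => Series (fun n => v (q * n + j)%nat)) (seq 0 m)) =
     Series (fun k => if Nat.ltb (k mod q) m then v k else 0)).
  { induction m; intros Hm.
    - simpl. symmetry. apply Series_0. reflexivity.
    - rewrite seq_S, map_app, sumR_app, IHm by lia. simpl. rewrite Rplus_0_r, (Series_residue_part q m v M) by (auto; lia).
      rewrite <- Series_plus.
      + apply Series_ext. intros k. unfold residue_part.
        destruct (Nat.ltb_spec (k mod q) m); destruct (Nat.eqb_spec (k mod q) m); destruct (Nat.ltb_spec (k mod q) (S m)); try lia; ring.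
      + apply (ex_series_le (V := R_CompleteNormedModule) _ M); auto. intros k. change (Rabs (if Nat.ltb (k mod q) m then v k else 0) <= M k).
        destruct (Nat.ltb _ _); auto. rewrite Rabs_R0. eapply Rle_trans; [apply Rabs_pos | apply HM].
      + apply (ex_series_le (V := R_CompleteNormedModule) _ M); auto. intros k; apply residue_part_le; auto. }
  rewrite A by auto. apply Series_ext. intros k.
  destruct (Nat.ltb_spec (k mod q) q) as [L|L]; auto. exfalso. assert (H := Nat.mod_upper_bound k q). lia.
Qed.

(** Since the term k = 0 vanishes, the classes can be numbered 1 to q; class q holds the positive
    multiples of q. *)
Lemma levy_regroup (al x : R) (q : nat) : 0 < al < 1 -> (0 < q)%nat ->
  Series (levy_term al 0 x) = sumR (map (fun j => Series (fun n => levy_term al 0 x (q * n + j))) (seq 1 q)).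
Proof.
  intros Hal Hq. destruct (levy_term_dominated al 0 x Hal (Rle_refl 0)) as [M [EM HM]].
  rewrite Series_incr_1.
  2: { apply (ex_series_le (V := R_CompleteNormedModule) _ M); auto. }
  rewrite levy_term_0, Rplus_0_l.
  rewrite <- (Series_regroup q (fun k => levy_term al 0 x (S k)) (fun k => M (S k)) Hq).
  - rewrite <- seq_shift, map_map. f_equal. apply map_ext. intros j. apply Series_ext. intros n. f_equal. lia.
  - apply (ex_series_incr_1 M); auto.
  - intros; apply HM.
Qed.

Lemma prodR_map_inv {A : Type} (f : A -> R) (l : list A) : prodR (map (fun a => / f a) l) = / prodR (map f l).
Proof.
  induction l; [unfold prodR; simpl; now rewrite Rinv_1|]. rewrite !map_cons, !prodR_cons, IHl, Rinv_mult. reflexivity.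
Qed.

Lemma Wright_R (a b : list (R * R)) (z : R) :
  Wright a b z = RtoC (Series (fun n => / prodR (map (fun pr => rgam (fst pr + snd pr * INR n)) a)
                          * prodR (map (fun pr => rgam (fst pr + snd pr * INR n)) b) * (z ^ n / INR (fact n)))).
Proof.
  assert (E : forall n, (prodC (map (fun pr => GammaC (RtoC (fst pr + snd pr * INR n))) a)
      * prodC (map (fun pr => rgammaC (RtoC (fst pr + snd pr * INR n))) b) * RtoC (z ^ n / INR (fact n)))%C
      = RtoC (/ prodR (map (fun pr => rgam (fst pr + snd pr * INR n)) a)
                          * prodR (map (fun pr => rgam (fst pr + snd pr * INR n)) b) * (z ^ n / INR (fact n)))).
  { intros n. rewrite (prodC_ext _ (fun pr => RtoC (/ rgam (fst pr + snd pr * INR n)))) by (intros; apply GammaC_R).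
    rewrite (prodC_ext (fun pr => rgammaC _) (fun pr => RtoC (rgam (fst pr + snd pr * INR n)))) by (intros; apply rgammaC_R).
    rewrite !prodC_RtoC, <- !RtoC_mult, prodR_map_inv. reflexivity. }
  assert (P2 : forall a b c : R, a = c -> b = 0 -> (a, b) = RtoC c) by (intros; subst; reflexivity).
  unfold Wright, CSeries. apply P2.
  - apply Series_ext. intros n. rewrite E. reflexivity.
  - apply Series_0. intros n. rewrite E. reflexivity.
Qed.

(* The [N]-th residue, written with the Gamma quotients of the series of the theorem. *)
Lemma levy_term_residue (p q j n : nat) (l x : R) : (0 < p)%nat -> (1 <= j <= q)%nat -> 0 < l -> 0 < x ->
  let N := (q * n + j)%nat in
  let f := fun k => rgam ((INR k - INR j) / INR q - INR n) in
  let zeta := - (l * INR N / INR q) in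
  let al := INR p * l / INR q in
  Kcst p q l x * (/ (prodR (map f (seq 1 (j - 1))) * prodR (map f (seq (S j) (q - j))))
    * (rgam (zeta + 1) * prodR (map (fun k => rgam (zeta + INR k / INR p)) (seq 1 (p - 1))))
    * ((-1) ^ n / INR (fact n) * exp (al * INR N * (ln (INR p) - ln x) - INR N * ln (INR q))))
  = / x * levy_term al 0 x N.
Proof.
  intros Hp Hj Hl Hx N f zeta al.
  assert (P : 0 < INR p) by (apply lt_0_INR; auto). assert (Q : 0 < INR q) by (apply lt_0_INR; lia).
  assert (Mp := mulc_pos p). assert (Mq := mulc_pos q).
  assert (HN : exists m, N = S m) by (exists (N - 1)%nat; unfold N; lia). destruct HN as [m Hm].
  assert (E1 := rgam_multiplication_residue q j n Hj). cbv zeta in E1. fold f N in E1.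
  rewrite prodR_rgam_full by auto.
  replace (INR p * zeta + 1) with (1 - al * INR N) by (unfold zeta, al; field; lra).
  set (X := prodR _ * prodR _) in *.
  assert (F := INR_fact_lt_0 n). assert (Fm := INR_fact_lt_0 m).
  replace (N - 1)%nat with m in E1 by lia.
  assert (Sg : forall i, ((-1) ^ i) * ((-1) ^ i) = 1).
  { intros i. rewrite <- Rpow_mult_distr. replace (-1 * -1) with 1 by ring. apply pow1. }
  assert (Sn := Sg n). assert (Sm := Sg m).
  assert (Rq : 0 < Rpower (INR q) (1 - INR N)) by apply exp_pos.
  set (Y := mulc q * Rpower (INR q) (1 - INR N) * INR q * ((-1) ^ m * INR (fact m))) in *.
  assert (NY : Y <> 0).
  { unfold Y. assert ((-1) ^ m <> 0) by (apply pow_nonzero; lra).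
    assert (0 < mulc q * Rpower (INR q) (1 - INR N)) by (apply Rmult_lt_0_compat; auto).
    assert (0 < mulc q * Rpower (INR q) (1 - INR N) * INR q) by (apply Rmult_lt_0_compat; auto).
    intros E0. apply Rmult_integral in E0. destruct E0 as [E0|E0]; [lra|].
    apply Rmult_integral in E0. destruct E0 as [E0|E0]; [auto | lra]. }
  assert (NX : X <> 0) by (intro E0; rewrite E0, Rmult_0_r in E1; auto).
  (* The multiplication formula at the pole trades the Gamma product together with n! for (N -
     1)!. *)
  assert (EX : / X * ((-1) ^ n / INR (fact n)) = / Y).
  { rewrite <- E1. replace ((-1) ^ n / INR (fact n)) with (/ ((-1) ^ n * INR (fact n))).
    - field. repeat split; auto; try lra. apply pow_nonzero; lra.
    - set (s := (-1) ^ n) in *. assert (Ns : s <> 0) by (intro E0; rewrite E0 in Sn; lra).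
      transitivity (/ s * / INR (fact n)); [field; split; [lra | auto]|].
      replace (/ s) with (s * s * / s) by (rewrite Sn; ring). field. split; [lra | auto]. }
  (* The factor - al N of the functional equation turns (-1)^N / N! into al (-1)^(N-1) / (N-1)!,
     which matches [Y]. *)
  unfold levy_term. rewrite (rgam_succ (0 - al * INR N)).
  replace (0 - al * INR N + 1) with (1 - al * INR N) by ring.
  set (r := rgam (1 - al * INR N)).
  match goal with |- ?K * (/ X * (?a * ?b * r) * (?c * ?e)) = _ =>
    replace (K * (/ X * (a * b * r) * (c * e))) with (K * a * INR p * (/ X * c) * (b * e / INR p) * r) by (field; lra) end.
  rewrite EX, Kcst_mulc by (auto; lia).
  assert (EE : Rpower (INR p) (1 - al * INR N) * exp (al * INR N * (ln (INR p) - ln x) - INR N * ln (INR q)) / INR p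
      = Rpower (INR q) (1 - INR N) / INR q * exp (- (al * ln x) * INR N)).
  { unfold Rpower. rewrite <- exp_plus.
    assert (Ip : / INR p = exp (- ln (INR p))) by (rewrite exp_Ropp, exp_ln; auto).
    assert (Iq : / INR q = exp (- ln (INR q))) by (rewrite exp_Ropp, exp_ln; auto).
    unfold Rdiv. rewrite Ip, Iq, <- !exp_plus. f_equal. ring. }
  rewrite EE. unfold Y.
  assert (Fm1 : INR (fact N) = INR N * INR (fact m)) by (rewrite Hm; change (fact (S m)) with (S m * fact m)%nat; apply mult_INR).
  assert (HNp : 0 < INR N) by (rewrite Hm; apply INR_S_pos).
  assert (Hs : (-1) ^ N = - (-1) ^ m) by (rewrite Hm; simpl; ring).
  rewrite Hs, Fm1. set (sm := (-1) ^ m) in *.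
  assert (Nsm : sm <> 0) by (intro E0; rewrite E0 in Sm; lra).
  assert (Ism : / sm = sm) by (apply (Rmult_eq_reg_l sm); auto; rewrite Rinv_r; auto).
  transitivity (mulc q * INR q * (INR p * l) / x * (/ (mulc q * Rpower (INR q) (1 - INR N) * INR q * INR (fact m)) * / sm)
     * (Rpower (INR q) (1 - INR N) / INR q * exp (- (al * ln x) * INR N)) * r).
  { field. repeat split; auto; lra. }
  rewrite Ism. unfold al. field. repeat split; lra.
Qed.

(** The prefactor of (iii), and for L = 1 that of (ii). *)
Definition Kint (p q L : nat) (x : R) : R :=
  sqrt (INR p * INR q * INR L) / (x * Rpower (2 * PI) ((INR q + 1 - INR p - INR L) / 2)).

Lemma Kint_Kcst (p q L : nat) (x : R) : (0 < L)%nat -> 0 < x ->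
  Kint p q L x * (mulc L * INR L) = Kcst p q (INR L) x.
Proof.
  intros HL Hx. assert (P := pos_INR p). assert (Q := pos_INR q). assert (PL : 0 < INR L) by (apply lt_0_INR; auto).
  unfold Kint, Kcst, mulc. rewrite Rpower_half by auto. rewrite (sqrt_mult (INR p * INR q)) by nra.
  replace ((INR q - INR p) / 2) with ((INR q + 1 - INR p - INR L) / 2 + - ((1 - INR L) / 2)) by field.
  rewrite Rpower_plus, Rpower_Ropp. assert (SL := sqrt_lt_R0 _ PL).
  assert (R1 : 0 < Rpower (2 * PI) ((1 - INR L) / 2)) by apply exp_pos.
  assert (R2 : 0 < Rpower (2 * PI) ((INR q + 1 - INR p - INR L) / 2)) by apply exp_pos.
  field. repeat split; lra.
Qed.

Lemma levy_term_residue_int (p q L j n : nat) (x : R) : (0 < p)%nat -> (1 <= j < q)%nat -> (0 < L)%nat -> 0 < x ->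
  let N := (q * n + j)%nat in
  let f := fun k => rgam ((INR k - INR j) / INR q - INR n) in
  let l := INR L in
  let al := INR p * l / INR q in
  Kint p q L x * (/ (prodR (map f (seq 1 (j - 1))) * prodR (map f (seq (S j) (q - 1 - j))))
    * (prodR (map (fun k => rgam (- (INR N / INR q) + INR k / l)) (seq 1 (L - 1))) *
       prodR (map (fun k => rgam (- (l * INR N / INR q) + INR k / INR p)) (seq 1 (p - 1))))
    * ((-1) ^ n / INR (fact n) * (exp (al * INR N * (ln (INR p) - ln x) - INR N * ln (INR q)) * Rpower l (l * INR N / INR q))))
  = / x * levy_term al 0 x N.
Proof.
  intros Hp Hj HL Hx N f l al.
  assert (Q : 0 < INR q) by (apply lt_0_INR; lia). assert (PL : 0 < l) by (apply lt_0_INR; auto).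
  assert (R := levy_term_residue p q j n l x Hp ltac:(lia) PL Hx). cbv zeta in R. fold N f al in R.
  rewrite <- R. clear R.
  replace (Kcst p q l x) with (Kint p q L x * (mulc L * l)) by apply (Kint_Kcst p q L x HL Hx).
  assert (E := prodR_rgam_full L (- (INR N / INR q)) HL). fold l in E.
  replace (l * - (INR N / INR q)) with (- (l * INR N / INR q)) in E by (field; lra).
  (* As 1 <= j < q, the number N is not divisible by q, so 1 - N/q is no pole of Gamma and this
     factor can be cancelled. *)
  assert (Nr : rgam (- (INR N / INR q) + 1) <> 0).
  { apply rgam_neq_0. intros m Em.
    assert (INR N = INR (q * (m + 1))).
    { rewrite mult_INR, plus_INR. simpl (INR 1). apply (f_equal (fun z => INR q * z)) in Em.
      replace (INR q * (- (INR N / INR q) + 1)) with (- INR N + INR q) in Em by (field; lra). lra. }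
    apply INR_eq in H. unfold N in H.
    destruct (Nat.le_gt_cases n m) as [D|D].
    - assert (A := Nat.mul_le_mono_l (n + 1) (m + 1) q ltac:(lia)). lia.
    - assert (A := Nat.mul_le_mono_l (m + 1) n q ltac:(lia)). lia. }
  replace (seq (S j) (q - j)) with (seq (S j) (q - 1 - j) ++ [q]).
  2: { replace (q - j)%nat with (S (q - 1 - j)) by lia. rewrite seq_S. repeat f_equal. lia. }
  rewrite map_app, prodR_app. simpl (prodR (map f [q])).
  assert (Ef : f q = rgam (- (INR N / INR q) + 1)).
  { unfold f, N. f_equal. rewrite plus_INR, mult_INR. field. lra. }
  rewrite Ef. set (r1 := rgam (- (INR N / INR q) + 1)) in *.
  set (PL' := prodR (map (fun k => rgam (- (INR N / INR q) + INR k / l)) (seq 1 (L - 1)))) in *.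
  assert (E' : PL' = mulc L * Rpower l (- (l * INR N / INR q) + 1) * rgam (- (l * INR N / INR q) + 1) / r1).
  { rewrite <- E. field. auto. }
  rewrite E', Rpower_plus, Rpower_Ropp, Rpower_1, !Rinv_mult, Rinv_1 by auto.
  assert (R1 : 0 < Rpower l (l * INR N / INR q)) by apply exp_pos.
  set (F1 := prodR (map f (seq 1 (j - 1)))). set (F2 := prodR (map f (seq (S j) (q - 1 - j)))).
  assert (Fn := INR_fact_lt_0 n). unfold Rdiv. set (i1 := / F1). set (i2 := / F2).
  field. repeat split; auto; lra.
Qed.

(** The jump function is made to leave out one index: for i <= j the argument is (k - j)/q with k =
    i - 1, for i > j it is the same with k = i, so k runs through 1 to q - 1 without j. *)
Lemma jump_prod (q j : nat) (h : R -> R) : (1 <= j < q)%nat ->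
  prodR (map (fun i => h (INR i / INR q - jump q j i)) (range 2 (q - 1)))
  = prodR (map (fun k => h ((INR k - INR j) / INR q)) (seq 1 (j - 1))) *
    prodR (map (fun k => h ((INR k - INR j) / INR q)) (seq (S j) (q - 1 - j))).
Proof.
  intros Hj. assert (Q : 0 < INR q) by (apply lt_0_INR; lia). unfold range.
  replace (seq 2 (S (q - 1) - 2)) with (seq 2 (j - 1) ++ seq (2 + (j - 1)) (q - 1 - j)).
  2: { rewrite <- seq_app. f_equal. lia. }
  rewrite map_app, prodR_app. f_equal.
  - rewrite <- seq_shift, map_map. f_equal. apply map_ext_in. intros k Hk. apply in_seq in Hk. f_equal.
    unfold jump. destruct (Nat.ltb_spec j (S k)); [lia|]. rewrite S_INR. field. lra.
  - replace (2 + (j - 1))%nat with (S j) by lia. f_equal. apply map_ext_in. intros k Hk. apply in_seq in Hk. f_equal.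
    unfold jump. destruct (Nat.ltb_spec j k); [|lia]. field. lra.
Qed.

Lemma prodn_S_l (f : nat -> R) (n : nat) : prodn f (S n) = f 0%nat * prodn (fun k => f (S k)) n.
Proof. induction n; [simpl; ring|]. change (prodn f (S (S n))) with (prodn f (S n) * f (S n)). rewrite IHn. simpl. ring. Qed.

Lemma prodn_rev (f : nat -> R) (n : nat) : prodn f n = prodn (fun k => f (n - 1 - k)%nat) n.
Proof.
  revert f. induction n; intros f; [reflexivity|].
  rewrite (prodn_S_l (fun k => f (S n - 1 - k)%nat)).
  change (prodn f (S n)) with (prodn f n * f n). rewrite (IHn f), Rmult_comm.
  f_equal; [f_equal; lia|].
  assert (E : forall m, prodn (fun k => f (n - 1 - k)%nat) m = prodn (fun k => f (S n - 1 - S k)%nat) m).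
  { induction m; [reflexivity|]. cbn [prodn]. rewrite IHm. do 2 f_equal. lia. }
  apply E.
Qed.

Lemma prodR_seq_1 (f : nat -> R) (n : nat) : prodR (map f (seq 1 n)) = prodn (fun k => f (S k)) n.
Proof.
  induction n; [reflexivity|]. rewrite seq_S, map_app, prodR_app, IHn. simpl. ring.
Qed.

(** Reversal k -> q - k. The first Wright function lists the parameters of the class j = q in this
    order. *)
Lemma prodR_reflect (q : nat) (h : R -> R) : (0 < q)%nat ->
  prodR (map (fun k => h (- (INR k / INR q))) (seq 1 (q - 1))) = prodR (map (fun k => h ((INR k - INR q) / INR q)) (seq 1 (q - 1))).
Proof.
  intros Hq. assert (Q : 0 < INR q) by (apply lt_0_INR; lia). rewrite !prodR_seq_1, prodn_rev.
  assert (E : forall m, (m <= q - 1)%nat -> prodn (fun k => h (- (INR (S (q - 1 - 1 - k)) / INR q))) m = prodn (fun k => h ((INR (S k) - INR q) / INR q)) m).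
  { induction m; intros Hm; [reflexivity|]. cbn [prodn]. rewrite IHm by lia. do 2 f_equal.
    replace (S (q - 1 - 1 - m)) with (q - S m)%nat by lia. rewrite minus_INR by lia. field. lra. }
  apply E. auto.
Qed.

Lemma Rpower_quot (P x Q a : R) (j : nat) : 0 < P -> 0 < x -> 0 < Q ->
  Rpower P a / (Rpower x a * Q ^ j) = exp (a * (ln P - ln x) - INR j * ln Q).
Proof.
  intros HP Hx HQ. rewrite <- Rpower_pow by auto. unfold Rpower, Rminus.
  rewrite exp_plus, exp_Ropp, Rmult_plus_distr_l, exp_plus, Ropp_mult_distr_r_reverse, exp_Ropp.
  assert (E1 := exp_pos (a * ln x)). assert (E2 := exp_pos (INR j * ln Q)). field. lra.
Qed.

Lemma exp_pow_nat (a : R) (n : nat) : exp a ^ n = exp (INR n * a).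
Proof. rewrite <- Rpower_pow by apply exp_pos. unfold Rpower. now rewrite ln_exp. Qed.

Lemma opp_pow (z : R) (n : nat) : (- z) ^ n = (-1) ^ n * z ^ n.
Proof. rewrite <- Rpow_mult_distr. f_equal. ring. Qed.

(** Descending by n reverses the n factors and their signs; this is how Gamma quotients with step -1
    become Pochhammer symbols. *)
Lemma rgam_sub_INR (r : R) (n : nat) : rgam (r - INR n) = rgam r * ((-1) ^ n * poch (1 - r) n).
Proof.
  rewrite (rgam_poch (r - INR n) n). replace (r - INR n + INR n) with r by ring.
  assert (E := poch_rev (r - 1) n). replace (r - 1 + 1 - INR n) with (r - INR n) in E by ring. rewrite E.
  rewrite poch_prodn, <- prodn_const, <- prodn_mult, Rmult_comm. f_equal.
  induction n; [reflexivity|]. simpl.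
  assert (E' := poch_rev (r - 1) n). replace (r - 1 + 1 - INR n) with (r - INR n) in E' by ring.
  rewrite (IHn E'). f_equal. ring.
Qed.

Lemma prodR_rgam_sub_INR {A : Type} (g : A -> R) (l : list A) (n : nat) :
  prodR (map (fun a => rgam (g a - INR n)) l)
  = prodR (map (fun a => rgam (g a)) l) * (((-1) ^ n) ^ length l * prodR (map (fun a => poch (1 - g a) n) l)).
Proof.
  induction l; [unfold prodR; simpl; ring|]. rewrite !map_cons, !prodR_cons, IHl, rgam_sub_INR. simpl. ring.
Qed.

Lemma sumC_scal (a : C) {A : Type} (f : A -> C) (l : list A) :
  (a * sumC (map f l))%C = sumC (map (fun i => a * f i)%C l).
Proof. induction l; simpl; [ring|]. rewrite <- IHl. ring. Qed.

Lemma sumC_RtoC {A : Type} (f : A -> R) (l : list A) : sumC (map (fun i => RtoC (f i)) l) = RtoC (sumR (map f l)).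
Proof. induction l; simpl; [reflexivity|]. rewrite IHl, <- RtoC_plus. reflexivity. Qed.

Lemma sumR_scal {A : Type} (a : R) (f : A -> R) (l : list A) : a * sumR (map f l) = sumR (map (fun i => a * f i) l).
Proof. induction l; simpl; [ring|]. rewrite <- IHl. ring. Qed.

Lemma levy_regroup_value (al x : R) (q : nat) (G : nat -> C) : 0 < al < 1 -> (0 < q)%nat ->
  (forall j, (1 <= j < q)%nat -> G j = RtoC (Series (fun n => / x * levy_term al 0 x (q * n + j)))) ->
  RtoC (/ x * Series (levy_term al 0 x)) =
  (sumC (map G (range 1 (q - 1))) + RtoC (Series (fun n => / x * levy_term al 0 x (q * n + q))%R))%C.
Proof.
  intros Hal Hq HG. rewrite (levy_regroup al x q) by auto.
  replace (seq 1 q) with (seq 1 (q - 1) ++ [q]).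
  2: { replace (seq 1 q) with (seq 1 (S (q - 1))) by (f_equal; lia). rewrite seq_S. repeat f_equal. lia. }
  rewrite map_app, sumR_app. simpl (sumR (map _ [q])).
  rewrite Rplus_0_r, Rmult_plus_distr_l, RtoC_plus, Series_scal_l. f_equal.
  unfold range. replace (S (q - 1) - 1)%nat with (q - 1)%nat by lia.
  rewrite sumR_scal, <- sumC_RtoC. f_equal. apply map_ext_in. intros j Hj. apply in_seq in Hj.
  rewrite HG by lia. rewrite Series_scal_l. reflexivity.
Qed.

(** * Matching the statement with the normal forms *)

Lemma alpha_ell (p q l1 l2 : nat) : (0 < p)%nat -> (0 < l1)%nat -> (0 < l2)%nat -> (p < q)%nat ->
  alpha_of p q l1 l2 = INR p * ell_of p q l1 l2 / INR q /\ 0 < ell_of p q l1 l2 /\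
  0 < alpha_of p q l1 l2 < 1 /\ INR p * ell_of p q l1 l2 < INR q.
Proof.
  intros Hp Hl1 Hl2 Hpq.
  assert (P : 0 < INR p) by (apply lt_0_INR; auto). assert (PQ : INR p < INR q) by (apply lt_INR; auto).
  assert (H1 : 0 < INR l1) by (apply lt_0_INR; auto). assert (H2 : 0 < INR l2) by (apply lt_0_INR; auto).
  assert (E : alpha_of p q l1 l2 = INR p * ell_of p q l1 l2 / INR q).
  { unfold alpha_of, ell_of. unfold Rminus. rewrite Rpower_plus, Rpower_Ropp, Rpower_1 by (apply Rdiv_lt_0_compat; lra).
    field. lra. }
  assert (L : 0 < ell_of p q l1 l2) by apply exp_pos.
  assert (A : 0 < alpha_of p q l1 l2 < 1).
  { split; [apply exp_pos|]. unfold alpha_of, Rpower. rewrite <- exp_0. apply exp_increasing.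
    assert (ln (INR p / INR q) < 0).
    { rewrite <- ln_1. apply ln_increasing; [apply Rdiv_lt_0_compat; lra|]. apply Rlt_div_l; lra. }
    assert (0 < INR l2 / INR l1) by (apply Rdiv_lt_0_compat; auto). nra. }
  repeat split; try apply A; auto.
  destruct A as [_ A]. rewrite E in A. apply Rlt_div_l in A; lra.
Qed.

Lemma prodC_GammaC {A : Type} (g : A -> C) (l : list A) :
  prodC (map (fun a => GammaC (g a)) l) = (/ prodC (map (fun a => rgammaC (g a)) l))%C.
Proof. unfold GammaC. rewrite <- prodC_inv, map_map. reflexivity. Qed.

Lemma range_1 (n : nat) : (0 < n)%nat -> range 1 (n - 1) = seq 1 (n - 1).
Proof. intros. unfold range. f_equal. lia. Qed.

Lemma Hfox_line (m : nat) (a b : list (R * R)) (c z : R) : length b = m ->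
  Hfox m 0 a b c z = MB_line (fun s =>
    (/ prodC (map (fun pr => rgammaC (RtoC (fst pr) + RtoC (snd pr) * s)) b) *
     prodC (map (fun pr => rgammaC (RtoC (fst pr) + RtoC (snd pr) * s)) a) * cpow z (- s))%C) c.
Proof.
  intros Hm. unfold Hfox. rewrite firstn_all2, skipn_all2 by lia. simpl firstn. simpl skipn.
  apply (f_equal (fun F => MB_line F c)). apply functional_extensionality. intros s. rewrite prodC_GammaC. simpl map. unfold prodC at 2 3. simpl. ring.
Qed.

(** In the Fox functions considered here the pole s = -1/q, from the parameter 1/q, is the rightmost
    one to be left of the contour. *)
Lemma H_contour_gt (q m n : nat) (a b : list (R * R)) (c : R) : (1 < q)%nat -> (length b <= m)%nat ->
  In (INR 1 / INR q, 1) b -> H_contour m n a b c -> - / INR q < c.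
Proof.
  intros Hq Hm HI [H _]. assert (Q : 0 < INR q) by (apply lt_0_INR; lia).
  specialize (H (INR 1 / INR q, 1)). rewrite firstn_all2 in H by auto. specialize (H HI). simpl in H.
  unfold Rdiv in H. lra.
Qed.

Lemma In_range_1 (q : nat) : (1 < q)%nat -> In (INR 1 / INR q, 1) (map (fun k => (INR k / INR q, 1)) (range 1 (q - 1))).
Proof. intros Hq. apply (in_map (fun k => (INR k / INR q, 1))). rewrite range_1 by lia. apply in_seq. lia. Qed.

Lemma map_pair_rgammaC (n : nat) (l : R) (s : C) (r : list nat) :
  prodC (map (fun pr => rgammaC (RtoC (fst pr) + RtoC (snd pr) * s)) (map (fun k => (INR k / INR n, l)) r))
  = prodC (map (fun k => rgammaC (RtoC l * s + RtoC (INR k / INR n))) r).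
Proof. rewrite map_map. apply prodC_ext. intros k _. simpl. f_equal. ring. Qed.

Lemma map_pair_rgammaC_1 (n : nat) (s : C) (r : list nat) :
  prodC (map (fun pr => rgammaC (RtoC (fst pr) + RtoC (snd pr) * s)) (map (fun k => (INR k / INR n, 1)) r))
  = prodC (map (fun k => rgammaC (s + RtoC (INR k / INR n))) r).
Proof. rewrite map_map. apply prodC_ext. intros k _. simpl. f_equal. ring. Qed.

Lemma ln_z_quot (P x Q a : R) (q : nat) : 0 < P -> 0 < x -> 0 < Q ->
  ln (Rpower P a / (Rpower x a * Q ^ q)) = a * ln P - a * ln x - INR q * ln Q.
Proof. intros. rewrite Rpower_quot by auto. rewrite ln_exp. ring. Qed.

Lemma levy_Hfox (p q : nat) (l x c0 c : R) : (0 < p)%nat -> (p < q)%nat -> 0 < l -> INR p * l < INR q -> 0 < x ->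
  0 < c0 < INR p * l / INR q ->
  let z := Rpower (INR p) (INR p * l) / (Rpower x (INR p * l) * INR q ^ q) in
  let aH := (1, l) :: map (fun k => (INR k / INR p, l)) (range 1 (p - 1)) in
  let bH := (1, 1) :: map (fun k => (INR k / INR q, 1)) (range 1 (q - 1)) in
  H_contour q 0 aH bH c ->
  levy (INR p * l / INR q) c0 x = (RtoC (Kcst p q l x) * Hfox q 0 aH bH c z)%C.
Proof.
  intros Hp Hpq Hl Hlt Hx Hc0 z aH bH Hc.
  assert (P : 0 < INR p) by (apply lt_0_INR; auto). assert (Q : 0 < INR q) by (apply lt_0_INR; lia).
  assert (Hal : 0 < INR p * l / INR q < 1).
  { split; [apply Rdiv_lt_0_compat; nra|]. apply Rlt_div_l; lra. }
  assert (Lb : length bH = q) by (unfold bH; simpl; rewrite length_map, range_1, length_seq; lia).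
  rewrite levy_series, Hfox_line by auto.
  rewrite (MB_line_H p q l x z c 1); auto; try lia.
  - f_equal. ring.
  - apply (H_contour_gt q q 0 aH bH c); auto; try lia. right. apply In_range_1. lia.
  - apply ln_z_quot; auto.
  - intros t. unfold H_integrand, aH, bH. rewrite !map_cons.
    change (prodC (?a :: ?r)) with (a * prodC r)%C.
    rewrite (map_pair_rgammaC p l), map_pair_rgammaC_1, !range_1 by lia. cbn [fst snd].
    rewrite !(Cplus_comm (RtoC 1)). rewrite !Cmult_1_l. reflexivity.
Qed.

(** The integrand here is [mulc L * INR L] times the one of (i). This constant changes the prefactor
    [Kint] into [Kcst] and is cancelled at the end. *)
Lemma levy_Hfox_int (p q L : nat) (x c0 c z : R) (aH : list (R * R)) : (0 < p)%nat -> (p < q)%nat -> (1 <= L)%nat ->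
  INR p * INR L < INR q -> 0 < x -> 0 < c0 < INR p * INR L / INR q ->
  z = Rpower (INR p) (INR p * INR L) / (Rpower x (INR p * INR L) * INR q ^ q) * Rpower (INR L) (INR L) ->
  aH = map (fun k => (INR k / INR L, 1)) (range 1 (L - 1)) ++ map (fun k => (INR k / INR p, INR L)) (range 1 (p - 1)) ->
  let bH := map (fun k => (INR k / INR q, 1)) (range 1 (q - 1)) in
  H_contour (q - 1) 0 aH bH c ->
  levy (INR p * INR L / INR q) c0 x = (RtoC (Kint p q L x) * Hfox (q - 1) 0 aH bH c z)%C.
Proof.
  intros Hp Hpq HL Hlt Hx Hc0 Hz HaH bH Hc.
  assert (P : 0 < INR p) by (apply lt_0_INR; auto). assert (Q : 0 < INR q) by (apply lt_0_INR; lia).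
  assert (PL : 0 < INR L) by (apply lt_0_INR; lia).
  assert (Hal : 0 < INR p * INR L / INR q < 1).
  { split; [apply Rdiv_lt_0_compat; nra|]. apply Rlt_div_l; lra. }
  assert (HLq : (L <= q)%nat).
  { apply INR_le. assert (1 <= INR p) by (apply (le_INR 1); lia). nra. }
  assert (Lb : length bH = (q - 1)%nat) by (unfold bH; rewrite length_map, range_1, length_seq; lia).
  assert (Hcq : - / INR q < c).
  { apply (H_contour_gt q (q - 1) 0 aH bH c); auto; try lia. apply In_range_1. lia. }
  set (z0 := Rpower (INR p) (INR p * INR L) / (Rpower x (INR p * INR L) * INR q ^ q)) in *.
  assert (Hz0 : 0 < z0) by (unfold z0; rewrite Rpower_quot by auto; apply exp_pos).
  rewrite levy_series, Hfox_line by auto.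
  assert (M := mulc_pos L).
  match goal with |- _ = (_ * MB_line ?F c)%C =>
    assert (E := MB_line_H p q (INR L) x z0 c (mulc L * INR L) F Hp ltac:(lia) PL Hlt Hx Hcq (ln_z_quot _ _ _ _ _ P Hx Q)) end.
  rewrite <- (Kint_Kcst p q L x) in E by (auto; lia). rewrite (RtoC_mult (Kint p q L x)) in E.
  assert (HF := fun H => E H). clear E.
  match type of HF with ?A -> _ => assert (HA : A) end.
  { intros t. rewrite <- H_integrand_int; auto; try lia. rewrite HaH, map_app, prodC_app. unfold bH.
    rewrite (map_pair_rgammaC p (INR L)), !map_pair_rgammaC_1, !range_1, Hz by lia. reflexivity. }
  specialize (HF HA). rewrite (RtoC_mult (mulc L * INR L)) in HF.
  assert (Nm : RtoC (mulc L * INR L) <> 0%C) by (apply RtoC_neq_0; assert (0 < mulc L * INR L) by (apply Rmult_lt_0_compat; auto); lra).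
  match type of HF with (?K * ?m * ?I)%C = (?m * ?V)%C =>
    transitivity (/ m * (m * V))%C; [field; exact Nm | rewrite <- HF; field; exact Nm] end.
Qed.

Lemma Wright_levy_int (p q L j : nat) (x z co : R) (a b : list (R * R)) : (0 < p)%nat -> (1 <= j < q)%nat -> (0 < L)%nat -> 0 < x ->
  let l := INR L in let P := INR p in let Q := INR q in
  z = Rpower P (P * l) * Rpower l l / (Rpower x (P * l) * Q ^ q) ->
  co = Rpower P (INR j * l * P / Q) * Rpower l (INR j * l / Q) / (Rpower x (INR j * l * P / Q) * Q ^ j) ->
  a = map (fun i => (INR i / Q - jump q j i, -1)) (range 2 (q - 1)) ->
  b = map (fun k => ((INR k * Q - INR j * l) / (l * Q), -1)) (range 1 (L - 1)) ++
      map (fun k => ((INR k * Q - INR j * P * l) / (P * Q), - l)) (range 1 (p - 1)) ->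
  forall n, Kint p q L x * (co * (/ prodR (map (fun pr => rgam (fst pr + snd pr * INR n)) a)
                          * prodR (map (fun pr => rgam (fst pr + snd pr * INR n)) b) * ((- z) ^ n / INR (fact n))))
   = / x * levy_term (P * l / Q) 0 x (q * n + j).
Proof.
  intros Hp Hj HL Hx l P Q Hz Hco Ha Hb n.
  assert (PP : 0 < P) by (apply lt_0_INR; auto). assert (PQ : 0 < Q) by (apply lt_0_INR; lia).
  assert (PL : 0 < l) by (apply lt_0_INR; auto).
  assert (R := levy_term_residue_int p q L j n x Hp Hj HL Hx). cbv zeta in R. fold l P Q in R. rewrite <- R. clear R.
  set (N := (q * n + j)%nat).
  assert (HN : INR N = Q * INR n + INR j) by (unfold N, Q; rewrite plus_INR, mult_INR; auto).
  assert (Ea : prodR (map (fun pr => rgam (fst pr + snd pr * INR n)) a) =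
    prodR (map (fun k => rgam ((INR k - INR j) / Q - INR n)) (seq 1 (j - 1))) *
    prodR (map (fun k => rgam ((INR k - INR j) / Q - INR n)) (seq (S j) (q - 1 - j)))).
  { rewrite Ha, map_map. cbn [fst snd].
    rewrite (map_ext _ (fun i => rgam (INR i / Q - jump q j i - INR n))) by (intros; f_equal; ring).
    apply (jump_prod q j (fun r => rgam (r - INR n)) Hj). }
  assert (Eb : prodR (map (fun pr => rgam (fst pr + snd pr * INR n)) b) =
    prodR (map (fun k => rgam (- (INR N / Q) + INR k / l)) (seq 1 (L - 1))) *
    prodR (map (fun k => rgam (- (l * INR N / Q) + INR k / P)) (seq 1 (p - 1)))).
  { rewrite Hb, map_app, prodR_app, !map_map, !range_1 by lia. cbn [fst snd]. f_equal; f_equal; apply map_ext; intros k; f_equal;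
      rewrite HN; field; lra. }
  assert (Ez : co * (- z) ^ n = (-1) ^ n * (exp (P * l / Q * INR N * (ln P - ln x) - INR N * ln Q) * Rpower l (l * INR N / Q))).
  { replace z with (Rpower P (P * l) / (Rpower x (P * l) * Q ^ q) * Rpower l l).
    2: { rewrite Hz. assert (0 < Rpower x (P * l)) by apply exp_pos. assert (0 < Q ^ q) by (apply pow_lt; auto). field. lra. }
    replace co with (Rpower P (INR j * l * P / Q) / (Rpower x (INR j * l * P / Q) * Q ^ j) * Rpower l (INR j * l / Q)).
    2: { rewrite Hco. assert (0 < Rpower x (INR j * l * P / Q)) by apply exp_pos. assert (0 < Q ^ j) by (apply pow_lt; auto). field. lra. }
    rewrite !Rpower_quot, opp_pow by auto. unfold Rpower. rewrite <- !exp_plus, exp_pow_nat.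
    rewrite (Rmult_comm (exp _)), Rmult_assoc, <- exp_plus. do 2 f_equal. rewrite HN. fold Q. field. lra. }
  rewrite Ea, Eb. set (A := prodR _ * prodR _). set (B := prodR _ * prodR _).
  assert (F := INR_fact_lt_0 n).
  transitivity (Kint p q L x * (/ A * B * (co * (- z) ^ n / INR (fact n)))); [unfold Rdiv; ring|].
  rewrite Ez. unfold Rdiv. ring.
Qed.

(** The upper parameters enter through their product only, so that one lemma covers j < q and the
    differently written list of the class j = q. *)
Lemma Wright_levy (p q j : nat) (l x z co : R) (a b : list (R * R)) : (0 < p)%nat -> (1 <= j <= q)%nat -> 0 < l -> 0 < x ->
  let P := INR p in let Q := INR q in
  z = Rpower P (P * l) / (Rpower x (P * l) * Q ^ q) ->
  co = Rpower P (INR j * l * P / Q) / (Rpower x (INR j * l * P / Q) * Q ^ j) ->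
  (forall n, prodR (map (fun pr => rgam (fst pr + snd pr * INR n)) a) =
    prodR (map (fun k => rgam ((INR k - INR j) / Q - INR n)) (seq 1 (j - 1))) *
    prodR (map (fun k => rgam ((INR k - INR j) / Q - INR n)) (seq (S j) (q - j)))) ->
  b = ((P * Q - INR j * P * l) / (P * Q), - l) :: map (fun k => ((INR k * Q - INR j * P * l) / (P * Q), - l)) (range 1 (p - 1)) ->
  forall n, Kcst p q l x * (co * (/ prodR (map (fun pr => rgam (fst pr + snd pr * INR n)) a)
                          * prodR (map (fun pr => rgam (fst pr + snd pr * INR n)) b) * ((- z) ^ n / INR (fact n))))
   = / x * levy_term (P * l / Q) 0 x (q * n + j).
Proof.
  intros Hp Hj Hl Hx P Q Hz Hco Ha Hb n.
  assert (PP : 0 < P) by (apply lt_0_INR; auto). assert (PQ : 0 < Q) by (apply lt_0_INR; lia).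
  assert (R := levy_term_residue p q j n l x Hp Hj Hl Hx). cbv zeta in R. fold P Q in R. rewrite <- R. clear R.
  set (N := (q * n + j)%nat).
  assert (HN : INR N = Q * INR n + INR j) by (unfold N, Q; rewrite plus_INR, mult_INR; auto).
  assert (Eb : prodR (map (fun pr => rgam (fst pr + snd pr * INR n)) b) =
    rgam (- (l * INR N / Q) + 1) * prodR (map (fun k => rgam (- (l * INR N / Q) + INR k / P)) (seq 1 (p - 1)))).
  { rewrite Hb, map_cons, prodR_cons, !map_map, !range_1 by lia. cbn [fst snd]. f_equal; f_equal; [|apply map_ext; intros k; f_equal];
      rewrite HN; field; lra. }
  assert (Ez : co * (- z) ^ n = (-1) ^ n * exp (P * l / Q * INR N * (ln P - ln x) - INR N * ln Q)).
  { rewrite Hz, Hco, !Rpower_quot, opp_pow by auto. rewrite exp_pow_nat.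
    rewrite (Rmult_comm (exp _)), Rmult_assoc, <- exp_plus. do 2 f_equal. rewrite HN. fold Q. field. lra. }
  rewrite Ha, Eb. set (A := prodR _ * prodR _). set (B := rgam _ * prodR _).
  assert (F := INR_fact_lt_0 n).
  transitivity (Kcst p q l x * (/ A * B * (co * (- z) ^ n / INR (fact n)))); [unfold Rdiv; ring|].
  rewrite Ez. unfold Rdiv. ring.
Qed.

(** For integer l the class q meets 1/Gamma at the integers - p L (n + 1), where it vanishes. Hence
    (ii) and (iii) lack the first Wright function of (i). *)
Lemma levy_term_int_0 (p q L n : nat) (x : R) : (0 < q)%nat ->
  levy_term (INR p * INR L / INR q) 0 x (q * n + q) = 0.
Proof.
  intros Hq. assert (Q : 0 < INR q) by (apply lt_0_INR; auto). unfold levy_term.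
  replace (0 - INR p * INR L / INR q * INR (q * n + q)) with (- INR (p * L * (n + 1))).
  - rewrite rgam_opp_INR. ring.
  - rewrite !mult_INR, !plus_INR, mult_INR. simpl (INR 1). field. lra.
Qed.

Lemma levy_int_series (p q L : nat) (x c0 : R) (G : nat -> C) : (0 < p)%nat -> (0 < q)%nat -> (0 < L)%nat ->
  INR p * INR L < INR q -> 0 < x -> 0 < c0 < INR p * INR L / INR q ->
  (forall j, (1 <= j < q)%nat ->
     (RtoC (Kint p q L x) * G j)%C = RtoC (Series (fun n => / x * levy_term (INR p * INR L / INR q) 0 x (q * n + j)))) ->
  levy (INR p * INR L / INR q) c0 x = (RtoC (Kint p q L x) * sumC (map G (range 1 (q - 1))))%C.
Proof.
  intros Hp Hq HL Hlt Hx Hc0 HG.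
  assert (P : 0 < INR p) by (apply lt_0_INR; auto). assert (Q : 0 < INR q) by (apply lt_0_INR; lia).
  assert (PL : 0 < INR L) by (apply lt_0_INR; lia).
  assert (Hal : 0 < INR p * INR L / INR q < 1).
  { split; [apply Rdiv_lt_0_compat; nra|]. apply Rlt_div_l; lra. }
  rewrite levy_series, (levy_regroup_value _ x q (fun j => RtoC (Kint p q L x) * G j)%C), sumC_scal by auto.
  rewrite (Series_0 (fun n => / x * _)) by (intros n; rewrite levy_term_int_0 by auto; ring). ring.
Qed.

(** Each of the q - 2 upper and p - 1 lower Gamma factors contributes (-1)^n, and - z one more; q +
    p - 2 has the parity of q - p, which gives the sign in the argument. *)
Lemma Wright_hyperF (p q j : nat) (z : R) : (0 < p)%nat -> (p < q)%nat ->
  let P := INR p in let Q := INR q in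
  let r := fun i => INR i / Q - jump q j i in
  let d := fun k => (INR k * Q - INR j * P) / (P * Q) in
  forall n,
  / prodR (map (fun i => rgam (r i - INR n)) (range 2 (q - 1))) *
  prodR (map (fun k => rgam (d k - INR n)) (range 1 (p - 1))) * ((- z) ^ n / INR (fact n)) =
  / prodR (map (fun i => rgam (r i)) (range 2 (q - 1))) * prodR (map (fun k => rgam (d k)) (range 1 (p - 1))) *
  (prodR (map (fun y => poch y n) (map (fun k => 1 - d k) (range 1 (p - 1)))) /
   prodR (map (fun y => poch y n) (map (fun i => 1 - INR i / Q + jump q j i) (range 2 (q - 1)))) / INR (fact n) *
   ((-1) ^ (q - p) * z) ^ n).
Proof.
  intros Hp Hpq P Q r d n. rewrite !prodR_rgam_sub_INR, !map_map.
  rewrite (map_ext (fun i => poch (1 - INR i / Q + jump q j i) n) (fun i => poch (1 - r i) n)) by (intros; unfold r; f_equal; ring).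
  replace (length (range 2 (q - 1))) with (q - 2)%nat by (unfold range; rewrite length_seq; lia).
  replace (length (range 1 (p - 1))) with (p - 1)%nat by (unfold range; rewrite length_seq; lia).
  assert (Ec : ((-1) ^ (q - p)) ^ n = ((-1) ^ n) ^ (q - p)) by (rewrite <- !pow_mult; f_equal; lia).
  rewrite opp_pow, Rpow_mult_distr, Ec.
  set (s := (-1) ^ n).
  assert (Hs : s * s = 1) by (unfold s; rewrite <- Rpow_mult_distr; replace (-1 * -1) with 1 by ring; apply pow1).
  assert (Ns : s <> 0) by (intro E0; rewrite E0 in Hs; lra).
  assert (Is : / s = s) by (apply (Rmult_eq_reg_l s); auto; rewrite Rinv_r; auto).
  assert (Sg : / s ^ (q - 2) * s ^ (p - 1) * s = s ^ (q - p)).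
  { rewrite <- pow_inv, Is, <- pow_add, (Rmult_comm _ s), tech_pow_Rmult.
    replace (S (q - 2 + (p - 1))) with (q - p + 2 * (p - 1))%nat by lia.
    rewrite pow_add, pow_mult. replace (s ^ 2) with 1 by (rewrite <- Hs; ring). rewrite pow1. ring. }
  rewrite <- Sg, !Rinv_mult. unfold Rdiv. ring.
Qed.

Theorem theorem2p1 (p q l1 l2 : nat)
  (hp : (0 < p)%nat) (hq : (0 < q)%nat) (hl1 : (0 < l1)%nat) (hl2 : (0 < l2)%nat)
  (hpq : (p < q)%nat) :
  let alpha := alpha_of p q l1 l2 in
  let l := ell_of p q l1 l2 in
  let P := INR p in
  let Q := INR q in
  (* (i) l not a positive integer, l1 <> l2 *)
  ((~ exists k : nat, (0 < k)%nat /\ l = INR k) -> l1 <> l2 ->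
   forall x : R, 0 < x -> forall c0 : R, 0 < c0 < alpha ->
   let z := Rpower P (P * l) / (Rpower x (P * l) * Q ^ q) in
   let K := l * sqrt (P * Q) / (x * Rpower (2 * PI) ((Q - P) / 2)) in
   let aH := (1, l) :: map (fun k => (INR k / P, l)) (range 1 (p - 1)) in
   let bH := (1, 1) :: map (fun k => (INR k / Q, 1)) (range 1 (q - 1)) in
   (forall c : R, H_contour q 0 aH bH c ->
      levy alpha c0 x = Cmult (RtoC K) (Hfox q 0 aH bH c z)) /\
   levy alpha c0 x =
     Cmult (RtoC K)
       (Cplus
         (Cmult (RtoC z)
            (Wright (map (fun k => (- (INR k / Q), -1)) (range 1 (q - 1)))
                    ((1 - l, - l) ::
                       map (fun k => ((INR k * Q - P * l * Q) / (P * Q), - l)) (range 1 (p - 1)))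
                    (- z)))
         (sumC (map (fun j =>
            Cmult (RtoC (Rpower P (INR j * l * P / Q) / (Rpower x (INR j * l * P / Q) * Q ^ j)))
              (Wright ((1 - jump q j q, -1) ::
                         map (fun i => (INR i / Q - jump q j i, -1)) (range 2 (q - 1)))
                      (((P * Q - INR j * P * l) / (P * Q), - l) ::
                         map (fun k => ((INR k * Q - INR j * P * l) / (P * Q), - l)) (range 1 (p - 1)))
                      (- z)))
            (range 1 (q - 1))))))
  /\
  (* (ii) l = 1, l1 = l2 *)
  (l = 1 -> l1 = l2 ->
   forall x : R, 0 < x -> forall c0 : R, 0 < c0 < alpha ->
   let z := P ^ p / (x ^ p * Q ^ q) in
   let K := sqrt (P * Q) / (x * Rpower (2 * PI) ((Q - P) / 2)) in
   let aH := map (fun k => (INR k / P, 1)) (range 1 (p - 1)) in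
   let bH := map (fun k => (INR k / Q, 1)) (range 1 (q - 1)) in
   (forall c : R, H_contour (q - 1) 0 aH bH c ->
      levy alpha c0 x = Cmult (RtoC K) (Hfox (q - 1) 0 aH bH c z)) /\
   levy alpha c0 x =
     Cmult (RtoC K)
       (sumC (map (fun j =>
          Cmult (Cmult (Cmult
            (RtoC (Rpower P (INR j * P / Q) / (Rpower x (INR j * P / Q) * Q ^ j)))
            (prodC (map (fun i1 => GammaC (RtoC (INR i1 / Q - jump q j i1))) (range 2 (q - 1)))))
            (prodC (map (fun i2 => rgammaC (RtoC ((INR i2 * Q - INR j * P) / (P * Q)))) (range 1 (p - 1)))))
            (RtoC (hyperF (map (fun k => 1 - (INR k * Q - INR j * P) / (P * Q)) (range 1 (p - 1)))
                          (map (fun i => 1 - INR i / Q + jump q j i) (range 2 (q - 1)))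
                          ((-1) ^ (q - p) * z))))
          (range 1 (q - 1)))))
  /\
  (* (iii) l in {2,3,...}, l1 <> l2 *)
  (forall L : nat, (2 <= L)%nat -> l = INR L -> l1 <> l2 ->
   forall x : R, 0 < x -> forall c0 : R, 0 < c0 < alpha ->
   let z := Rpower P (P * l) * Rpower l l / (Rpower x (P * l) * Q ^ q) in
   let K := sqrt (P * Q * l) / (x * Rpower (2 * PI) ((Q + 1 - P - l) / 2)) in
   let aH := map (fun k => (INR k / l, 1)) (range 1 (L - 1)) ++
             map (fun k => (INR k / P, l)) (range 1 (p - 1)) in
   let bH := map (fun k => (INR k / Q, 1)) (range 1 (q - 1)) in
   (forall c : R, H_contour (q - 1) 0 aH bH c ->
      levy alpha c0 x = Cmult (RtoC K) (Hfox (q - 1) 0 aH bH c z)) /\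
   levy alpha c0 x =
     Cmult (RtoC K)
       (sumC (map (fun j =>
          Cmult
            (RtoC (Rpower P (INR j * l * P / Q) * Rpower l (INR j * l / Q)
                   / (Rpower x (INR j * l * P / Q) * Q ^ j)))
            (Wright (map (fun i => (INR i / Q - jump q j i, -1)) (range 2 (q - 1)))
                    (map (fun k => ((INR k * Q - INR j * l) / (l * Q), -1)) (range 1 (L - 1)) ++
                     map (fun k => ((INR k * Q - INR j * P * l) / (P * Q), - l)) (range 1 (p - 1)))
                    (- z)))
          (range 1 (q - 1))))).
Proof.
  intros alpha l P Q.
  destruct (alpha_ell p q l1 l2 hp hl1 hl2 hpq) as [Ea [Hl [Hal Hlt]]]. fold alpha l P Q in Ea, Hl, Hal, Hlt. clearbody alpha l.
  assert (PP : 0 < P) by (apply lt_0_INR; auto). assert (PQ : 0 < Q) by (apply lt_0_INR; auto).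
  split; [|split].
  - intros _ _ x Hx c0 Hc0 z K aH bH. rewrite Ea in Hc0 |- *. split.
    { intros c Hc. apply levy_Hfox; auto. }
    rewrite levy_series by (auto; rewrite <- Ea; auto).
    rewrite Cmult_plus_distr_l, sumC_scal.
    erewrite (levy_regroup_value (P * l / Q) x q); [|rewrite <- Ea; auto|auto|].
    + rewrite Cplus_comm. f_equal. rewrite Wright_R, <- !RtoC_mult. f_equal. rewrite <- !Series_scal_l.
      apply Series_ext. intros n. symmetry.
      (* The class j = q is the first Wright function; its coefficient is z itself. *)
      apply (Wright_levy p q q l x z z); auto; try lia.
      * unfold z. fold P Q. replace (Q * l * P / Q) with (P * l) by (field; lra). reflexivity.
      * intros m. rewrite map_map, Nat.sub_diag, range_1 by auto. cbn [fst snd].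
        rewrite (map_ext _ (fun k => rgam (- (INR k / Q) - INR m))) by (intros; f_equal; ring).
        assert (Er := prodR_reflect q (fun r => rgam (r - INR m)) hq). cbv beta in Er. fold Q in Er. rewrite Er. simpl (seq (S q) 0). simpl (prodR (map _ [])). fold Q. ring.
      * fold P Q. f_equal; [f_equal; field; lra|]. apply map_ext. intros k. f_equal. field. lra.
    + intros j Hj. cbv beta. rewrite Wright_R, <- !RtoC_mult. f_equal. rewrite <- !Series_scal_l.
      apply Series_ext. intros n.
      apply (Wright_levy p q j l x z); auto; try lia.
      intros m. rewrite map_cons, prodR_cons, map_map. cbn [fst snd].
      rewrite (map_ext _ (fun i => rgam (INR i / Q - jump q j i - INR m))) by (intros; f_equal; ring).
      assert (Ej := jump_prod q j (fun r => rgam (r - INR m)) Hj). cbv beta in Ej. fold Q in Ej. rewrite Ej.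
      replace (seq (S j) (q - j)) with (seq (S j) (q - 1 - j) ++ [q]).
      2: { replace (q - j)%nat with (S (q - 1 - j)) by lia. rewrite seq_S. repeat f_equal. lia. }
      rewrite map_app, prodR_app. simpl (prodR (map _ [q])).
      replace (1 - jump q j q + -1 * INR m) with ((Q - INR j) / Q - INR m).
      2: { unfold jump. destruct (Nat.ltb_spec j q); [|lia]. fold Q. field. lra. }
      fold Q. ring.
  - intros El _ x Hx c0 Hc0 z K aH bH. subst l.
    (* Case (ii) is the integral case with L = 1, where the parameters belonging to L form an empty
       list. *)
    change 1 with (INR 1) in Ea, Hlt. rewrite Ea in Hc0 |- *.
    assert (HK : K = Kint p q 1 x).
    { unfold K, Kint. fold P Q. simpl (INR 1). rewrite Rmult_1_r. do 3 f_equal. field. }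
    assert (Hz1 : z = Rpower P (P * INR 1) / (Rpower x (P * INR 1) * Q ^ q)).
    { unfold z. simpl (INR 1). rewrite Rmult_1_r. unfold P at 3 4. rewrite !Rpower_pow by auto. reflexivity. }
    assert (R1 : forall a, Rpower (INR 1) a = 1).
    { intros a. unfold Rpower. simpl (INR 1). rewrite ln_1, Rmult_0_r. apply exp_0. }
    rewrite HK. split.
    { intros c Hc. apply levy_Hfox_int; auto; try lia. rewrite R1, Rmult_1_r. exact Hz1. }
    apply levy_int_series; auto; try lia. intros j Hj.
    rewrite (prodC_ext (fun i1 => GammaC _) (fun i1 => RtoC (/ rgam (INR i1 / Q - jump q j i1)))) by (intros; apply GammaC_R).
    rewrite (prodC_ext (fun i2 => rgammaC _) (fun i2 => RtoC (rgam ((INR i2 * Q - INR j * P) / (P * Q))))) by (intros; apply rgammaC_R).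
    rewrite !prodC_RtoC, prodR_map_inv, <- !RtoC_mult. f_equal. unfold hyperF. rewrite <- !Series_scal_l.
    apply Series_ext. intros n.
    set (co := Rpower P (INR j * P / Q) / (Rpower x (INR j * P / Q) * Q ^ j)).
    (* The hypergeometric terms are recognised as Wright terms for L = 1; the comparison with the
       density is then the same as in (iii). *)
    rewrite <- (Wright_levy_int p q 1 j x z co _ _ hp Hj ltac:(lia) Hx) with (4 := eq_refl) (3 := eq_refl).
    + fold P Q. f_equal. assert (Eh := Wright_hyperF p q j z hp hpq n). cbv zeta in Eh. fold P Q in Eh.
      match type of Eh with _ = ?rhs => transitivity (co * rhs); [unfold Rdiv; ring|] end.
      f_equal. rewrite <- Eh. simpl (range 1 (1 - 1)). cbn [app map]. rewrite !map_map. cbn [fst snd].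
      f_equal. f_equal.
      * do 2 f_equal. apply map_ext. intros i. f_equal. ring.
      * change (range 1 0) with (@nil nat). rewrite map_app, !map_map. f_equal. cbn [map app]. apply map_ext. intros k. cbn [fst snd]. f_equal. simpl (INR 1). field. lra.
    + fold P Q. rewrite R1, Rmult_1_r. exact Hz1.
    + fold P Q. rewrite R1, Rmult_1_r. simpl (INR 1). rewrite Rmult_1_r. reflexivity.
  - intros L HL El _. subst l. intros x Hx c0 Hc0 z K aH bH. rewrite Ea in Hc0 |- *.
    assert (PL : 0 < INR L) by (apply lt_0_INR; lia).
    split.
    { intros c Hc. apply levy_Hfox_int; auto; try lia. unfold z. fold P Q.
      assert (0 < Rpower x (P * INR L)) by apply exp_pos. assert (0 < Q ^ q) by (apply pow_lt; auto). field. lra. }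
    apply levy_int_series; auto; try lia. intros j Hj.
    rewrite Wright_R, <- !RtoC_mult. f_equal. rewrite <- !Series_scal_l.
    apply Series_ext. intros n. apply Wright_levy_int; auto. lia.
Qed.
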